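(* Let $(\bar{\boldsymbol x}(\cdot),\bar{\boldsymbol p}(\cdot))=\gamma(\cdot,\bar{\boldsymbol q})$ on $[0,t_f]$ be the nominal extremal and let $t_0\in[0,t_f)$. Suppose that along the nominal extremal on $[t_0,t_f]$ there are $k\in\mathbb N$ switching times $t_0<t_1<\dots<t_k<t_f$ and that each switching point is regular, i.e. $H_1(\bar{\boldsymbol x}(t_i),\bar{\boldsymbol p}(t_i))=0$ and $\dot H_1(\bar{\boldsymbol x}(t_i),\bar{\boldsymbol p}(t_i))\neq 0$ for $i=1,\dots,k$. Suppose that for every time $s\in[0,t_f)$ and every actual state $\boldsymbol x_*\in\mathcal X\setminus\mathcal M$ under consideration near $\bar{\boldsymbol x}(s)$ there is at least one point $\boldsymbol x_f\in\mathcal M$ with $t_f-s\ge t_m^*(\boldsymbol x_*,\boldsymbol x_f)$. Assume moreover that, for the subset $\mathcal N$ small enough, (1) $\det\left[\frac{\partial \boldsymbol x}{\partial \boldsymbol q}(t,\bar{\boldsymbol q})\right]\neq 0$ for $t\in[t_0,t_f)$ (at the switching times $t_i$, where this matrix may jump, this is understood for its one-sided limits); (2) $\det\left[\frac{\partial \boldsymbol x}{\partial \boldsymbol q}(t_i^+,\bar{\boldsymbol q})\right]\det\left[\frac{\partial \boldsymbol x}{\partial \boldsymbol q}(t_i^-,\bar{\boldsymbol q})\right]>0$ at each switching time $t_i$, $i=1,\dots,k$, where $t_i^\pm$ denote one-sided limits in time. Then for every $t\in[t_0,t_f)$ and every $\boldsymbol x_*\in\mathcal X\setminus\mathcal M$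 in a sufficiently small neighborhood of $\bar{\boldsymbol x}(t)$ there exists $\boldsymbol q_*\in\boldsymbol F(\mathcal N)$ such that $\boldsymbol x_*=\boldsymbol x(t,\boldsymbol q_* )$.
   Context: Let $n=7$. $\mathbb R^n$ denotes column vectors and $(\mathbb R^n)^*$ row vectors. Constants: $\mu,\beta,u_{max},m_c,r_c,t_f>0$. State and dynamics: $\boldsymbol x=[\boldsymbol r^T\ \boldsymbol v^T\ m]^T$ lies in $\mathcal X=\{(\boldsymbol r,\boldsymbol v,m)\in(\mathbb R^3\setminus\{0\})\times\mathbb R^3\times\mathbb R:\ \|\boldsymbol r\|>r_c,\ \boldsymbol r\times\boldsymbol v\ne0,\ m\ge m_c\}$. The control is $(\rho,\boldsymbol\tau)\in\mathcal T=[0,1]\times\mathbb S^2$. The system $\Sigma$ is $\dot{\boldsymbol x}=\boldsymbol f_0(\boldsymbol x)+\rho\,\boldsymbol f_1(\boldsymbol x,\boldsymbol\tau)$, with $\boldsymbol f_0(\boldsymbol x)=(\boldsymbol v,\,-\mu\boldsymbol r/\|\boldsymbol r\|^3,\,0)$ and $\boldsymbol f_1(\boldsymbol x,\boldsymbol\tau)=(\boldsymbol 0,\ (u_{max}/m)\boldsymbol\tau,\ -\beta u_{max})$. Target: $\mathcal M=\{\boldsymbol x\in\mathcal X:\phi(\boldsymbol x)=0\}$, where $\phi:\mathcal X\to\mathbb R^l$ is twice continuously differentiable and $0<l\le n$. The fuel-optimal problem is to steer $\Sigma$ in time $t_f$, by a measurable control, from a fixed $\boldsymbol x_0\in\mathcal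 X\setminus\mathcal M$ to $\mathcal M$ minimizing $\int_0^{t_f}\rho\,dt$. For $\boldsymbol x_*\in\mathcal X\setminus\mathcal M$ and $\boldsymbol x_f\in\mathcal M$, $t_m^*(\boldsymbol x_*,\boldsymbol x_f)$ is the minimum time to steer $\Sigma$ from $\boldsymbol x_*$ to $\boldsymbol x_f$ by measurable controls with values in $\mathcal T$. Extremals: only normal extremals (cost multiplier $p^0=-1$) are considered. With costate $\boldsymbol p=[\boldsymbol p_r^T\ \boldsymbol p_v^T\ p_m]^T\in\mathbb R^n$ and $h=\boldsymbol p^T[\boldsymbol f_0(\boldsymbol x)+\rho\boldsymbol f_1(\boldsymbol x,\boldsymbol\tau)]-\rho$, an extremal is a solution of $\dot{\boldsymbol x}=\partial h/\partial\boldsymbol p$, $\dot{\boldsymbol p}=-\partial h/\partial\boldsymbol x$, where $(\rho,\boldsymbol\tau)$ maximizes $h$ over $\mathcal T$ at each time, and with transversality condition $\boldsymbol p(t_f)\perp T_{\boldsymbol x(t_f)}\mathcal M$, $\boldsymbol x(t_f)\in\mathcal M$. Maximization gives $\boldsymbol\tau=\boldsymbol p_v/\|\boldsymbol p_v\|$ if $\boldsymbol p_v\ne0$, $\rho=1$ if $H_1>0$ and $\rho=0$ if $H_1<0$, where $H_1(\boldsymbol x,\boldsymbol p)=\boldsymbol p^T\boldsymbol f_1(\boldsymbol x,\boldsymbol\tau(\boldsymbol x,\boldsymbol p))-1$ is the switching function; $\dot H_1$ is its time derivative along the extremal. The control is bang-bang and switching times are the times where $\rho$ switches. $(\boldsymbol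 x,\boldsymbol p)$ is regarded as a point of $T\mathcal X$ (identified with $\mathcal X\times\mathbb R^n$), and $\Pi:T\mathcal X\to\mathcal X$, $\Pi(\boldsymbol x,\boldsymbol p)=\boldsymbol x$. Parameterized family: the nominal extremal $(\bar{\boldsymbol x}(\cdot),\bar{\boldsymbol p}(\cdot))$ on $[0,t_f]$ is a fixed extremal with $\bar{\boldsymbol x}(0)=\boldsymbol x_0$. Standing assumption: $\nabla\phi(\bar{\boldsymbol x}(t_f))$ has full rank. Let $\mathcal L_f=\{(\boldsymbol x,\boldsymbol p)\in T\mathcal X:\boldsymbol x\in\mathcal M,\ \boldsymbol p\perp T_{\boldsymbol x}\mathcal M\}$ (then $n$-dimensional near the nominal endpoint), let $\mathcal N\subset\mathcal L_f$ be a sufficiently small open neighborhood in $\mathcal L_f$ of $(\bar{\boldsymbol x}(t_f),\bar{\boldsymbol p}(t_f))$, and let $\boldsymbol F:\mathcal N\to(\mathbb R^n)^*$ be an invertible map onto its image, smooth with smooth inverse. For $\boldsymbol q\in\boldsymbol F(\mathcal N)$, $\gamma(\cdot,\boldsymbol q)=(\boldsymbol x(\cdot,\boldsymbol q),\boldsymbol p(\cdot,\boldsymbol q)):[0,t_f]\to T\mathcal X$ is the extremal with $\gamma(t_f,\boldsymbol q)=\boldsymbol F^{-1}(\boldsymbol q)$; and $\bar{\boldsymbol q}=\boldsymbol F(\bar{\boldsymbol x}(t_f),\bar{\boldsymbol p}(t_f))$, so the nominal extremal is $\gamma(\cdot,\bar{\boldsymbol q})$. The map $\gamma$ is taken to be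 continuously differentiable in $\boldsymbol q$ on each interval between consecutive switching times; $\partial\boldsymbol x/\partial\boldsymbol q$ may jump at switching times. *)

(* Defs.v *)
From HB Require Import structures.
From mathcomp Require Import all_boot all_order all_algebra.
From mathcomp Require Import all_classical all_reals all_analysis.

Set Implicit Arguments.
Unset Strict Implicit.
Unset Printing Implicit Defensive.

Import Order.TTheory GRing.Theory Num.Theory.
Import numFieldNormedType.Exports.

Local Open Scope classical_set_scope.
Local Open Scope ring_scope.

Section Calculus.
Context {R : realType}.

(* For finite-dimensional V, continuity of every directional derivative is
   continuity of the differential. *)
Definition C1_at (V W : normedModType R) (f : V -> W) (x : V) : Prop :=
  (\forall y \near x, differentiable f y) /\
  forall v, {for x, continuous ('D_v f)}.

Definition C2_at (V W : normedModType R) (f : V -> W) (x : V) : Prop :=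
  C1_at f x /\ forall v, C1_at ('D_v f) x.

Definition grad n (g : 'cV[R]_n -> R) (x : 'cV[R]_n) : 'cV[R]_n :=
  \col_j 'D_(delta_mx j 0) (g : _ -> R^o) x.

Definition dot n (a b : 'cV[R]_n) : R := (a^T *m b) 0 0.

(* The library norm on matrices is the sup norm, hence this one. *)
Definition enorm n (a : 'cV[R]_n) : R := Num.sqrt (dot a a).

(* Indices are taken modulo 3. *)
Definition cross (a b : 'cV[R]_3) : 'cV[R]_3 :=
  \col_i (a (i + 1) 0 * b (i + 2) 0 - a (i + 2) 0 * b (i + 1) 0).

(* y' = g almost everywhere on [0, T] with y absolutely continuous, written in
   integral form; g is only required to be integrable because the controls are
   only measurable. *)
Definition caratheodory n (T : R) (y g : R -> 'cV[R]_n) : Prop :=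
  forall i,
    lebesgue_measure.-integrable `[0, T] (fun s => (g s i 0)%:E) /\
    forall t, 0 <= t <= T ->
      y t i 0 = y 0 i 0 + \int[lebesgue_measure]_(s in `[0, t]) g s i 0.

End Calculus.

Record constants (R : realType) := Constants {
  mu : R;
  beta : R;
  umax : R;
  mc : R;
  rc : R;
  mu_gt0 : 0 < mu;
  beta_gt0 : 0 < beta;
  umax_gt0 : 0 < umax;
  mc_gt0 : 0 < mc;
  rc_gt0 : 0 < rc }.

Section Spacecraft.
Context {R : realType} (c : constants R).
Local Notation state := 'cV[R]_7.

(* 7 is convertible to 3 + 3 + 1, so that a state is a column of blocks. *)
Definition mkstate (r v : 'cV[R]_3) (m : R) : state :=
  col_mx (col_mx r v) (m%:M : 'cV[R]_1).
Definition pos (x : state) : 'cV[R]_3 :=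
  usubmx (usubmx (x : 'cV[R]_(3 + 3 + 1))).
Definition vel (x : state) : 'cV[R]_3 :=
  dsubmx (usubmx (x : 'cV[R]_(3 + 3 + 1))).
Definition mass (x : state) : R := dsubmx (x : 'cV[R]_(3 + 3 + 1)) 0 0.

Definition X : set state :=
  [set x | [/\ pos x != 0, enorm (pos x) > rc c,
               cross (pos x) (vel x) != 0 & mass x >= mc c]].

Definition f0 (x : state) : state :=
  mkstate (vel x) (- (mu c / enorm (pos x) ^+ 3) *: pos x) 0.

Definition f1 (x : state) (tau : 'cV[R]_3) : state :=
  mkstate 0 ((umax c / mass x) *: tau) (- (beta c * umax c)).

Definition admissible (rho : R) (tau : 'cV[R]_3) : Prop :=
  0 <= rho <= 1 /\ enorm tau = 1.

Definition control (T : R) (rho : R -> R) (tau : R -> 'cV[R]_3) : Prop :=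
  [/\ measurable_fun `[0, T] rho,
      forall i, measurable_fun `[0, T] (fun t => tau t i 0) &
      forall t, 0 <= t <= T -> admissible (rho t) (tau t)].

Definition trajectory (T : R) (x : R -> state) (rho : R -> R)
    (tau : R -> 'cV[R]_3) : Prop :=
  [/\ control T rho tau,
      forall t, 0 <= t <= T -> X (x t) &
      caratheodory T x (fun t => f0 (x t) + rho t *: f1 (x t) (tau t))].

Definition steers (T : R) (xs xf : state) : Prop :=
  exists x rho tau, [/\ trajectory T x rho tau, x 0 = xs & x T = xf].

(* +oo when xf cannot be reached from xs *)
Definition tmin (xs xf : state) : \bar R :=
  ereal_inf [set T%:E | T in [set T | 0 <= T /\ steers T xs xf]].

Definition h (x p : state) (rho : R) (tau : 'cV[R]_3) : R :=
  dot p (f0 x + rho *: f1 x tau) - rho.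

(* If vel p = 0 this is 0 rather than a unit vector; dot p (f1 x tau), hence
   H1 below, does not depend on tau in that case. *)
Definition thrust_dir (p : state) : 'cV[R]_3 := (enorm (vel p))^-1 *: vel p.

Definition H1 (x p : state) : R := dot p (f1 x (thrust_dir p)) - 1.

Section Target.
Context (l : nat) (phi : state -> 'cV[R]_l).

Definition M : set state := [set x | X x /\ phi x = 0].

Definition dphi (x : state) : 'M[R]_(l, 7) :=
  \matrix_(i, j) grad (fun y => phi y i 0) x j 0.

(* Tangent space of the level set M, meaningful where dphi x has full rank. *)
Definition tangent (x : state) : set state := [set w | dphi x *m w = 0].

Definition Lf : set (state * state) :=
  [set z | M z.1 /\ forall w, tangent z.1 w -> dot z.2 w = 0].

Definition extremal (tf : R) (x p : R -> state) (rho : R -> R)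
    (tau : R -> 'cV[R]_3) : Prop :=
  [/\ control tf rho tau /\ (forall t, 0 <= t <= tf -> X (x t)),
      caratheodory tf x
        (fun t => grad (fun p' => h (x t) p' (rho t) (tau t)) (p t)),
      caratheodory tf p
        (fun t => - grad (fun x' => h x' (p t) (rho t) (tau t)) (x t)),
      forall t, 0 <= t <= tf -> forall rho' tau', admissible rho' tau' ->
        h (x t) (p t) rho' tau' <= h (x t) (p t) (rho t) (tau t) &
      Lf (x tf, p tf)].

End Target.

Definition bang_bang (tf : R) (rho : R -> R) : Prop :=
  forall t, 0 <= t <= tf -> rho t = 0 \/ rho t = 1.

(* The value of rho at the single instant s is irrelevant. *)
Definition switching_time (tf : R) (rho : R -> R) (s : R) : Prop :=
  0 < s < tf /\ ~ exists a, \forall t \near s^', rho t = a.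

Definition regular_switching (x p : R -> state) (s : R) : Prop :=
  let H1t : R -> R^o := fun t => H1 (x t) (p t) in
  [/\ H1t s = 0, derivable H1t s 1 & 'D_1 H1t s != 0].

(* F is a C1 diffeomorphism of N onto its image, with inverse Finv.  Since N
   need not be open in the ambient space, F is C1 in the sense of local
   extensions.  N being a 7-dimensional manifold, its image is open. *)
Definition chart (N : set (state * state)) (F : state * state -> 'rV[R]_7)
    (Finv : 'rV[R]_7 -> state * state) : Prop :=
  [/\ forall z, N z -> exists2 G : state * state -> 'rV[R]_7,
        C1_at G z & \forall y \near z, N y -> F y = G y,
      forall z, N z -> Finv (F z) = z,
      open (F @` N) &
      forall q, (F @` N) q -> C1_at Finv q].

Definition dxdq (gamma : R -> 'rV[R]_7 -> state * state) (t : R)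
    (q : 'rV[R]_7) : 'M[R]_7 :=
  \matrix_(i, j)
    'D_(delta_mx 0 j) ((fun q' => (gamma t q').1 i 0) : _ -> R^o) q.

End Spacecraft.

(* Main.v *)
(* The switching function H1 is transversal to the nominal extremal at a regular
   switching time s, so every nearby extremal switches exactly once near s, at a
   time s + T(q).  As the mass decreases at the constant rate beta umax exactly
   while the engine is on, T is an affine function of the masses at two times
   around s where the flow is smooth; hence T is strictly differentiable, with no
   need for the implicit function theorem.  Integrating the equations of motion,
     x(s, q) = x(s, qbar) + Jm (q - qbar) - min (T(q), 0) D + small Lipschitz term,
   where D is the jump of the velocity at the switch, and Jp = Jm - D (dT).  With
   k = dT Jm^-1 D, the condition det Jp * det Jm > 0 says 1 - k > 0, which is what
   is needed to rewrite x(s, q) = y as the fixed-point equation of a contraction.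
   Away from the switching times the same argument applies with D = 0. *)
From HB Require Import structures.
Require Import Defs.
From mathcomp Require Import all_boot all_order all_algebra.
From mathcomp Require Import all_classical all_reals all_analysis.
From mathcomp Require Import ring lra.

Set Implicit Arguments.
Unset Strict Implicit.
Unset Printing Implicit Defensive.

Import Order.TTheory GRing.Theory Num.Theory.
Import numFieldNormedType.Exports.
Local Open Scope classical_set_scope.
Local Open Scope ring_scope.

(** * Strict differentiability and local surjectivity *)

Section Strict.
Context {R : realType}.

(** The obstacle is that [gamma s] is not assumed differentiable in the parameter at a switching
    time [s]: it may have a kink where [T] changes sign, and [dxdq] is only described as time tends
    to [s] from either side. All information is therefore collected at times [u < s < w], where
    [gamma] is C1, and carried to [s] by integral estimates. Controls being merely measurable, these
    are mean value inequalities for absolutely continuous functions, uniform in the parameter.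
    Differentiability is taken in two-point form: the remainder is then Lipschitz with an
    arbitrarily small constant near the base point, which is what a contraction consumes and what a
    one-point derivative would not give. The relation between [Jp] and [Jm] comes from comparing two
    extremals at [w] instead of [s], which makes [Jp - Jm + D dT] smaller than every [e]. The role
    of [1 - k > 0]: on solutions, [T = Z + k min (T, 0)] with [Z] made of data and small remainders
    only. Then [T] and [Z] have the same sign and [min (T, 0) = min (Z, 0) / (1 - k)], a single
    formula for both sides of the kink. *)

Definition strict_diff (V : normedModType R) (f d : V -> R) (q : V) : Prop :=
  forall e : R, 0 < e -> exists2 r : R, 0 < r & forall q1 q2 : V,
    `|q1 - q| < r -> `|q2 - q| < r ->
    `|f q1 - f q2 - d (q1 - q2)| <= e * `|q1 - q2|.

Lemma mx_entry_le_norm m n (A : 'M[R]_(m, n)) i j : `|A i j| <= `|A|.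
Proof.
rewrite /Num.norm/= mx_normrE.
exact: (le_bigmax _ (fun ij : 'I_m * 'I_n => `|A ij.1 ij.2|) (i, j)).
Qed.

Lemma mx_norm_le m n (A : 'M[R]_(m, n)) (C : R) : 0 <= C ->
  (forall i j, `|A i j| <= C) -> `|A| <= C.
Proof.
move=> C0 AC; rewrite /Num.norm/= mx_normrE.
by apply: bigmax_le => //= -[i j] _; exact: AC.
Qed.

Lemma ball_seg (V : normedModType R) (q q1 q2 : V) (r t : R) :
  0 <= t <= 1 -> `|q1 - q| < r -> `|q2 - q| < r ->
  `|q2 + t *: (q1 - q2) - q| < r.
Proof.
move=> /andP[t0 t1] h1 h2.
have -> : q2 + t *: (q1 - q2) - q = t *: (q1 - q) + (1 - t) *: (q2 - q).
  have -> : q1 - q = (q1 - q2) + (q2 - q) by rewrite addrA subrK.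
  by rewrite [in RHS]scalerDr -[RHS]addrA -scalerDl subrKC scale1r [RHS]addrC addrAC.
apply: (le_lt_trans (ler_normD _ _)); rewrite !normrZ (ger0_norm t0).
rewrite (@ger0_norm _ (1 - t)) ?subr_ge0//.
(* For [t > 0] strictness comes from the bound on [q1]; at [t = 0] that summand vanishes and the
   bound on [q2] gives it. *)
case: (ltrP 0 t) => [t0'|tn]; last first.
  by have -> : t = 0; [lra | rewrite mul0r add0r subr0 mul1r].
nra.
Qed.

(** Mean value theorem on the segment from [q2] to [q1]: the increment is a derivative at an
    intermediate point, whose partial derivatives are close to those at [q]. The functional [pr]
    makes the function scalar, as the theorem requires. *)
Lemma C1_strict n (W : normedModType R) (f : 'rV[R]_n -> W) (q : 'rV[R]_n)
    (pr : {linear W -> R^o}) : continuous pr -> C1_at f q ->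
  strict_diff (fun y => pr (f y))
    (fun v => \sum_j v 0 j * pr ('D_(delta_mx 0 j) f q)) q.
Proof.
move=> cpr [df cf] e e0.
pose g : 'rV[R]_n -> R^o := pr \o f.
have dpr z : differentiable pr z by apply: linear_differentiable.
have dg y : differentiable f y -> differentiable g y.
  by move=> dfy; exact: differentiable_comp.
have dgv y v : differentiable f y -> 'D_v g y = pr ('D_v f y).
  move=> dfy; rewrite !deriveE//; last exact: dg.
  by rewrite diff_comp//= diff_lin.
have cg j : {for q, continuous (fun y => pr ('D_(delta_mx 0 j) f y))}.
  by apply: continuous_comp; [exact: cf | exact: cpr].
(* The [n] partial derivatives contribute [n * e'] in total; [n.+1] keeps the quotient meaningful
   when [n = 0]. *)
pose e' := e / n.+1%:R.
have e'0 : 0 < e' by rewrite divr_gt0.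
have : \forall y \near q, differentiable f y /\
   forall j, `|pr ('D_(delta_mx 0 j) f q) - pr ('D_(delta_mx 0 j) f y)| < e'.
  near=> y; split; first by near: y.
  near: y; apply: filter_forall => j.
  by move: (cg j) => /cvgrPdist_lt /(_ _ e'0).
move=> /nbhs_ballP[r /= r0 hr].
exists r => // q1 q2 h1 h2.
pose v := q1 - q2; pose s : R -> 'rV[R]_n := fun t => q2 + t *: v.
have hin t : 0 <= t <= 1 -> ball q r (s t).
  by move=> t01; rewrite -ball_normE/= distrC; exact: ball_seg.
have ds (t : R) : is_diff t s (fun h => h *: v).
  have := is_diffD (is_diff_cst q2 t) (is_diff_scalel t v).
  rewrite (_ : cst q2 + _ = s)// => h; apply: is_diff_eq.
  by apply/funext => x; rewrite [LHS]add0r.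
have dphi (t : R) : t \in `]0, 1[ -> is_derive t 1 (g \o s : R -> R^o) ('D_v g (s t)).
  rewrite in_itv/= => /andP[t0 t1]; have t01 : 0 <= t <= 1 by lra.
  have [dft _] := hr _ (hin t t01).
  have dst : differentiable s t by exact: ex_diff.
  have dgs : differentiable (g \o s) t.
    by apply: differentiable_comp => //; exact: dg.
  apply: DeriveDef; first exact: diff_derivable.
  rewrite !deriveE//; last exact: dg.
  rewrite diff_comp//; last exact: dg.
  by rewrite /= diff_val scale1r.
have cphi : {within `[0, 1], continuous (g \o s : R -> R^o)}.
  apply/continuous_in_subspaceT => t; rewrite inE/= in_itv/= => t01.
  apply: differentiable_continuous; apply: differentiable_comp.
    exact: ex_diff.
  by apply: dg; have [] := hr _ (hin t t01).
have [t] := MVT_segment ler01 dphi cphi.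
rewrite in_itv/= => t01.
have [dft hclose] := hr _ (hin t t01).
rewrite /= /s scale1r scale0r addr0 subr0 mulr1 /v subrKC => ->.
rewrite -/v dgv// -/(s t).
have -> : pr ('D_v f (s t)) = \sum_j v 0 j * pr ('D_(delta_mx 0 j) f (s t)).
  rewrite deriveE// {1}[v]row_sum_delta linear_sum/= linear_sum/=.
  by apply: eq_bigr => j _; rewrite !linearZ/= deriveE.
rewrite -sumrB; apply: (le_trans (ler_norm_sum _ _ _)).
apply: (@le_trans _ _ (\sum_(j < n) e' * `|v|)).
  apply: ler_sum => j _; rewrite -mulrBr normrM mulrC.
  apply: ler_pM => //; last exact: mx_entry_le_norm.
  by rewrite distrC ltW.
rewrite sumr_const card_ord -mulr_natl mulrA /e' ler_wpM2r// mulrCA ler_piMr ?(ltW e0)//.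
by rewrite ler_pdivrMr// mul1r ler_nat.
Unshelve. all: by end_near. Qed.

End Strict.

(** Lets ['rV[R]_n] be inferred as a complete normed module, as the fixed-point theorem requires. *)
HB.instance Definition _ (R : realType) (m n : nat) :=
  Complete.copy 'M[R]_(m, n) 'M[R]_(m, n).

(** * Local surjectivity of a map with one kink, by contraction *)

Section Surjection.
Context {R : realType}.

Lemma mulmx_norm_le m n p (A : 'M[R]_(m, n)) (B : 'M[R]_(n, p)) :
  `|A *m B| <= n%:R * `|A| * `|B|.
Proof.
apply: mx_norm_le => [|i j]; first by rewrite !mulr_ge0.
rewrite mxE; apply: (le_trans (ler_norm_sum _ _ _)).
apply: (@le_trans _ _ (\sum_(k < n) `|A| * `|B|)).
  by apply: ler_sum => k _; rewrite normrM ler_pM// mx_entry_le_norm.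
by rewrite sumr_const card_ord -mulrA mulr_natl.
Qed.

Lemma norm_trmx m n (A : 'M[R]_(m, n)) : `|A^T| = `|A|.
Proof.
have le p q (B : 'M[R]_(p, q)) : `|B^T| <= `|B|.
  by apply: mx_norm_le => // i j; rewrite mxE mx_entry_le_norm.
by apply/eqP; rewrite eq_le le -{1}[A]trmxK le.
Qed.

(** Matrix determinant lemma. After factoring out [J], the two products of the same block matrices
    in opposite orders have equal determinants, namely [1 - a d] and [det (1 - d a)]. *)
Lemma det_rank1_update n (J : 'M[R]_n) (D : 'cV[R]_n) (a : 'rV[R]_n) :
  J \in unitmx ->
  \det (J - D *m a) = \det J * (1 - (a *m (invmx J *m D)) 0 0).
Proof.
move=> uJ; pose d := invmx J *m D.
have -> : J - D *m a = J *m (1%:M - d *m a).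
  by rewrite mulmxBr mulmx1 /d -[invmx J *m D *m a]mulmxA mulKVmx.
rewrite det_mulmx; congr (_ * _).
have eq1 : block_mx 1%:M (- a) 0 1%:M *m block_mx 1%:M a d 1%:M =
    block_mx (1%:M - a *m d) 0 d (1%:M : 'M[R]_n).
  by rewrite mulmx_block !(mul1mx, mul0mx, mulmx1, mulNmx, addrN, add0r).
have eq2 : block_mx 1%:M a d 1%:M *m block_mx 1%:M (- a) 0 1%:M =
    block_mx 1%:M 0 d (1%:M - d *m a) :> 'M[R]_(1 + n).
  by rewrite mulmx_block !(mul1mx, mul0mx, mulmx1, mulmxN, mulmx0, addrN, add0r, addr0, addNr) addrC.
have := congr1 determinant eq1; have := congr1 determinant eq2.
rewrite !det_mulmx !det_ublock !det_lblock !det1 !(mul1r, mulr1) => -> ->.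
by rewrite det_mx11 !mxE eqxx.
Qed.

(** A contraction of ratio [1/2] that moves the centre by at most [r / 2] maps the closed ball into
    itself. *)
Lemma fixpoint_closed_ball (V : completeNormedModType R) (G : V -> V) (c : V)
    (r : R) : 0 <= r ->
  (forall p1 p2, `|p1 - c| <= r -> `|p2 - c| <= r ->
     `|G p1 - G p2| <= 2^-1 * `|p1 - p2|) ->
  `|G c - c| <= r / 2 -> exists2 p, `|p - c| <= r & p = G p.
Proof.
move=> r0 hG hc; pose U := [set p | `|p - c| <= r].
have funG : set_fun U U G.
  move=> p Up; rewrite /U/= -(subrKA (G c)).
  apply: (le_trans (ler_normD _ _)).
  have := hG p c Up; rewrite subrr normr0 => /(_ r0) hp.
  have : `|p - c| <= r by [].
  by move: hc hp; lra.
pose G' : {fun U >-> U} := mkfun funG.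
have [|||p Up pG] := @banach_fixed_point R V U G'.
- exists (2^-1 : R)%:nng; split; first by rewrite /= invf_lt1// ltr1n.
  by move=> [p1 p2] [/= h1 h2]; exact: hG.
- rewrite (_ : U = (fun p => `|p - c|) @^-1` [set x | x <= r])//.
  apply: closed_comp; last exact: closed_le.
  by move=> x _; apply: cvg_norm; apply: cvgB; [exact: cvg_id|exact: cvg_cst].
- by exists c; rewrite /U/= subrr normr0.
by exists p.
Qed.

Lemma min_lip (x y z : R) : `|Num.min x z - Num.min y z| <= `|x - y|.
Proof.
have h1 := ler_norm (x - y); have h2 := ler_norm (y - x); rewrite distrC in h2.
by rewrite ler_norml; case: (lerP x z) => ?; case: (lerP y z) => ?; lra.
Qed.

Lemma max_lip (x y z : R) : `|Num.max x z - Num.max y z| <= `|x - y|.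
Proof.
have h1 := ler_norm (x - y); have h2 := ler_norm (y - x); rewrite distrC in h2.
by rewrite ler_norml; case: (lerP x z) => ?; case: (lerP y z) => ?; lra.
Qed.

(** With [e] and [e2] the remainders of [f] and [T], the equation [f q = y] reads
    [q - qb = w - K e q + min (T q, 0) d] up to transposition. Applying [a] gives
    [T q = Z q + k min (T q, 0)], hence [min (T q, 0) = min (Z q, 0) / (1 - k)]. Substituting leaves
    a right-hand side [G q] that depends on [q] only through [e] and [e2]. *)
Lemma piecewise_surjection n (f : 'rV[R]_n -> 'cV[R]_n) (T : 'rV[R]_n -> R)
    (J : 'M[R]_n) (D : 'cV[R]_n) (a : 'rV[R]_n) (qb : 'rV[R]_n)
    (U : set 'rV[R]_n) :
  \det (J - D *m a) * \det J > 0 -> nbhs qb U -> T qb = 0 ->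
  strict_diff T (fun v => (a *m v^T) 0 0) qb ->
  (forall e : R, 0 < e -> exists2 r : R, 0 < r & forall q1 q2 : 'rV[R]_n,
    `|q1 - qb| < r -> `|q2 - qb| < r ->
    `|f q1 - f q2 - J *m (q1 - q2)^T
      + (Num.min (T q1) 0 - Num.min (T q2) 0) *: D| <= e * `|q1 - q2|) ->
  \forall y \near f qb, exists2 q, U q & f q = y.
Proof.
move=> hdet hU T0 hT hf.
have uJ : J \in unitmx.
  by rewrite unitmxE unitfE; apply/eqP => J0; rewrite J0 mulr0 ltxx in hdet.
pose K := invmx J; pose d := K *m D; pose k := (a *m d) 0 0.
(* By [det_rank1_update] the hypothesis is the positivity of the square of [\det J] times
   [1 - k]. *)
have k1 : 0 < 1 - k.
  move: hdet; rewrite det_rank1_update// -/K -/d -/k mulrAC -expr2.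
  by rewrite pmulr_rgt0// exprn_even_gt0//= -unitfE -unitmxE.
pose CK := n%:R * `|K| + 1; pose Ca := n%:R * `|a| + 1.
pose Cd := `|d| / (1 - k).
have CK1 : 1 <= CK by rewrite lerDr !mulr_ge0.
have Ca1 : 1 <= Ca by rewrite lerDr !mulr_ge0.
have Cd0 : 0 <= Cd by rewrite divr_ge0// ltW.
have hK p (v : 'M[R]_(n, p)) : `|K *m v| <= CK * `|v|.
  by apply: (le_trans (mulmx_norm_le _ _)); rewrite ler_wpM2r// lerDl.
have ha (v : 'M[R]_(n, 1)) : `|(a *m v) 0 0| <= Ca * `|v|.
  apply: (le_trans (mx_entry_le_norm _ _ _)).
  by apply: (le_trans (mulmx_norm_le _ _)); rewrite ler_wpM2r// lerDl.
have normd x : `|x / (1 - k) *: d| = Cd * `|x|.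
  by rewrite normrZ normrM normfV (gtr0_norm k1) /Cd mulrC mulrAC mulrA.
(* If [e] and [e2] have Lipschitz constant [eps], then [G] has Lipschitz constant [S * eps]: [CK]
   comes from [K e], the rest from [Z] through [d / (1 - k)]. The choice of [eps] below makes this
   [1/2]. *)
pose S := CK + Cd * (1 + Ca * CK).
have S0 : 0 < S by rewrite (lt_le_trans ltr01)// (le_trans CK1)// lerDl mulr_ge0// addr_ge0// mulr_ge0//; lra.
pose eps := (2 * S)^-1.
have eps0 : 0 < eps by rewrite invr_gt0 mulr_gt0.
have [r1 r10 hr1] := hT _ eps0; have [r2 r20 hr2] := hf _ eps0.
have [r3 /= r30 hr3] := (nbhs_ballP _ _).1 hU.
(* Halved so that the closed ball of radius [r] lies in the three open balls. *)
pose r := Num.min r1 (Num.min r2 r3) / 2.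
have r0 : 0 < r by rewrite divr_gt0// !lt_min r10 r20 r30.
have hr : r < r1 /\ r < r2 /\ r < r3.
  have : 0 < Num.min r1 (Num.min r2 r3) by rewrite !lt_min r10 r20 r30.
  have : Num.min r1 (Num.min r2 r3) <= r1 by rewrite ge_min lexx.
  have : Num.min r1 (Num.min r2 r3) <= r2 by rewrite !ge_min lexx orbT.
  have : Num.min r1 (Num.min r2 r3) <= r3 by rewrite !ge_min lexx !orbT.
  by rewrite /r; lra.
pose e q := f q - f qb - J *m (q - qb)^T + Num.min (T q) 0 *: D.
pose e2 q := T q - (a *m (q - qb)^T) 0 0.
have lip_e q1 q2 : `|q1 - qb| <= r -> `|q2 - qb| <= r ->
    `|e q1 - e q2| <= eps * `|q1 - q2|.
  move=> h1 h2; have := hr2 q1 q2 (le_lt_trans h1 hr.2.1) (le_lt_trans h2 hr.2.1).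
  congr (`|_| <= _); rewrite /e -[q1 - q2](subrKA qb) -[qb - q2]opprB.
  rewrite [(_ - (q2 - qb))^T]linearB/= mulmxBr scalerBl.
  by apply/matrixP => i j; rewrite !mxE; ring.
have lip_e2 q1 q2 : `|q1 - qb| <= r -> `|q2 - qb| <= r ->
    `|e2 q1 - e2 q2| <= eps * `|q1 - q2|.
  move=> h1 h2; have := hr1 q1 q2 (le_lt_trans h1 hr.1) (le_lt_trans h2 hr.1).
  congr (`|_| <= _); rewrite /e2 -[q1 - q2](subrKA qb) -[qb - q2]opprB.
  rewrite [(_ - (q2 - qb))^T]linearB/= mulmxBr.
  by rewrite !mxE; ring.
have e0 : e qb = 0.
  by rewrite /e !subrr trmx0 mulmx0 T0 minxx scale0r subrr addr0.
have e20 : e2 qb = 0 by rewrite /e2 subrr trmx0 mulmx0 T0 mxE subrr.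
(* For [y] this close to [f qb], [w] has norm at most [r / (2 * S)], so [G] moves [qb] by at most
   [S * |w|], that is, by at most [r / 2]. *)
have Sr : 0 < r / (2 * S * CK).
  by rewrite divr_gt0// mulr_gt0 ?mulr_gt0// (lt_le_trans _ CK1).
near=> y.
pose w := K *m (y - f qb).
pose Z q := (a *m w) 0 0 + e2 q - (a *m (K *m e q)) 0 0.
pose G q := qb + (w - K *m e q + (Num.min (Z q) 0 / (1 - k)) *: d)^T.
have [||q hq qG] := @fixpoint_closed_ball 'rV[R]_n G qb r (ltW r0).
- move=> q1 q2 h1 h2.
  have -> : G q1 - G q2 = (- (K *m (e q1 - e q2)) +
      ((Num.min (Z q1) 0 - Num.min (Z q2) 0) / (1 - k)) *: d)^T.
    rewrite /G mulmxBr mulrBl scalerBl; apply/matrixP => i j.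
    by rewrite !mxE; ring.
  rewrite norm_trmx; apply: (le_trans (ler_normD _ _)).
  have hKe : `|K *m (e q1 - e q2)| <= CK * (eps * `|q1 - q2|).
    by apply: (le_trans (hK _ _)); rewrite ler_pM2l ?lip_e// (lt_le_trans _ CK1).
  have hZ : `|Z q1 - Z q2| <= (1 + Ca * CK) * (eps * `|q1 - q2|).
    have -> : Z q1 - Z q2 = (e2 q1 - e2 q2) - (a *m (K *m (e q1 - e q2))) 0 0.
      by rewrite /Z !mulmxBr !mxE; ring.
    apply: (le_trans (ler_normB _ _)).
    rewrite mulrDl mul1r lerD ?lip_e2//.
    apply: (le_trans (ha _)); rewrite -mulrA ler_pM2l//.
    by rewrite (lt_le_trans _ Ca1).
  have hM : `|(Num.min (Z q1) 0 - Num.min (Z q2) 0) / (1 - k) *: d| <=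
      Cd * ((1 + Ca * CK) * (eps * `|q1 - q2|)).
    by rewrite normd ler_wpM2l// (le_trans (min_lip _ _ _)).
  rewrite normrN; apply: (le_trans (lerD hKe hM)).
  have -> : CK * (eps * `|q1 - q2|) + Cd * ((1 + Ca * CK) * (eps * `|q1 - q2|))
    = (S * eps) * `|q1 - q2| by rewrite /S; ring.
  by rewrite /eps invfM mulrCA mulfV ?mulr1// gt_eqF.
- rewrite /G e0 mulmx0 subr0 addrC addKr norm_trmx.
  have -> : Z qb = (a *m w) 0 0.
    by rewrite /Z e0 e20 !mulmx0 addr0 [X in _ - X]mxE subr0.
  have hw : `|w| <= r / (2 * S).
    apply: (le_trans (hK _ _)).
    rewrite -ler_pdivlMl ?(lt_le_trans _ CK1)//.
    have -> : CK^-1 * (r / (2 * S)) = r / (2 * S * CK) by rewrite !invfM; ring.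
    by rewrite ltW// distrC; near: y; apply: (@cvgr_dist_lt _ _ _ _ _ id).
  apply: (le_trans (ler_normD _ _)).
  have hm : `|Num.min ((a *m w) 0 0) 0 / (1 - k) *: d| <= Cd * (Ca * `|w|).
    rewrite normd ler_wpM2l//; apply: le_trans (ha w).
    by have := min_lip ((a *m w) 0 0) 0 0; rewrite minxx !subr0.
  apply: (le_trans (lerD (lexx _) hm)).
  apply: (@le_trans _ _ (S * `|w|)).
    rewrite /S mulrA -[X in X + _]mul1r -mulrDl ler_wpM2r//.
    have Ca0 : 0 <= Ca by lra.
    have : 0 <= Ca * Cd * (CK - 1) by apply: mulr_ge0; [exact: mulr_ge0 | rewrite subr_ge0].
    by nra.
  apply: (@le_trans _ _ (S * (r / (2 * S)))); first by rewrite ler_wpM2l// ltW.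
  by rewrite le_eqVlt; apply/orP; left; apply/eqP; field; rewrite gt_eqF.
exists q.
  apply: hr3; rewrite -ball_normE/= distrC; apply: le_lt_trans hq _.
  by case: hr => _ [].
have qqb : (q - qb)^T = w - K *m e q + (Num.min (Z q) 0 / (1 - k)) *: d.
  by rewrite {1}qG /G addrC addKr trmxK.
have aT : T q = Z q + k / (1 - k) * Num.min (Z q) 0.
  have -> : T q = (a *m (q - qb)^T) 0 0 + e2 q by rewrite /e2; ring.
  rewrite qqb mulmxDr mulmxBr -scalemxAr.
  have mxE4 (A B C : 'M[R]_1) x :
      (A - B + x *: C) 0 0 = A 0 0 - B 0 0 + x * C 0 0 by rewrite !mxE.
  by rewrite mxE4 -/k /Z; ring.
(* By [aT], [T q] is [Z q] when [Z q >= 0] and [Z q / (1 - k)] when [Z q < 0]; as [1 - k > 0], the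
   sign is preserved. *)
have minT : Num.min (T q) 0 = Num.min (Z q) 0 / (1 - k).
  have k1' : 1 - k != 0 by rewrite gt_eqF.
  rewrite aT; case: (lerP 0 (Z q)) => hZ.
    by rewrite mulr0 addr0 mul0r; case: lerP hZ => //; lra.
  have -> : Z q + k / (1 - k) * Z q = Z q / (1 - k) by field.
  have : Z q / (1 - k) < 0 by rewrite pmulr_llt0 ?invr_gt0.
  by case: lerP => //; lra.
(* Unfolding only one occurrence turns this into [e q = f q - y + e q] at the fixed point, which is
   the conclusion. *)
have : e q = e q by [].
rewrite {2}/e qqb minT mulmxDr mulmxBr -scalemxAr /d /w !mulKVmx// => he.
apply/eqP; rewrite -subr_eq0; apply/eqP.
apply: (@addrI _ (e q)); rewrite addr0 {2}he.
by apply/matrixP => i j; rewrite !mxE; ring.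
Unshelve. all: by end_near. Qed.

End Surjection.

(** * Absolutely continuous functions *)

Section Primitive.
Context {R : realType}.
Notation lebesgue := (@lebesgue_measure R).

(** One coordinate of [caratheodory]. The scalar form makes linear combinations of different
    coordinates primitives again. *)
Definition primitive (T : R) (y g : R -> R) : Prop :=
  lebesgue.-integrable `[0, T] (fun s => (g s)%:E) /\
  forall t, 0 <= t <= T -> y t = y 0 + \int[lebesgue]_(s in `[0, t]) g s.

Lemma integrable_subitv (T : R) (g : R -> R) (I : interval R) :
  [set` I] `<=` `[0, T] ->
  lebesgue.-integrable `[0, T] (fun s => (g s)%:E) ->
  lebesgue.-integrable [set` I] (EFin \o g).
Proof. by move=> IT; apply: integrableS => //; exact: measurable_itv. Qed.

Lemma primitive_lin (T c1 c2 : R) (y1 g1 y2 g2 : R -> R) :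
  primitive T y1 g1 -> primitive T y2 g2 ->
  primitive T (fun t => c1 * y1 t + c2 * y2 t) (fun t => c1 * g1 t + c2 * g2 t).
Proof.
move=> [i1 h1] [i2 h2]; split.
  rewrite (_ : (fun s => _) =
    (fun s => c1%:E * (g1 s)%:E) \+ (fun s => c2%:E * (g2 s)%:E))%E//.
  by apply: integrableD => //; apply: integrableZl.
move=> t tT; rewrite h1// h2//.
have sub : `[0, t] `<=` `[0, T].
  by apply: subset_itvl; rewrite bnd_simp; case/andP: tT.
have j1 := integrable_subitv sub i1; have j2 := integrable_subitv sub i2.
have k1 : lebesgue.-integrable `[0, t] (EFin \o (fun s => c1 * g1 s)).
  by rewrite (_ : _ \o _ = (fun s => c1%:E * (g1 s)%:E)%E)//; apply: integrableZl.
have k2 : lebesgue.-integrable `[0, t] (EFin \o (fun s => c2 * g2 s)).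
  by rewrite (_ : _ \o _ = (fun s => c2%:E * (g2 s)%:E)%E)//; apply: integrableZl.
rewrite (RintegralD _ k1 k2)// !RintegralZl//; ring.
Qed.

Lemma primitive_id (T : R) : primitive T id (fun=> 1).
Proof.
split.
  by apply: continuous_compact_integrable; [exact: segment_compact|move=> ?; exact: cvg_cst].
move=> t /andP[t0 tT]; rewrite Rintegral_cst//= lebesgue_measure_itv/= lte_fin.
by case: ltrP => /= h; lra.
Qed.

Lemma primitive_increment (T : R) (y g : R -> R) (a b : R) :
  0 <= a -> a <= b -> b <= T -> primitive T y g ->
  y b - y a = \int[lebesgue]_(s in `]a, b]) g s.
Proof.
move=> a0 ab bT [ig hg].
rewrite hg ?(le_trans a0)// (hg a) ?a0 ?(le_trans ab)//.
rewrite opprD addrACA subrr add0r.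
apply: Rintegral_itvB; rewrite ?bnd_simp//.
by apply: integrable_subitv ig; apply: subset_itvl; rewrite bnd_simp.
Qed.

(** The set [E] holds instants at which nothing is known of [g], such as a switching instant; being
    finite, it is negligible for the integral. *)
Lemma primitive_ge0 (T : R) (y g : R -> R) (E : set R) (a b : R) :
  finite_set E -> 0 <= a -> a <= b -> b <= T -> primitive T y g ->
  (forall s, a < s < b -> ~ E s -> 0 <= g s) -> y a <= y b.
Proof.
move=> fE a0 ab bT pg g0; rewrite -subr_ge0 (primitive_increment a0 ab bT pg).
(* The endpoint [b] is removed as well: the increment is an integral over []a, b]], while the sign
   is known only on the open interval. *)
have cE : countable (E `|` [set b]).
  by apply: finite_set_countable; rewrite finite_setU.
have mE : measurable (E `|` [set b]).
  exact: countable_measurable.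
have ig : lebesgue.-integrable `]a, b] (EFin \o g).
  by apply: integrable_subitv pg.1; apply: subset_itv; rewrite bnd_simp.
have neg : (\int[lebesgue]_(s in `]a, b]) (g s)%:E =
    \int[lebesgue]_(s in `]a, b] `\` (E `|` [set b])) (g s)%:E)%E.
  by apply: negligible_integral => //; exact: countable_lebesgue_measure0.
rewrite [leRHS](congr1 fine neg).
apply: fine_ge0; apply: integral_ge0 => s [/=]; rewrite in_itv/= => /andP[sa sb].
move=> /not_orP[Es bs]; rewrite lee_fin g0// sa/= lt_neqAle sb andbT.
exact/eqP.
Qed.

Lemma primitive_le (T : R) (y1 g1 y2 g2 : R -> R) (E : set R) (a b : R) :
  finite_set E -> 0 <= a -> a <= b -> b <= T ->
  primitive T y1 g1 -> primitive T y2 g2 ->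
  (forall s, a < s < b -> ~ E s -> g1 s <= g2 s) ->
  y1 b - y1 a <= y2 b - y2 a.
Proof.
move=> fE a0 ab bT p1 p2 h.
have := primitive_ge0 fE a0 ab bT (primitive_lin 1 (-1) p2 p1).
have g0 s : a < s < b -> ~ E s -> 0 <= 1 * g2 s + -1 * g1 s.
  by move=> sab Es; have := h s sab Es; lra.
by move=> /(_ g0); lra.
Qed.

(** Mean value inequality for absolutely continuous functions: both [y2 - y1] and [y2 + y1] have a
    nonnegative derivative outside [E]. *)
Lemma primitive_norm_le (T : R) (y1 g1 y2 g2 : R -> R) (E : set R) (a b : R) :
  finite_set E -> 0 <= a -> a <= b -> b <= T ->
  primitive T y1 g1 -> primitive T y2 g2 ->
  (forall s, a < s < b -> ~ E s -> `|g1 s| <= g2 s) ->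
  `|y1 b - y1 a| <= y2 b - y2 a.
Proof.
move=> fE a0 ab bT p1 p2 h; rewrite ler_norml; apply/andP; split.
  have p1N := primitive_lin (-1) 0 p1 p1.
  have := primitive_le fE a0 ab bT p1N p2.
  have g0 s : a < s < b -> ~ E s -> -1 * g1 s + 0 * g1 s <= g2 s.
    by move=> sab Es; have := h s sab Es; rewrite ler_norml => /andP[]; lra.
  by move=> /(_ g0); lra.
apply: (primitive_le fE a0 ab bT p1 p2) => s sab Es.
exact: le_trans (ler_norm _) (h s sab Es).
Qed.

Lemma primitive_norm_le_cst (T : R) (y g : R -> R) (E : set R) (K a b : R) :
  finite_set E -> 0 <= a -> a <= b -> b <= T -> primitive T y g ->
  (forall s, a < s < b -> ~ E s -> `|g s| <= K) ->
  `|y b - y a| <= K * (b - a).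
Proof.
move=> fE a0 ab bT p h.
have := primitive_norm_le fE a0 ab bT p (primitive_lin K 0 (primitive_id T) (primitive_id T)).
have h' s : a < s < b -> ~ E s -> `|g s| <= K * 1 + 0 * 1.
  by move=> sab Es; have := h s sab Es; lra.
by move=> /(_ h') /le_trans; apply; lra.
Qed.

Lemma primitive_continuous (T : R) (y g : R -> R) : 0 <= T -> primitive T y g ->
  {within `[0, T], continuous y}.
Proof.
move=> T0 [ig hg].
have cI := @parameterized_integral_continuous R 0 T g T0 ig.
apply: (@subspace_eq_continuous _ _ _ (fun t => y 0 + parameterized_integral lebesgue 0 t g)).
  by move=> t; rewrite inE/= in_itv/= => tT; rewrite /from_subspace (hg t tT).
by move=> t; apply: cvgD; [exact: cvg_cst | exact: cI].
Qed.

End Primitive.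

(** * Rules for strict derivatives *)

Section StrictCalculus.
Context {R : realType} {V : normedModType R}.
Implicit Types (f d : V -> R) (q : V).

(** A bound on the growth of [d] suffices for the calculus rules; homogeneity is asked separately in
    [SD_derive], where a directional derivative is read off. *)
Definition SD f d q : Prop :=
  (exists C : R, forall v, `|d v| <= C * `|v|) /\ strict_diff f d q.

(** The filter form on pairs, in which finitely many tolerances combine without explicit radii. *)
Lemma strict_diff_near f d q : strict_diff f d q <->
  forall e : R, 0 < e -> \forall p \near (q, q),
    `|f p.1 - f p.2 - d (p.1 - p.2)| <= e * `|p.1 - p.2|.
Proof.
split=> [h e e0|h e e0].
  have [r r0 hr] := h e e0.
  exists (ball q r, ball q r); first by split; exact: nbhsx_ballx.
  move=> [p1 p2] [/=]; rewrite -!ball_normE/= ![`|q - _|]distrC => h1 h2.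
  exact: hr.
have [[A B]/= [/nbhs_ballP[r1 /= r10 hA] /nbhs_ballP[r2 /= r20 hB]] hAB] := h e e0.
exists (Num.min r1 r2); first by rewrite lt_min r10.
move=> q1 q2; rewrite !lt_min => /andP[h1 _] /andP[_ h2].
apply: (hAB (q1, q2)); split => /=.
  by apply: hA; rewrite -ball_normE/= distrC.
by apply: hB; rewrite -ball_normE/= distrC.
Qed.

Lemma SD_lip f d q : SD f d q -> exists L r : R, [/\ 0 <= L, 0 < r &
  forall q1 q2, `|q1 - q| < r -> `|q2 - q| < r ->
    `|f q1 - f q2| <= L * `|q1 - q2|].
Proof.
move=> [[C hC] hs]; have [r r0 hr] := hs 1 ltr01.
exists (`|C| + 1), r; split=> [||q1 q2 h1 h2]; [by rewrite addr_ge0 | by [] |].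
rewrite -[f q1 - f q2](subrK (d (q1 - q2))) mulrDl addrC.
apply: (le_trans (ler_normD _ _)); apply: lerD; last exact: hr.
by apply: (le_trans (hC _)); rewrite ler_wpM2r// ler_norm.
Qed.

Lemma SD_continuous f d q : SD f d q -> {for q, continuous f}.
Proof.
move=> /SD_lip [L [r [L0 r0 hL]]]; apply/cvgrPdist_lt => e e0.
have L1 : 0 < L + 1 by lra.
near=> y.
have yr : `|y - q| < r.
  by rewrite distrC; near: y; apply: (@cvgr_dist_lt _ _ _ _ _ id).
rewrite distrC; apply: (le_lt_trans (hL _ _ yr _)); first by rewrite subrr normr0.
have : `|y - q| < e / (L + 1).
  rewrite distrC; near: y; apply: (@cvgr_dist_lt _ _ _ _ _ id) => //.
  exact: divr_gt0.
rewrite ltr_pdivlMr// mulrC; apply: le_lt_trans.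
by rewrite ler_wpM2r//; lra.
Unshelve. all: by end_near. Qed.

Lemma SD_cst (c : R) q : SD (fun=> c) (fun=> 0) q.
Proof.
split; first by exists 0 => v; rewrite normr0 mul0r.
by move=> e e0; exists 1 => // q1 q2 _ _; rewrite subrr subr0 normr0 mulr_ge0// ltW.
Qed.

Lemma SD_lin f d g d' (a b : R) q : SD f d q -> SD g d' q ->
  SD (fun y => a * f y + b * g y) (fun v => a * d v + b * d' v) q.
Proof.
move=> [[C hC] /strict_diff_near hf] [[C' hC'] /strict_diff_near hg]; split.
  exists (`|a| * C + `|b| * C') => v.
  apply: (le_trans (ler_normD _ _)); rewrite !normrM mulrDl -!mulrA.
  by rewrite lerD// ler_wpM2l.
apply/strict_diff_near => e e0.
have ab0 : 0 < `|a| + `|b| + 1 by rewrite ltr_wpDl// addr_ge0.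
have e'0 : 0 < e / (`|a| + `|b| + 1) by rewrite divr_gt0.
near=> p.
have h1 : `|f p.1 - f p.2 - d (p.1 - p.2)| <= e / (`|a| + `|b| + 1) * `|p.1 - p.2|.
  by near: p; exact: hf.
have h2 : `|g p.1 - g p.2 - d' (p.1 - p.2)| <= e / (`|a| + `|b| + 1) * `|p.1 - p.2|.
  by near: p; exact: hg.
have -> : a * f p.1 + b * g p.1 - (a * f p.2 + b * g p.2) -
    (a * d (p.1 - p.2) + b * d' (p.1 - p.2)) =
  a * (f p.1 - f p.2 - d (p.1 - p.2)) + b * (g p.1 - g p.2 - d' (p.1 - p.2)).
  by ring.
apply: (le_trans (ler_normD _ _)); rewrite !normrM.
apply: (le_trans (lerD (ler_wpM2l (normr_ge0 a) h1) (ler_wpM2l (normr_ge0 b) h2))).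
rewrite -mulrDl mulrA ler_wpM2r//.
rewrite mulrCA ler_piMr ?(ltW e0)// ler_pdivrMr// mul1r; lra.
Unshelve. all: by end_near. Qed.

(* Writing increments of g as Q (a, b) (a - b) with Q continuous covers squares,
   inverses and square roots at once; products follow by polarization. *)
Lemma SD_chain f d q (g : R -> R) (Q : R * R -> R) : SD f d q ->
  (exists2 r : R, 0 < r & forall a b, `|f q - a| < r -> `|f q - b| < r ->
     g a - g b = Q (a, b) * (a - b)) ->
  Q ab @[ab --> (f q, f q)] --> Q (f q, f q) ->
  SD (fun y => g (f y)) (fun v => Q (f q, f q) * d v) q.
Proof.
move=> sf [r r0 gQ] cQ; have cf := SD_continuous sf.
have c1 : f p.1 @[p --> (q, q)] --> f q by apply: (@cvg_comp _ _ _ fst f _ (nbhs q)); [exact: cvg_fst|exact: cf].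
have c2 : f p.2 @[p --> (q, q)] --> f q by apply: (@cvg_comp _ _ _ snd f _ (nbhs q)); [exact: cvg_snd|exact: cf].
have cff : (f p.1, f p.2) @[p --> (q, q)] --> (f q, f q) by exact: (cvg_pair c1 c2).
case: sf => [[C hC] /strict_diff_near hf]; set Q0 := Q (f q, f q).
split.
  exists (`|Q0| * C) => v.
  by rewrite normrM -mulrA ler_wpM2l.
apply/strict_diff_near => e e0.
have K0 : 0 < `|Q0| + 1 by rewrite ltr_wpDl.
have C0 : 0 < `|C| + 1 by rewrite ltr_wpDl.
(* The tolerance [e] is split between the remainder of [f], multiplied by a value of [Q] bounded by
   [|Q0| + 1], and the variation of [Q], multiplied by [d]. *)
have e1 : 0 < e / (2 * (`|Q0| + 1)) by rewrite divr_gt0// mulr_gt0.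
have e2 : 0 < Num.min (e / (2 * (`|C| + 1))) 1.
  by rewrite lt_min ltr01 divr_gt0// mulr_gt0.
have cQf : Q (f p.1, f p.2) @[p --> (q, q)] --> Q0.
  exact: (cvg_comp _ _ cff cQ).
have gQf : \forall p \near (q, q), g (f p.1) - g (f p.2) =
    Q (f p.1, f p.2) * (f p.1 - f p.2).
  near=> p; apply: gQ; near: p; [exact: (cvgr_dist_lt _ _ c1)|exact: (cvgr_dist_lt _ _ c2)].
near=> p.
have h1 : `|f p.1 - f p.2 - d (p.1 - p.2)| <= e / (2 * (`|Q0| + 1)) * `|p.1 - p.2|.
  by near: p; exact: hf.
have : `|Q0 - Q (f p.1, f p.2)| < Num.min (e / (2 * (`|C| + 1))) 1.
  by near: p; exact: (cvgr_dist_lt _ _ cQf).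
rewrite lt_min => /andP[h2 h3].
have -> : g (f p.1) - g (f p.2) = Q (f p.1, f p.2) * (f p.1 - f p.2).
  by near: p.
move: h1 h2 h3; set Q1 := Q _; set D := d _ => h1 h2 h3.
have -> : Q1 * (f p.1 - f p.2) - Q0 * D =
  Q1 * (f p.1 - f p.2 - D) - (Q0 - Q1) * D by ring.
apply: (le_trans (ler_normB _ _)); rewrite !normrM.
have hQ1 : `|Q1| <= `|Q0| + 1.
  have -> : Q1 = Q0 - (Q0 - Q1) by ring.
  by apply: (le_trans (ler_normB _ _)); rewrite lerD2l ltW.
have hD : `|D| <= (`|C| + 1) * `|p.1 - p.2|.
  apply: (le_trans (hC _)); rewrite ler_wpM2r//.
  by have := ler_norm C; lra.
have k1 := ler_pM (normr_ge0 _) (normr_ge0 _) hQ1 h1.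
have k2 := ler_pM (normr_ge0 _) (normr_ge0 _) (ltW h2) hD.
apply: (le_trans (lerD k1 k2)).
rewrite le_eqVlt; apply/orP; left; apply/eqP; field.
by rewrite !gt_eqF.
Unshelve. all: by end_near. Qed.

Lemma SD_sqr f d q : SD f d q ->
  SD (fun y => f y ^+ 2) (fun v => (f q + f q) * d v) q.
Proof.
move=> sf; apply: (@SD_chain f d q (fun x => x ^+ 2) (fun ab => ab.1 + ab.2) sf).
  by exists 1 => // a b _ _ /=; ring.
have c1 : ab.1 @[ab --> (f q, f q)] --> f q by exact: cvg_fst.
have c2 : ab.2 @[ab --> (f q, f q)] --> f q by exact: cvg_snd.
exact: (cvgD c1 c2).
Qed.

Lemma SD_eq f f' d d' q : SD f d q -> f =1 f' -> d =1 d' -> SD f' d' q.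
Proof. by move=> h /funext <- /funext <-. Qed.

Lemma SD_mul f d g d' q : SD f d q -> SD g d' q ->
  SD (fun y => f y * g y) (fun v => g q * d v + f q * d' v) q.
Proof.
move=> sf sg.
have s1 := SD_sqr (SD_lin 1 1 sf sg).
have s2 := SD_lin 1 1 (SD_sqr sf) (SD_sqr sg).
by apply: SD_eq (SD_lin (2^-1) (- 2^-1) s1 s2) _ _ => y /=; field.
Qed.

Lemma SD_inv f d q : f q != 0 -> SD f d q ->
  SD (fun y => (f y)^-1) (fun v => - (f q * f q)^-1 * d v) q.
Proof.
move=> f0 sf.
have c1 : ab.1 @[ab --> (f q, f q)] --> f q by exact: cvg_fst.
have c2 : ab.2 @[ab --> (f q, f q)] --> f q by exact: cvg_snd.
apply: (@SD_chain f d q (@GRing.inv R) (fun ab => - (ab.1 * ab.2)^-1) sf).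
  have ne0 a : `|f q - a| < `|f q| -> a != 0.
    by move=> h; apply/eqP => a0; rewrite a0 subr0 ltxx in h.
  exists `|f q|; first by rewrite normr_gt0.
  by move=> a b /ne0 a0 /ne0 b0 /=; field; rewrite a0 b0.
apply: cvgN; apply: cvgV; first by rewrite mulf_neq0.
exact: (cvgM c1 c2).
Qed.

Lemma SD_sqrt f d q : 0 < f q -> SD f d q ->
  SD (fun y => Num.sqrt (f y)) (fun v => (Num.sqrt (f q) + Num.sqrt (f q))^-1 * d v) q.
Proof.
move=> f0 sf; have sf0 : 0 < Num.sqrt (f q) by rewrite sqrtr_gt0.
have c1 : ab.1 @[ab --> (f q, f q)] --> f q by exact: cvg_fst.
have c2 : ab.2 @[ab --> (f q, f q)] --> f q by exact: cvg_snd.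
have s1 := cvg_comp _ _ c1 (@sqrt_continuous R (f q)).
have s2 := cvg_comp _ _ c2 (@sqrt_continuous R (f q)).
apply: (@SD_chain f d q (@Num.sqrt R)
  (fun ab => (Num.sqrt ab.1 + Num.sqrt ab.2)^-1) sf).
  have gt0 a : `|f q - a| < f q -> 0 < a.
    by rewrite ltr_norml => /andP[_]; lra.
  exists (f q) => // a b /gt0 a0 /gt0 b0 /=.
  have sa : 0 < Num.sqrt a by rewrite sqrtr_gt0.
  have sb : 0 < Num.sqrt b by rewrite sqrtr_gt0.
  rewrite -[X in _ = _ * (X - _)]sqr_sqrtr ?(ltW a0)//.
  rewrite -[X in _ = _ * (_ - X)]sqr_sqrtr ?(ltW b0)//.
  by field; rewrite gt_eqF// addr_gt0.
apply: cvgV; first by rewrite gt_eqF// addr_gt0.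
exact: (cvgD s1 s2).
Qed.

End StrictCalculus.

Section DirectionalDerivative.
Context {R : realType} {V : normedModType R}.

Lemma SD_derive (f d : V -> R) (q w : V) : SD f d q ->
  (forall t, d (t *: w) = t * d w) -> 'D_w (f : V -> R^o) q = d w.
Proof.
move=> [_ hs] dw; apply/cvg_lim => //; apply/cvgrPdist_le => e e0.
have w0 : 0 < `|w| + 1 by rewrite ltr_wpDl.
have [r r0 hr] := hs (e / (`|w| + 1)) (divr_gt0 e0 w0).
near=> t.
have t0 : t != 0 by near: t; exact: nbhs_dnbhs_neq.
have tr : `|t| < r / (`|w| + 1).
  by near: t; apply: dnbhs0_lt; rewrite divr_gt0.
have htw : `|t *: w + q - q| < r.
  rewrite addrK normrZ; move: tr; rewrite ltr_pdivlMr//; apply: le_lt_trans.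
  by rewrite ler_wpM2l// lerDl.
have := hr _ _ htw (_ : `|q - q| < r).
rewrite subrr normr0 => /(_ r0); rewrite addrK dw normrZ => h.
rewrite distrC /= /GRing.scale/=.
have -> : t^-1 * (f (t *: w + q) - f q) - d w =
  t^-1 * (f (t *: w + q) - f q - t * d w) by field.
rewrite normrM normfV ler_pdivrMl ?normr_gt0//.
apply: (le_trans h); rewrite mulrCA ler_wpM2l//.
rewrite mulrAC -mulrA ler_piMr ?(ltW e0)// ler_pdivrMr// mul1r; lra.
Unshelve. all: by end_near. Qed.

End DirectionalDerivative.

(** * Euclidean geometry of column vectors *)

Section Vectors3.
Context {R : realType}.
Implicit Types a b : 'cV[R]_3.

Lemma dotE n (a b : 'cV[R]_n) : dot a b = \sum_i a i 0 * b i 0.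
Proof. by rewrite /dot mxE; apply: eq_bigr => i _; rewrite mxE. Qed.

Lemma dot3E a b : dot a b = a 0 0 * b 0 0 + a 1 0 * b 1 0 + a 2 0 * b 2 0.
Proof.
rewrite dotE !big_ord_recl big_ord0 addr0 addrA.
by congr (_ * _ + _ * _ + _ * _); congr (_ _ _); apply: val_inj.
Qed.

Lemma dotC n (a b : 'cV[R]_n) : dot a b = dot b a.
Proof. by rewrite !dotE; apply: eq_bigr => i _; rewrite mulrC. Qed.

Lemma dotDr n (a b1 b2 : 'cV[R]_n) : dot a (b1 + b2) = dot a b1 + dot a b2.
Proof. by rewrite /dot mulmxDr mxE. Qed.

Lemma dotZr n (a b : 'cV[R]_n) k : dot a (k *: b) = k * dot a b.
Proof. by rewrite /dot -scalemxAr mxE. Qed.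

Lemma dotDl n (a1 a2 b : 'cV[R]_n) : dot (a1 + a2) b = dot a1 b + dot a2 b.
Proof. by rewrite dotC dotDr !(dotC b). Qed.

Lemma dotZl n (a b : 'cV[R]_n) k : dot (k *: a) b = k * dot a b.
Proof. by rewrite dotC dotZr dotC. Qed.

Lemma dotNl n (a b : 'cV[R]_n) : dot (- a) b = - dot a b.
Proof. by rewrite -scaleN1r dotZl mulN1r. Qed.

Lemma dot0l n (b : 'cV[R]_n) : dot 0 b = 0.
Proof. by rewrite /dot trmx0 mul0mx mxE. Qed.

Lemma dot_ge0 n (a : 'cV[R]_n) : 0 <= dot a a.
Proof. by rewrite dotE sumr_ge0// => i _; rewrite -expr2 sqr_ge0. Qed.

Lemma dot_eq0 n (a : 'cV[R]_n) : (dot a a == 0) = (a == 0).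
Proof.
apply/idP/eqP => [|->]; last by rewrite dot0l.
rewrite dotE psumr_eq0 => [/allP h|i _]; last by rewrite -expr2 sqr_ge0.
apply/matrixP => i j; rewrite (ord1 j) mxE; apply/eqP.
by have := h i (mem_index_enum _); rewrite mulf_eq0 orbb.
Qed.

Lemma enorm_ge0 n (a : 'cV[R]_n) : 0 <= enorm a.
Proof. exact: sqrtr_ge0. Qed.

Lemma enorm_sqr n (a : 'cV[R]_n) : enorm a ^+ 2 = dot a a.
Proof. by rewrite sqr_sqrtr// dot_ge0. Qed.

Lemma enorm_gt0 n (a : 'cV[R]_n) : (0 < enorm a) = (a != 0).
Proof. by rewrite sqrtr_gt0 lt_neqAle dot_ge0 andbT eq_sym dot_eq0. Qed.

Lemma enormZ n (a : 'cV[R]_n) k : 0 <= k -> enorm (k *: a) = k * enorm a.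
Proof.
move=> k0; rewrite /enorm dotZl dotZr mulrA -expr2 sqrtrM ?sqr_ge0//.
by rewrite sqrtr_sqr ger0_norm.
Qed.

Lemma entry_le_enorm n (a : 'cV[R]_n) i : `|a i 0| <= enorm a.
Proof.
rewrite -(ler_pXn2r (n := 2))// ?nnegrE ?enorm_ge0// enorm_sqr real_normK ?num_real//.
by rewrite dotE (bigD1 i)//= -expr2 lerDl sumr_ge0// => j _; rewrite -expr2 sqr_ge0.
Qed.

(** Cauchy-Schwarz for a unit vector [b]: the square of [a - |a| b] expands to [2 |a| (|a| - a.b)].
    The next lemma is the equality case, where that square vanishes. *)
Lemma dot_le_enorm n (a b : 'cV[R]_n) : enorm b = 1 -> dot a b <= enorm a.
Proof.
move=> b1; have [a0|an0] := eqVneq a 0.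
  by rewrite a0 dot0l enorm_ge0.
have e0 : 0 < enorm a by rewrite enorm_gt0.
have := dot_ge0 (a - enorm a *: b).
rewrite -[- _]scaleN1r scalerA !(dotDl, dotDr, dotZl, dotZr) -!enorm_sqr b1 (dotC b).
have -> : enorm a ^+ 2 + -1 * enorm a * dot a b + (-1 * enorm a * dot a b
  + -1 * enorm a * (-1 * enorm a * 1 ^+ 2)) = 2 * enorm a * (enorm a - dot a b) by ring.
by rewrite pmulr_rge0 ?subr_ge0// mulr_gt0.
Qed.

Lemma dot_eq_enorm n (a b : 'cV[R]_n) : a != 0 -> enorm b = 1 ->
  dot a b = enorm a -> b = (enorm a)^-1 *: a.
Proof.
move=> an0 b1 ab; have e0 : 0 < enorm a by rewrite enorm_gt0.
have : dot (a - enorm a *: b) (a - enorm a *: b) == 0.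
  rewrite -[- _]scaleN1r scalerA !(dotDl, dotDr, dotZl, dotZr) -!enorm_sqr b1 (dotC b) ab.
  by apply/eqP; ring.
rewrite dot_eq0 subr_eq0 => /eqP {2}->.
by rewrite scalerA mulVf ?scale1r// gt_eqF.
Qed.

Definition SDv {V : normedModType R} n (u du : V -> 'cV[R]_n) (q : V) : Prop :=
  forall i, SD (fun y => u y i 0) (fun v => du v i 0) q.

Lemma SD_dot {V : normedModType R} (u du w dw : V -> 'cV[R]_3) (q : V) :
  SDv u du q -> SDv w dw q ->
  SD (fun y => dot (u y) (w y)) (fun v => dot (du v) (w q) + dot (u q) (dw v)) q.
Proof.
move=> su sw.
have s i := SD_mul (su i) (sw i).
by apply: SD_eq (SD_lin 1 1 (SD_lin 1 1 (s 0) (s 1)) (s 2)) _ _ => y;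
  rewrite !dot3E; ring.
Qed.

Lemma SDv_cst {V : normedModType R} n (a : 'cV[R]_n) (q : V) : SDv (fun=> a) (fun=> 0) q.
Proof. by move=> i; apply: SD_eq (SD_cst (a i 0) q) _ _ => v //; rewrite mxE. Qed.

Lemma SD_enorm {V : normedModType R} (u du : V -> 'cV[R]_3) (q : V) :
  u q != 0 -> SDv u du q ->
  SD (fun y => enorm (u y)) (fun v => dot (u q) (du v) / enorm (u q)) q.
Proof.
move=> u0 su; have du0 : 0 < dot (u q) (u q) by rewrite -enorm_sqr exprn_gt0// enorm_gt0.
apply: SD_eq (@SD_sqrt _ _ (fun y => dot (u y) (u y)) _ q du0 (SD_dot su su)) _ _ => //= v.
rewrite -/(enorm _) (dotC (du v)); field.
by rewrite !gt_eqF// ?addr_gt0// enorm_gt0.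
Qed.

End Vectors3.

(** * Coordinates of states as position, velocity and mass *)

Section Coordinates.
Context {R : realType}.
Local Notation state := 'cV[R]_7.

Definition ir (j : 'I_3) : 'I_7 := lshift 1 (lshift 3 j).
Definition iv (j : 'I_3) : 'I_7 := lshift 1 (rshift 3 j).
Definition im : 'I_7 := rshift 6 (0 : 'I_1).

Lemma ind7 (P : 'I_7 -> Prop) : (forall j, P (ir j)) -> (forall j, P (iv j)) ->
  P im -> forall i, P i.
Proof.
move=> hr hv hm i; have [k ->|k ->] := @split_ordP 6%N 1%N i.
  by have [j ->|j ->] := @split_ordP 3%N 3%N k; [exact: hr|exact: hv].
by rewrite (ord1 k); exact: hm.
Qed.

Lemma posE (x : state) j : pos x j 0 = x (ir j) 0.
Proof. by rewrite !mxE. Qed.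

Lemma velE (x : state) j : vel x j 0 = x (iv j) 0.
Proof. by rewrite !mxE. Qed.

Lemma massE (x : state) : mass x = x im 0.
Proof. by rewrite /mass mxE. Qed.

Lemma pos_mkstate (r v : 'cV[R]_3) m : pos (mkstate r v m) = r.
Proof. by rewrite /pos /mkstate !col_mxKu. Qed.

Lemma vel_mkstate (r v : 'cV[R]_3) m : vel (mkstate r v m) = v.
Proof. by rewrite /vel /mkstate col_mxKu col_mxKd. Qed.

Lemma mass_mkstate (r v : 'cV[R]_3) m : mass (mkstate r v m) = m.
Proof. by rewrite /mass /mkstate col_mxKd mxE eqxx. Qed.

Lemma mkstate_ir (r v : 'cV[R]_3) m j : mkstate r v m (ir j) 0 = r j 0.
Proof. by rewrite -posE pos_mkstate. Qed.

Lemma mkstate_iv (r v : 'cV[R]_3) m j : mkstate r v m (iv j) 0 = v j 0.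
Proof. by rewrite -velE vel_mkstate. Qed.

Lemma mkstate_im (r v : 'cV[R]_3) m : mkstate r v m im 0 = m.
Proof. by rewrite -massE mass_mkstate. Qed.

Lemma dot_state (x y : state) :
  dot x y = dot (pos x) (pos y) + dot (vel x) (vel y) + mass x * mass y.
Proof.
rewrite !dotE (@big_split_ord _ _ _ 6%N 1%N) (@big_split_ord _ _ _ 3%N 3%N) big_ord1/=.
by congr (_ + _ + _); [apply: eq_bigr => j _; rewrite !posE|apply: eq_bigr => j _; rewrite !velE|rewrite !massE].
Qed.

(** The map [l] is the identity, [fst] or [snd], so that one statement serves both states and pairs
    of state and costate. By linearity the remainder is zero. *)
Lemma SD_coord (V : normedModType R) (l : {linear V -> state}) (q : V) i :
  (forall v, `|l v| <= `|v|) -> SD (fun y => l y i 0) (fun v => l v i 0) q.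
Proof.
move=> hl; split.
  by exists 1 => v; rewrite mul1r (le_trans _ (hl v))// mx_entry_le_norm.
move=> e e0; exists 1 => // q1 q2 _ _.
by rewrite linearB !mxE subrr normr0 mulr_ge0// ltW.
Qed.

Lemma SDv_pos (V : normedModType R) (l : {linear V -> state}) (q : V) :
  (forall v, `|l v| <= `|v|) -> SDv (fun y => pos (l y)) (fun v => pos (l v)) q.
Proof.
by move=> hl j; apply: SD_eq (SD_coord q (ir j) hl) _ _ => y; rewrite posE.
Qed.

Lemma SDv_vel (V : normedModType R) (l : {linear V -> state}) (q : V) :
  (forall v, `|l v| <= `|v|) -> SDv (fun y => vel (l y)) (fun v => vel (l v)) q.
Proof.
by move=> hl j; apply: SD_eq (SD_coord q (iv j) hl) _ _ => y; rewrite velE.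
Qed.

Lemma SD_mass (V : normedModType R) (l : {linear V -> state}) (q : V) :
  (forall v, `|l v| <= `|v|) -> SD (fun y => mass (l y)) (fun v => mass (l v)) q.
Proof.
by move=> hl; apply: SD_eq (SD_coord q im hl) _ _ => y; rewrite massE.
Qed.

End Coordinates.

(** * The Hamiltonian system *)

Section Hamiltonian.
Context {R : realType} (c : constants R).
Local Notation state := 'cV[R]_7.

(** Closed form of the adjoint right-hand side, minus the gradient of [h] in the state; see
    [grad_h_state]. *)
Definition costate_rate (x p : state) (rho : R) (tau : 'cV[R]_3) : state :=
  mkstate ((mu c / enorm (pos x) ^+ 3) *: vel p -
           (3 * mu c * dot (vel p) (pos x) / enorm (pos x) ^+ 5) *: pos x)
          (- pos p)
          (rho * (umax c / mass x ^+ 2 * dot (vel p) tau)).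

Lemma grad_SD n (g : 'cV[R]_n -> R) (a x : 'cV[R]_n) :
  SD g (fun w => dot a w) x -> grad g x = a.
Proof.
move=> sg; apply/matrixP => i j; rewrite (ord1 j) mxE (SD_derive sg); last first.
  by move=> t; rewrite dotZr.
rewrite dotE (bigD1 i)//= mxE !eqxx mulr1 big1 ?addr0// => k ki.
by rewrite mxE (negbTE ki) mulr0.
Qed.

Lemma dot_norm_le n (a b : 'cV[R]_n) : `|dot a b| <= n%:R * `|a| * `|b|.
Proof.
rewrite dotE; apply: (le_trans (ler_norm_sum _ _ _)).
apply: (@le_trans _ _ (\sum_(i < n) `|a| * `|b|)).
  by apply: ler_sum => i _; rewrite normrM ler_pM ?mx_entry_le_norm.
by rewrite sumr_const card_ord -mulrA mulr_natl.
Qed.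

Lemma grad_h_costate (x p : state) rho tau :
  grad (fun p' => h c x p' rho tau) p = f0 c x + rho *: f1 c x tau.
Proof.
set a := f0 c x + _; apply: grad_SD; split.
  by exists (7%:R * `|a|) => v; exact: dot_norm_le.
move=> e e0; exists 1 => // q1 q2 _ _; rewrite /h -/a.
have -> : dot q1 a - rho - (dot q2 a - rho) - dot a (q1 - q2) = 0.
  by rewrite (dotC a) dotDl dotNl; ring.
by rewrite normr0 mulr_ge0// ltW.
Qed.

Lemma hE (x p : state) rho tau : h c x p rho tau =
  dot (pos p) (vel x) - mu c * (dot (vel p) (pos x) / enorm (pos x) ^+ 3)
  + rho * (umax c * (dot (vel p) tau / mass x) - mass p * (beta c * umax c)) - rho.
Proof.
rewrite /h dotDr dotZr !dot_state /f0 /f1 !pos_mkstate !vel_mkstate !mass_mkstate.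
rewrite !dotZr (dotC (pos p) 0) dot0l; ring.
Qed.

Lemma grad_h_state (x p : state) rho tau : pos x != 0 -> mass x != 0 ->
  - grad (fun x' => h c x' p rho tau) x = costate_rate x p rho tau.
Proof.
move=> r0 m0; rewrite -[RHS]opprK; congr (- _); apply: grad_SD.
have id_le (v : state) : `|v| <= `|v| by [].
have sr := @SDv_pos R _ (@idfun state) x id_le.
have sv := @SDv_vel R _ (@idfun state) x id_le.
have sm := @SD_mass R _ (@idfun state) x id_le.
have e0 : 0 < enorm (pos x) by rewrite enorm_gt0.
have en0 : enorm (pos x) != 0 by rewrite gt_eqF.
have se := SD_enorm r0 sr.
have se1 := @SD_inv _ _ (fun y : state => enorm (pos y)) _ x en0 se.
have se3 := SD_mul se1 (SD_sqr se1).
have s1 := SD_dot (SDv_cst (pos p) x) sv.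
have s2 := SD_mul (SD_dot (SDv_cst (vel p) x) sr) se3.
have s3 := @SD_inv _ _ (fun y : state => mass y) _ x m0 sm.
have s12 := SD_lin 1 (- mu c) s1 s2.
have s4 := SD_lin (rho * umax c * dot (vel p) tau)
  (- rho * (mass p * (beta c * umax c) + 1)) s3 (SD_cst 1 x).
apply: SD_eq (SD_lin 1 1 s12 s4) _ _ => [y|w] /=.
  rewrite hE -exprVn; ring.
rewrite dotNl dot_state /costate_rate pos_mkstate vel_mkstate mass_mkstate.
rewrite dotDl !dotNl !dotZl !dot0l.
field.
by rewrite en0 m0.
Qed.

Lemma X_pos (x : state) : X c x -> pos x != 0.
Proof. by case. Qed.

Lemma X_enorm (x : state) : X c x -> rc c < enorm (pos x).
Proof. by case. Qed.

Lemma X_mass (x : state) : X c x -> mc c <= mass x.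
Proof. by case. Qed.

Lemma X_mass_gt0 (x : state) : X c x -> 0 < mass x.
Proof. by move=> /X_mass; apply: lt_le_trans; exact: mc_gt0. Qed.

(** The fourteen scalar unknowns are indexed by a finite type, so that norms and differential
    equations are handled one scalar at a time. *)
Definition coord (k : bool * 'I_7) (z : state * state) : R :=
  if k.1 then z.1 k.2 0 else z.2 k.2 0.

Definition field (z : state * state) (rho : R) (tau : 'cV[R]_3) : state * state :=
  (f0 c z.1 + rho *: f1 c z.1 tau, costate_rate z.1 z.2 rho tau).

Record dynamics (tf : R) (z : R -> state * state) (rho : R -> R)
    (tau : R -> 'cV[R]_3) : Prop := Dynamics {
  dyn_X : forall t, 0 <= t <= tf -> X c (z t).1;
  dyn_adm : forall t, 0 <= t <= tf -> admissible (rho t) (tau t);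
  dyn_max : forall t, 0 <= t <= tf -> forall rho' tau', admissible rho' tau' ->
    h c (z t).1 (z t).2 rho' tau' <= h c (z t).1 (z t).2 (rho t) (tau t);
  dyn_ode : forall k, primitive tf (fun t => coord k (z t))
    (fun t => coord k (field (z t) (rho t) (tau t))) }.

Lemma eq_primitive (T : R) (y g g' : R -> R) : 0 <= T ->
  (forall t, 0 <= t <= T -> g t = g' t) -> primitive T y g -> primitive T y g'.
Proof.
move=> T0 gg [ig hg]; split.
  by apply: eq_integrable ig => // t; rewrite inE/= in_itv/= => tT; rewrite gg.
move=> t tT; rewrite (hg t tT); congr (_ + _); apply: eq_Rintegral => s.
rewrite inE/= in_itv/= => st; apply: gg; case/andP: tT; case/andP: st; lra.
Qed.

Lemma extremal_dynamics l (phi : state -> 'cV[R]_l) tf (z : R -> state * state)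
    rho tau : 0 <= tf ->
  extremal c phi tf (fun t => (z t).1) (fun t => (z t).2) rho tau ->
  dynamics tf z rho tau.
Proof.
move=> tf0 [[[_ _ adm] hX] hx hp hm _]; split => // -[[] i]; rewrite /coord/=.
  have := hx i; apply: eq_primitive => // t tT.
  by rewrite grad_h_costate.
have := hp i; apply: eq_primitive => // t tT.
by rewrite grad_h_state ?X_pos ?gt_eqF ?X_mass_gt0//; exact: hX.
Qed.

End Hamiltonian.

(** * Maximum principle and growth of the Hamiltonian field *)

Section FieldEstimates.
Context {R : realType} (c : constants R).
Local Notation state := 'cV[R]_7.
Implicit Types (z w : state * state).

Lemma coord_le_norm k z : `|coord k z| <= `|z|.
Proof.
rewrite [leRHS]prod_normE le_max /coord; case: k => -[] i /=.
  by rewrite mx_entry_le_norm.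
by rewrite [X in _ || X]mx_entry_le_norm orbT.
Qed.

Lemma norm_le_coord z (C : R) : 0 <= C -> (forall k, `|coord k z| <= C) -> `|z| <= C.
Proof.
move=> C0 h; rewrite prod_normE ge_max; apply/andP; split.
  by apply: mx_norm_le => // i j; rewrite (ord1 j); exact: (h (true, i)).
by apply: mx_norm_le => // i j; rewrite (ord1 j); exact: (h (false, i)).
Qed.

Lemma coordD k z w : coord k (z + w) = coord k z + coord k w.
Proof. by rewrite /coord; case: ifP => _; rewrite mxE. Qed.

Lemma coordN k z : coord k (- z) = - coord k z.
Proof. by rewrite /coord; case: ifP => _; rewrite mxE. Qed.

Lemma coordB k z w : coord k (z - w) = coord k z - coord k w.
Proof. by rewrite coordD coordN. Qed.

Lemma coordZ k a z : coord k (a *: z) = a * coord k z.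
Proof. by rewrite /coord; case: ifP => _; rewrite mxE. Qed.

Lemma H1E (x p : state) :
  H1 c x p = umax c * (enorm (vel p) / mass x) - mass p * (beta c * umax c) - 1.
Proof.
rewrite /H1 dot_state /f1 pos_mkstate vel_mkstate mass_mkstate dotZr.
rewrite (dotC _ 0) dot0l /thrust_dir dotZr -enorm_sqr.
have [->|/eqP n0] := eqVneq (vel p) 0.
  by rewrite (_ : enorm 0 = 0) ?/enorm ?dot0l ?sqrtr0//; ring.
have e0 : enorm (vel p) != 0 by rewrite gt_eqF// enorm_gt0; exact/eqP.
by rewrite expr2 mulKf//; ring.
Qed.

(** [h] is affine in [rho]. Its slope is [H1] minus a misalignment defect, which is nonnegative by
    Cauchy-Schwarz and zero for [thrust_dir p]. *)
Lemma h_switch (x p : state) rho tau : enorm (vel p) != 0 ->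
  h c x p rho tau = h c x p 0 tau + rho *
    (H1 c x p - umax c / mass x * (enorm (vel p) - dot (vel p) tau)).
Proof. by move=> e0; rewrite !hE H1E; ring. Qed.

Section MaximumPrinciple.
Variables (x p : state) (rho : R) (tau : 'cV[R]_3).
Hypotheses (Xx : X c x) (pv0 : vel p != 0) (adm : admissible rho tau).
Hypothesis hmax : forall rho' tau', admissible rho' tau' ->
  h c x p rho' tau' <= h c x p rho tau.

Lemma enorm_thrust_dir : enorm (thrust_dir p) = 1.
Proof.
by rewrite /thrust_dir enormZ ?invr_ge0 ?enorm_ge0// mulVf// gt_eqF// enorm_gt0.
Qed.

Lemma dot_thrust_dir : dot (vel p) (thrust_dir p) = enorm (vel p).
Proof. by rewrite /thrust_dir dotZr -enorm_sqr expr2 mulKf// gt_eqF// enorm_gt0. Qed.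

Let m0 : 0 < umax c / mass x.
Proof. by rewrite divr_gt0 ?umax_gt0// (X_mass_gt0 Xx). Qed.

(** Maximality is tested against the pair made of [rho'] and [thrust_dir p]; the value of [h] at
    zero throttle does not depend on the direction and cancels. *)
Let ineq rho' : 0 <= rho' <= 1 -> rho' * H1 c x p <=
  rho * (H1 c x p - umax c / mass x * (enorm (vel p) - dot (vel p) tau)).
Proof.
move=> r01; have e0 : enorm (vel p) != 0 by rewrite gt_eqF// enorm_gt0.
have := hmax (conj r01 enorm_thrust_dir).
rewrite (h_switch _ _ _ e0) [leRHS](h_switch _ _ _ e0) dot_thrust_dir subrr mulr0 subr0.
by rewrite !(hE _ _ _ 0) !mul0r !addr0 !subr0 lerD2l.
Qed.

Let defect : 0 <= umax c / mass x * (enorm (vel p) - dot (vel p) tau).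
Proof.
by rewrite mulr_ge0 ?(ltW m0)// subr_ge0 dot_le_enorm//; case: adm.
Qed.

(* This also covers the times where H1 = 0, at which rho is not determined. *)
Lemma max_alignment : rho * dot (vel p) tau = rho * enorm (vel p).
Proof.
have [/andP[r0 r1] _] := adm; have := @ineq rho; rewrite r0 r1 => /(_ isT) h.
apply/eqP; rewrite eq_le ler_wpM2l ?dot_le_enorm//=; last by case: adm.
have : rho * (umax c / mass x * (enorm (vel p) - dot (vel p) tau)) <= 0 by nra.
rewrite mulrCA pmulr_rle0// mulrBr; lra.
Qed.

Lemma max_thrust_on : 0 < H1 c x p -> rho = 1 /\ tau = thrust_dir p.
Proof.
move=> H0; have [/andP[r0 r1] t1] := adm.
have := @ineq 1; rewrite ler01 lexx => /(_ isT) h1.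
have rho1 : rho = 1.
  have d0 := mulr_ge0 r0 defect.
  by apply/eqP; rewrite eq_le r1/= -(ler_pM2r H0); lra.
split=> //; apply: dot_eq_enorm => //.
by have := max_alignment; rewrite rho1 !mul1r.
Qed.

Lemma max_thrust_off : H1 c x p < 0 -> rho = 0.
Proof.
move=> H0; have [/andP[r0 r1] t1] := adm.
have := @ineq 0; rewrite lexx ler01 => /(_ isT) h1.
have d0 := mulr_ge0 r0 defect.
by apply/eqP; rewrite eq_le r0 andbT -(ler_nM2r H0); lra.
Qed.

End MaximumPrinciple.

Lemma field_ir z rho tau j : coord (true, ir j) (field c z rho tau) = vel z.1 j 0.
Proof. by rewrite /coord/= /f0 /f1 mxE [X in _ + X]mxE !mkstate_ir [X in _ + _ * X]mxE mulr0 addr0. Qed.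

Lemma field_iv z rho tau j : coord (true, iv j) (field c z rho tau) =
  - (mu c / enorm (pos z.1) ^+ 3) * pos z.1 j 0 + rho * (umax c / mass z.1 * tau j 0).
Proof.
rewrite /coord/= /f0 /f1 mxE [X in _ + X]mxE !mkstate_iv.
by rewrite [X in X + _]mxE [X in _ + _ * X]mxE.
Qed.

Lemma field_im z rho tau : coord (true, im) (field c z rho tau) =
  - (rho * (beta c * umax c)).
Proof. by rewrite /coord/= /f0 /f1 mxE [X in _ + X]mxE !mkstate_im add0r mulrN. Qed.

Lemma field_pr z rho tau j : coord (false, ir j) (field c z rho tau) =
  mu c / enorm (pos z.1) ^+ 3 * vel z.2 j 0 -
  3 * mu c * dot (vel z.2) (pos z.1) / enorm (pos z.1) ^+ 5 * pos z.1 j 0.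
Proof.
rewrite /coord/= /costate_rate mkstate_ir mxE [X in X + _]mxE [X in _ + X]mxE.
by rewrite [X in _ - X]mxE.
Qed.

Lemma field_pv z rho tau j : coord (false, iv j) (field c z rho tau) = - pos z.2 j 0.
Proof. by rewrite /coord/= /costate_rate mkstate_iv mxE. Qed.

Lemma field_pm z rho tau : coord (false, im) (field c z rho tau) =
  rho * (umax c / mass z.1 ^+ 2 * dot (vel z.2) tau).
Proof. by rewrite /coord/= /costate_rate mkstate_im. Qed.

Definition fieldE := (field_ir, field_iv, field_im, field_pr, field_pv, field_pm).

(** On [X] the radius stays above [rc] and the mass above [mc], so every singular factor is bounded
    and the field grows at most linearly, through the velocity and the costate only. *)
Lemma field_growth : exists A L : R, [/\ 0 <= A, 0 <= L &
  forall z rho tau, X c z.1 -> admissible rho tau ->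
  forall k, `|coord k (field c z rho tau)| <= A + L * `|z|].
Proof.
have mu0 := mu_gt0 c; have b0 := beta_gt0 c; have u0 := umax_gt0 c.
have m0 := mc_gt0 c; have r0 := rc_gt0 c.
pose A1 := mu c / rc c ^+ 2; pose A2 := umax c / mc c; pose A3 := beta c * umax c.
pose L1 := mu c / rc c ^+ 3; pose L2 := umax c / mc c ^+ 2.
have A10 : 0 <= A1 by rewrite divr_ge0 ?exprn_ge0// ltW.
have A20 : 0 <= A2 by rewrite divr_ge0// ltW.
have A30 : 0 <= A3 by rewrite mulr_ge0// ltW.
have L10 : 0 <= L1 by rewrite divr_ge0 ?exprn_ge0// ltW.
have L20 : 0 <= L2 by rewrite divr_ge0 ?exprn_ge0// ltW.
(* [A1], [A2], [A3] bound gravity, thrust and mass flow. In the growth rate, [1] is for [vel z.1]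
   and [pos z.2], [10 = 1 + 9] for the two terms of the gravity gradient, and [3] for the three
   products in a dot product. *)
exists (A1 + A2 + A3), (1 + 10 * L1 + 3 * L2); split; [by lra|by lra|].
move=> z rho tau Xz [/andP[rho0 rho1] tau1].
set r := enorm (pos z.1).
have rr : rc c < r by exact: X_enorm.
have rp : 0 < r by exact: lt_trans rr.
have mm : mc c <= mass z.1 by exact: X_mass.
have mp : 0 < mass z.1 by exact: X_mass_gt0 Xz.
have z0 : 0 <= `|z| by [].
have hr j : `|pos z.1 j 0| <= r by exact: entry_le_enorm.
have hv j : `|vel z.1 j 0| <= `|z| by rewrite velE; exact: (coord_le_norm (true, _)).
have hpr j : `|pos z.2 j 0| <= `|z| by rewrite posE; exact: (coord_le_norm (false, _)).
have hpv j : `|vel z.2 j 0| <= `|z| by rewrite velE; exact: (coord_le_norm (false, _)).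
have hdot (b : 'cV[R]_3) (C : R) : (forall j, `|b j 0| <= C) -> `|dot (vel z.2) b| <= 3 * `|z| * C.
  move=> hb; rewrite dot3E.
  have h j : `|vel z.2 j 0 * b j 0| <= `|z| * C by rewrite normrM ler_pM.
  apply: (le_trans (ler_normD _ _)); apply: (le_trans (lerD (ler_normD _ _) (lexx _))).
  by have h0 := h 0; have h1 := h 1; have h2 := h 2; lra.
have htau j : `|tau j 0| <= 1 by rewrite -tau1; exact: entry_le_enorm.
have q1 n : (0 < n)%N -> r ^- n <= rc c ^- n.
  move=> n0; rewrite lef_pV2 ?posrE ?exprn_gt0// ler_pXn2r// ?nnegrE ?ltW//.
have q2 : (mass z.1)^-1 <= (mc c)^-1 by rewrite lef_pV2.
have q3 : (mass z.1) ^- 2 <= (mc c) ^- 2.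
  by rewrite lef_pV2 ?posrE ?exprn_gt0// ler_pXn2r// ?nnegrE ?ltW.
have L1z : 0 <= L1 * `|z| by rewrite mulr_ge0.
have L2z : 0 <= L2 * `|z| by rewrite mulr_ge0.
case=> -[]; elim/ind7 => [j|j|]; rewrite fieldE -?/r.
- have := hv j; lra.
- apply: (le_trans (ler_normD _ _)).
  have k1 : `|- (mu c / r ^+ 3) * pos z.1 j 0| <= A1.
    rewrite mulNr normrN normrM (@ger0_norm _ (mu c / _)); last first.
      by rewrite divr_ge0 ?exprn_ge0// ltW.
    apply: (@le_trans _ _ (mu c / r ^+ 3 * r)).
      by rewrite ler_wpM2l// divr_ge0 ?exprn_ge0// ltW.
    have -> : mu c / r ^+ 3 * r = mu c * r ^- 2 by field; rewrite gt_eqF.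
    by rewrite ler_pM2l// q1.
  have k2 : `|rho * (umax c / mass z.1 * tau j 0)| <= A2.
    rewrite normrM (ger0_norm rho0) normrM (@ger0_norm _ (umax c / _)); last first.
      by rewrite divr_ge0// ltW.
    have k3 : umax c / mass z.1 <= A2 by rewrite ler_pM2l.
    have k4 : umax c / mass z.1 * `|tau j 0| <= A2 * 1.
      by rewrite ler_pM// divr_ge0// ltW.
    have : rho * (umax c / mass z.1 * `|tau j 0|) <= 1 * (A2 * 1).
      by rewrite ler_pM// mulr_ge0// divr_ge0// ltW.
    by rewrite mul1r mulr1.
  lra.
- rewrite normrN normrM (ger0_norm rho0) -/A3 (ger0_norm A30).
  have : rho * A3 <= 1 * A3 by rewrite ler_wpM2r.
  lra.
- apply: (le_trans (ler_normB _ _)).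
  have k1 : `|mu c / r ^+ 3 * vel z.2 j 0| <= L1 * `|z|.
    have k0 : 0 <= mu c / r ^+ 3 by rewrite divr_ge0 ?exprn_ge0// ltW.
    rewrite normrM (ger0_norm k0) ler_pM//.
    by rewrite ler_pM2l// q1.
  have k2 : `|3 * mu c * dot (vel z.2) (pos z.1) / r ^+ 5 * pos z.1 j 0| <= 9 * (L1 * `|z|).
    have := ler_pM (normr_ge0 _) (normr_ge0 _) (hdot _ _ hr) (hr j).
    rewrite -normrM => k3.
    have -> : 3 * mu c * dot (vel z.2) (pos z.1) / r ^+ 5 * pos z.1 j 0 =
      (3 * mu c / r ^+ 5) * (dot (vel z.2) (pos z.1) * pos z.1 j 0) by ring.
    have k4 : 0 <= 3 * mu c / r ^+ 5 by rewrite divr_ge0 ?mulr_ge0 ?exprn_ge0// ltW.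
    rewrite normrM (ger0_norm k4); apply: (le_trans (ler_wpM2l k4 k3)).
    have -> : 3 * mu c / r ^+ 5 * (3 * `|z| * r * r) = 9 * (mu c * r ^- 3 * `|z|).
      by field; rewrite gt_eqF.
    rewrite ler_pM2l// ler_wpM2r// ler_pM2l//; exact: q1.
  lra.
- have := hpr j; rewrite normrN; lra.
- have k1 := hdot _ _ htau.
  have k2 : 0 <= umax c / mass z.1 ^+ 2 by rewrite divr_ge0 ?exprn_ge0// ltW.
  have k3 : umax c / mass z.1 ^+ 2 <= L2 by rewrite ler_pM2l.
  rewrite normrM (ger0_norm rho0) normrM (ger0_norm k2).
  have k4 := ler_pM k2 (normr_ge0 _) k3 k1.
  have k5 : rho * (umax c / mass z.1 ^+ 2 * `|dot (vel z.2) tau|) <=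
      1 * (L2 * (3 * `|z| * 1)).
    by rewrite ler_pM// mulr_ge0.
  by move: k5; rewrite mul1r; lra.
Qed.

End FieldEstimates.

(** * Local regularity of the maximized field and of the switching function *)

Section LocalFlow.
Context {R : realType} (c : constants R).
Local Notation state := 'cV[R]_7.
Implicit Types (z w : state * state).

(** Maximizing controls turn the field into [drift + rho * thrust], where [thrust] has the optimal
    direction already substituted; only the scalar [rho] still depends on time explicitly. *)
Definition drift z : state * state := field c z 0 0.
Definition thrust z : state * state :=
  (f1 c z.1 (thrust_dir z.2),
   mkstate 0 0 (umax c / mass z.1 ^+ 2 * enorm (vel z.2))).

Lemma field_off z tau : field c z 0 tau = drift z.
Proof. by rewrite /drift /field /costate_rate !scale0r !mul0r. Qed.

Lemma thrust_ir z j : coord (true, ir j) (thrust z) = 0.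
Proof. by rewrite /coord/= mkstate_ir mxE. Qed.

Lemma thrust_iv z j : coord (true, iv j) (thrust z) =
  umax c / mass z.1 * thrust_dir z.2 j 0.
Proof. by rewrite /coord/= mkstate_iv mxE. Qed.

Lemma thrust_im z : coord (true, im) (thrust z) = - (beta c * umax c).
Proof. by rewrite /coord/= mkstate_im. Qed.

Lemma thrust_pr z j : coord (false, ir j) (thrust z) = 0.
Proof. by rewrite /coord/= mkstate_ir mxE. Qed.

Lemma thrust_pv z j : coord (false, iv j) (thrust z) = 0.
Proof. by rewrite /coord/= mkstate_iv mxE. Qed.

Lemma thrust_pm z : coord (false, im) (thrust z) =
  umax c / mass z.1 ^+ 2 * enorm (vel z.2).
Proof. by rewrite /coord/= mkstate_im. Qed.

Definition thrustE :=
  (thrust_ir, thrust_iv, thrust_im, thrust_pr, thrust_pv, thrust_pm).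

Lemma coord_inj z w : (forall k, coord k z = coord k w) -> z = w.
Proof.
move=> h; apply/eqP; rewrite -subr_eq0 -normr_le0.
by apply: norm_le_coord => // k; rewrite coordB h subrr normr0.
Qed.

Lemma field_on z : vel z.2 != 0 ->
  field c z 1 (thrust_dir z.2) = drift z + thrust z.
Proof.
move=> pv0; apply: coord_inj => -[[]]; elim/ind7 => [j|j|];
  rewrite coordD thrustE !fieldE ?dot_thrust_dir//; ring.
Qed.

Lemma fst_norm_le z : `|[the {linear _ -> _} of fst] z : state| <= `|z|.
Proof. by rewrite [leRHS]prod_normE le_max lexx. Qed.

Lemma snd_norm_le z : `|[the {linear _ -> _} of snd] z : state| <= `|z|.
Proof. by rewrite [leRHS]prod_normE le_max lexx orbT. Qed.

Lemma SD_coord_lip (V : normedModType R) (F : V -> state * state) (zb : V) :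
  (forall k, exists d, SD (fun y => coord k (F y)) d zb) ->
  exists L r : R, [/\ 0 <= L, 0 < r & forall z1 z2 : V,
    `|z1 - zb| < r -> `|z2 - zb| < r -> `|F z1 - F z2| <= L * `|z1 - z2|].
Proof.
move=> hF.
have /choice[Lr hLr] : forall k, exists Lr : R * R, [/\ 0 <= Lr.1, 0 < Lr.2 &
    forall z1 z2 : V, `|z1 - zb| < Lr.2 -> `|z2 - zb| < Lr.2 ->
    `|coord k (F z1) - coord k (F z2)| <= Lr.1 * `|z1 - z2|].
  by move=> k; have [d /SD_lip[L [r h]]] := hF k; exists (L, r).
exists (\sum_k (Lr k).1), (\big[Num.min/1]_k (Lr k).2); split.
- by apply: sumr_ge0 => k _; have [] := hLr k.
- by apply/bigmin_gtP; split=> // k _; have [] := hLr k.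
move=> z1 z2 /bigmin_gtP[_ h1] /bigmin_gtP[_ h2].
apply: norm_le_coord => [|k].
  by rewrite mulr_ge0// sumr_ge0// => k _; have [] := hLr k.
rewrite coordB; have [_ _ h] := hLr k.
apply: (le_trans (h _ _ (h1 k isT) (h2 k isT))); rewrite ler_wpM2r//.
by rewrite (bigD1 k)//= lerDl sumr_ge0// => i _; have [] := hLr i.
Qed.

Section Strict.
Variable zb : state * state.
Hypotheses (r0 : pos zb.1 != 0) (m0 : mass zb.1 != 0) (pv0 : vel zb.2 != 0).

Let sr : SDv (fun z : state * state => pos z.1) (fun w => pos w.1) zb :=
  SDv_pos zb fst_norm_le.
Let sv : SDv (fun z : state * state => vel z.1) (fun w => vel w.1) zb :=
  SDv_vel zb fst_norm_le.
Let sm : SD (fun z : state * state => mass z.1) (fun w => mass w.1) zb :=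
  SD_mass zb fst_norm_le.
Let spr : SDv (fun z : state * state => pos z.2) (fun w => pos w.2) zb :=
  SDv_pos zb snd_norm_le.
Let spv : SDv (fun z : state * state => vel z.2) (fun w => vel w.2) zb :=
  SDv_vel zb snd_norm_le.
Let spm : SD (fun z : state * state => mass z.2) (fun w => mass w.2) zb :=
  SD_mass zb snd_norm_le.
Let simv := @SD_inv _ _ (fun z : state * state => mass z.1) _ zb m0 sm.
Let sepv := @SD_enorm _ _ (fun z : state * state => vel z.2) _ zb pv0 spv.

Let er0 : enorm (pos zb.1) != 0.
Proof. by rewrite gt_eqF// enorm_gt0. Qed.

Let epv0 : enorm (vel zb.2) != 0.
Proof. by rewrite gt_eqF// enorm_gt0. Qed.

Let sier := @SD_inv _ _ (fun z : state * state => enorm (pos z.1)) _ zb er0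
  (@SD_enorm _ _ (fun z : state * state => pos z.1) _ zb r0 sr).

Lemma SD_drift k : exists d, SD (fun z => coord k (drift z)) d zb.
Proof.
have s3 := SD_mul sier (SD_sqr sier).
have s5 := SD_mul s3 (SD_sqr sier).
(* Negative powers of the radius are rewritten as products of [y = x^-1] and squares, the forms
   covered by the [SD] rules. *)
have V3 (x y : R) : y = x^-1 -> x ^- 3 = y * y ^+ 2.
  by move=> ->; rewrite -exprVn -exprS.
have V5 (x y : R) : y = x^-1 -> x ^- 5 = y * y ^+ 2 * y ^+ 2.
  by move=> ->; rewrite -exprVn -exprS -exprD.
case: k => -[]; elim/ind7 => [j|j|].
- by eexists; apply: SD_eq (sv j) _ _ => // z; rewrite fieldE.
- eexists; apply: SD_eq (SD_mul (SD_lin (- mu c) 0 s3 s3) (sr j)) _ _ => // z /=.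
  by rewrite fieldE (V3 _ _ erefl); ring.
- by eexists; apply: SD_eq (SD_cst 0 zb) _ _ => // z; rewrite fieldE mul0r oppr0.
- have s1 := SD_mul (SD_lin (mu c) 0 s3 s3) (spv j).
  have s2 := SD_mul (SD_mul s5 (SD_dot spv sr)) (sr j).
  eexists; apply: SD_eq (SD_lin 1 (- (3 * mu c)) s1 s2) _ _ => // z /=.
  by rewrite fieldE (V3 _ _ erefl) (V5 _ _ erefl); ring.
- by eexists; apply: SD_eq (SD_lin (-1) 0 (spr j) (spr j)) _ _ => // z /=; rewrite fieldE; ring.
- by eexists; apply: SD_eq (SD_cst 0 zb) _ _ => // z; rewrite fieldE mul0r.
Qed.

Lemma SD_thrust k : exists d, SD (fun z => coord k (thrust z)) d zb.
Proof.
have V2 (x y : R) : y = x^-1 -> x ^- 2 = y ^+ 2 by move=> ->; rewrite -exprVn.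
have siepv := @SD_inv _ _ (fun z : state * state => enorm (vel z.2)) _ zb epv0 sepv.
case: k => -[]; elim/ind7 => [j|j|].
- by eexists; apply: SD_eq (SD_cst 0 zb) _ _ => // z; rewrite thrustE.
- eexists; apply: SD_eq (SD_mul (SD_lin (umax c) 0 simv simv) (SD_mul siepv (spv j))) _ _ => // z /=.
  by rewrite thrustE [thrust_dir _ _ _]mxE; ring.
- by eexists; apply: SD_eq (SD_cst (- (beta c * umax c)) zb) _ _ => // z; rewrite thrustE.
- by eexists; apply: SD_eq (SD_cst 0 zb) _ _ => // z; rewrite thrustE.
- by eexists; apply: SD_eq (SD_cst 0 zb) _ _ => // z; rewrite thrustE.
- eexists; apply: SD_eq (SD_mul (SD_lin (umax c) 0 (SD_sqr simv) (SD_sqr simv)) sepv) _ _ => // z /=.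
  by rewrite thrustE (V2 _ _ erefl); ring.
Qed.

Lemma thrust_continuous (e : R) : 0 < e ->
  exists2 r : R, 0 < r & forall z, `|z - zb| < r -> `|thrust z - thrust zb| <= e.
Proof.
move=> e0; have [L [r [L0 r00 hL]]] := SD_coord_lip SD_thrust.
have L1 : 0 < L + 1 by lra.
exists (Num.min r (e / (L + 1))); first by rewrite lt_min r00 divr_gt0.
move=> z; rewrite lt_min => /andP[h1 h2].
apply: (le_trans (hL z zb h1 _)); first by rewrite subrr normr0.
move: h2; rewrite ltr_pdivlMr// => h2; have := normr_ge0 (z - zb); nra.
Qed.

(* The derivative of H1 along extremals at zb: the terms containing rho cancel. *)
Definition H1_slope : R :=
  - (umax c / (enorm (vel zb.2) * mass zb.1)) * dot (vel zb.2) (pos zb.2).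

Definition dH1 w : R :=
  umax c / (enorm (vel zb.2) * mass zb.1) * dot (vel zb.2) (vel w.2) -
  umax c * enorm (vel zb.2) / mass zb.1 ^+ 2 * mass w.1 -
  beta c * umax c * mass w.2.

Lemma SD_H1 : SD (fun z => H1 c z.1 z.2) dH1 zb.
Proof.
have s1 := SD_mul sepv simv.
have s2 := SD_lin (umax c) (- (beta c * umax c)) s1 spm.
apply: SD_eq (SD_lin 1 (-1) s2 (SD_cst 1 zb)) _ _ => [z|w] /=.
  by rewrite H1E; ring.
by rewrite /dH1; field; rewrite m0 epv0.
Qed.

(** The terms in [rho], one from the mass and one from its costate, appear as a difference. With
    [max_alignment] it becomes [rho] times a quantity vanishing at [zb], so [H1] keeps a derivative
    at a switch although [rho] jumps. *)
Lemma dH1_field z rho tau : dH1 (field c z rho tau) =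
  - (umax c / (enorm (vel zb.2) * mass zb.1)) * dot (vel zb.2) (pos z.2) +
  beta c * umax c ^+ 2 *
  (rho * enorm (vel zb.2) / mass zb.1 ^+ 2 - rho * dot (vel z.2) tau / mass z.1 ^+ 2).
Proof.
have -> : dH1 (field c z rho tau) =
  umax c / (enorm (vel zb.2) * mass zb.1) * dot (vel zb.2) (- pos z.2) -
  umax c * enorm (vel zb.2) / mass zb.1 ^+ 2 * coord (true, im) (field c z rho tau) -
  beta c * umax c * coord (false, im) (field c z rho tau).
  rewrite /dH1 !massE /coord/=; congr (_ * dot _ _ - _ - _).
  by rewrite /costate_rate vel_mkstate.
rewrite !fieldE (dotC _ (- _)) dotNl (dotC (pos _)); ring.
Qed.

Lemma dH1_coord w : dH1 w =
  umax c / (enorm (vel zb.2) * mass zb.1) * (vel zb.2 0 0 * coord (false, iv 0) w +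
    vel zb.2 1 0 * coord (false, iv 1) w + vel zb.2 2 0 * coord (false, iv 2) w) +
  - (umax c * enorm (vel zb.2) / mass zb.1 ^+ 2) * coord (true, im) w +
  - (beta c * umax c) * coord (false, im) w.
Proof. by rewrite /dH1 dot3E !massE !velE /coord/=; ring. Qed.

Lemma dH1B z w : dH1 (z - w) = dH1 z - dH1 w.
Proof. by rewrite !dH1_coord !coordB; ring. Qed.

(** With its coefficients frozen at [zb], [dH1] is a fixed linear form; this replaces a chain rule
    for the nonlinear [H1] along an absolutely continuous curve. *)
Lemma dH1_primitive tf (z : R -> state * state) rho tau : dynamics c tf z rho tau ->
  primitive tf (fun t => dH1 (z t)) (fun t => dH1 (field c (z t) (rho t) (tau t))).
Proof.
move=> hz; have ode := dyn_ode hz.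
pose a j := umax c / (enorm (vel zb.2) * mass zb.1) * vel zb.2 j 0.
have p1 := primitive_lin (a 0) (a 1) (ode (false, iv 0)) (ode (false, iv 1)).
have p2 := primitive_lin (a 2) (- (umax c * enorm (vel zb.2) / mass zb.1 ^+ 2))
  (ode (false, iv 2)) (ode (true, im)).
have := primitive_lin 1 (- (beta c * umax c)) (primitive_lin 1 1 p1 p2) (ode (false, im)).
by move=> p; congr (primitive _ _ _): p; apply/funext => t; rewrite dH1_coord /a; ring.
Qed.

End Strict.

(* A substitute for Gronwall's inequality on short intervals. *)
Lemma sup_half (a b B C : R) (N : R -> R) : a <= b ->
  (forall t, a <= t <= b -> N t <= B) ->
  (forall M, (forall t, a <= t <= b -> N t <= M) ->
     forall t, a <= t <= b -> N t <= C + M / 2) ->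
  forall t, a <= t <= b -> N t <= 2 * C.
Proof.
move=> ab hB hM t tab.
pose S := [set N t | t in `[a, b]].
have S0 : S !=set0 by exists (N a); exists a => //=; rewrite in_itv/= lexx.
have hS : has_sup S.
  split=> //; exists B => _ [s /= + <-]; rewrite in_itv/=; exact: hB.
have hN s : a <= s <= b -> N s <= sup S.
  by move=> sab; apply: ub_le_sup; [case: hS|exists s; rewrite //= in_itv].
have : sup S <= C + sup S / 2.
  by apply: ge_sup => // _ [s /= + <-]; rewrite in_itv/= => sab; exact: (hM (sup S)).
by have := hN t tab; lra.
Qed.

End LocalFlow.

(** * Trajectories near a regular switching point *)

Section Trajectories.
Context {R : realType} (c : constants R).
Local Notation state := 'cV[R]_7.

(** Margins are divided by [b + 1] because the constant [b] may be zero. *)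
Lemma shrink_le (b k e : R) : 0 <= b -> 0 < k -> 0 <= e ->
  b * (e / (k * (b + 1))) <= e / k.
Proof.
move=> b0 k0 e0; have b1 : 0 < b + 1 by lra.
have -> : b * (e / (k * (b + 1))) = (b / (b + 1)) * (e / k).
  by field; rewrite !gt_eqF.
by rewrite ler_piMl ?divr_ge0 ?(ltW k0)// ler_pdivrMr//; lra.
Qed.

(** Linear growth bounds the speed by [A + L M] when the norm is at most [M]; on an interval with
    [L (w - u) <= 1/2], [sup_half] bounds that norm by [2 (|z u| + A (w - u))]. [A] and [L] serve
    all trajectories at once. *)
Lemma dynamics_bound : exists A L : R, [/\ 0 <= A, 0 <= L &
  forall tf (z : R -> state * state) rho tau, dynamics c tf z rho tau ->
  forall u w, 0 <= u -> u <= w -> w <= tf -> L * (w - u) <= 2^-1 ->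
  forall a b, u <= a -> a <= b -> b <= w ->
    `|z b - z a| <= (A + L * (2 * (`|z u| + A * (w - u)))) * (b - a)].
Proof.
have [A [L [A0 L0 hAL]]] := field_growth c; exists A, L; split=> //.
move=> tf z rho tau hz u w u0 uw wtf Lw.
have lip M : (forall t, u <= t <= w -> `|z t| <= M) ->
    forall a b, u <= a -> a <= b -> b <= w -> `|z b - z a| <= (A + L * M) * (b - a).
  move=> hM a b ua ab bw; have M0 : 0 <= M.
    by apply: le_trans (hM u _) => //; rewrite lexx.
  apply: norm_le_coord => [|k].
    by rewrite mulr_ge0 ?subr_ge0// addr_ge0// mulr_ge0.
  rewrite coordB; apply: (primitive_norm_le_cst (E := set0) _ _ ab _ (dyn_ode hz k)) => //.
  - exact: le_trans ua.
  - exact: le_trans bw wtf.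
  move=> s /andP[as_ sb] _; have stf : 0 <= s <= tf by lra.
  apply: (le_trans (hAL _ _ _ (dyn_X hz stf) (dyn_adm hz stf) k)).
  by rewrite lerD2l ler_wpM2l// hM//; lra.
have tf0 : 0 <= tf by lra.
(* [sup_half] needs some finite bound to start from; continuity on a segment provides one. *)
have /choice[B hB] : forall k, exists B, forall t, 0 <= t <= tf -> `|coord k (z t)| <= B.
  move=> k; have cz := primitive_continuous tf0 (dyn_ode hz k).
  have [t _ ht] := EVT_max tf0 (fun x => cvg_norm (cz x)).
  by exists `|coord k (z t)| => s stf; apply: ht; rewrite in_itv.
have hBz t : u <= t <= w -> `|z t| <= \sum_k `|B k|.
  move=> tuw; apply: norm_le_coord => [|k]; first exact: sumr_ge0.
  apply: (le_trans (hB k t _)); first lra.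
  by rewrite (bigD1 k)//= (le_trans (ler_norm _))// lerDl sumr_ge0.
have hhalf M : (forall t, u <= t <= w -> `|z t| <= M) ->
    forall t, u <= t <= w -> `|z t| <= (`|z u| + A * (w - u)) + M / 2.
  move=> hM t /andP[ut tw]; have M0 : 0 <= M.
    by apply: le_trans (hM u _) => //; rewrite lexx.
  have := lip M hM u t (lexx u) ut tw.
  have : `|z t| <= `|z t - z u| + `|z u|.
    by rewrite -{1}[z t](subrK (z u)); exact: ler_normD.
  have : (A + L * M) * (t - u) <= (A + L * M) * (w - u).
    by rewrite ler_wpM2l ?lerD2r// addr_ge0// mulr_ge0.
  have : L * (w - u) * M <= 2^-1 * M by rewrite ler_wpM2r.
  lra.
exact/lip/(sup_half uw hBz hhalf).
Qed.

Lemma dynamics_continuous tf (z : R -> state * state) rho tau s :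
  dynamics c tf z rho tau -> 0 <= s <= tf -> forall e : R, 0 < e ->
  exists2 d : R, 0 < d & forall t, 0 <= t <= tf -> `|t - s| < d -> `|z t - z s| < e.
Proof.
move=> hz stf e e0; have [A [L [A0 L0 hAL]]] := dynamics_bound.
(* The window around [s] has length at most [1 / (2 (L + 1))], as [dynamics_bound] requires, and is
   clipped to [[0, tf]]. *)
pose u := Num.max 0 (s - (4 * (L + 1))^-1); pose w := Num.min tf (s + (4 * (L + 1))^-1).
have v0 : 0 < (4 * (L + 1))^-1 by rewrite invr_gt0; lra.
have us : u <= s by rewrite ge_max; lra.
have sw : s <= w by rewrite le_min; lra.
have u0 : 0 <= u by rewrite le_max lexx.
have wtf : w <= tf by rewrite ge_min lexx.
have Luw : L * (w - u) <= 2^-1.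
  have : w - u <= 2 * (4 * (L + 1))^-1.
    have : w <= s + (4 * (L + 1))^-1 by rewrite ge_min lexx orbT.
    have : s - (4 * (L + 1))^-1 <= u by rewrite le_max lexx orbT.
    lra.
  move/(ler_wpM2l L0)/le_trans; apply.
  have -> : L * (2 * (4 * (L + 1))^-1) = 2^-1 * (L / (L + 1)).
    by field; rewrite gt_eqF//; lra.
  by rewrite ler_piMr// ler_pdivrMr; lra.
have := hAL _ _ _ _ hz u w u0 (le_trans us sw) wtf Luw.
set K := (A + _) => hK.
have K0 : 0 <= K.
  by rewrite addr_ge0// !mulr_ge0// addr_ge0// mulr_ge0// subr_ge0 (le_trans us).
have K1 : 0 < K + 1 by lra.
exists (Num.min (4 * (L + 1))^-1 (e / (K + 1))); first by rewrite lt_min v0 divr_gt0.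
move=> t ttf; rewrite lt_min => /andP[h1 h2].
have tu : u <= t <= w.
  by move: h1; rewrite /u /w ge_max le_min ltr_norml; lra.
apply: (@le_lt_trans _ _ (K * `|t - s|)).
  have [ts|st] := leP t s.
    have -> : `|t - s| = s - t by rewrite ler0_norm ?opprB// subr_le0.
    by rewrite distrC; apply: hK => //; lra.
  have -> : `|t - s| = t - s by rewrite gtr0_norm// subr_gt0.
  by apply: hK; lra.
move: h2; rewrite ltr_pdivlMr// => h2; have := normr_ge0 (t - s); nra.
Qed.

(** A trajectory starting near [zb] has speed at most [K], which depends on [zb] and [e] only, so
    the same duration [d] works for every extremal. *)
Lemma near_stay (zb : state * state) (e : R) : 0 < e ->
  exists2 d : R, 0 < d & forall tf (z : R -> state * state) rho tau u w,
    dynamics c tf z rho tau -> 0 <= u -> u <= w -> w <= tf -> w - u < d ->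
    `|z u - zb| < e / 2 -> forall t, u <= t <= w -> `|z t - zb| < e.
Proof.
move=> e0; have [A [L [A0 L0 hAL]]] := dynamics_bound.
pose K := A + L * (2 * (`|zb| + e + A)).
have K0 : 0 <= K by rewrite addr_ge0// !mulr_ge0// !addr_ge0// ltW.
pose d := Num.min 1 (Num.min (2 * (L + 1))^-1 (e / (2 * (K + 1)))).
have d0 : 0 < d.
  by rewrite !lt_min ltr01 divr_gt0// ?mulr_gt0// ?invr_gt0 ?mulr_gt0//; lra.
exists d => // tf z rho tau u w hz u0 uw wtf + hu t /andP[ut tw].
rewrite !lt_min => /and3P[d1 d2 d3].
have Lw : L * (w - u) <= 2^-1.
  move: d2; rewrite -div1r ltr_pdivlMr; last lra.
  by nra.
have := hAL _ _ _ _ hz u w u0 uw wtf Lw u t (lexx u) ut tw.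
have zu : `|z u| <= `|zb| + e / 2.
  have : `|z u| <= `|z u - zb| + `|zb| by rewrite -{1}[z u](subrK zb); exact: ler_normD.
  by lra.
have hK : A + L * (2 * (`|z u| + A * (w - u))) <= K.
  rewrite lerD2l ler_wpM2l// ler_pM2l//.
  have : A * (w - u) <= A * 1 by rewrite ler_wpM2l// ltW.
  by lra.
have h3 : (A + L * (2 * (`|z u| + A * (w - u)))) * (t - u) <= K * (w - u).
  apply: (@le_trans _ _ (K * (t - u))); first by rewrite ler_wpM2r// subr_ge0.
  by rewrite ler_wpM2l// lerD2r.
have h4 : K * (w - u) <= e / 2.
  move: d3; rewrite ltr_pdivlMr; last lra.
  by nra.
have : `|z t - zb| <= `|z t - z u| + `|z u - zb|.
  by rewrite -(subrKA (z u)); exact: ler_normD.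
by lra.
Qed.

(** Strict differentiability replaces the increment of [H1] by that of the linear form [dH1], with
    an error controlled by [|z b - z a| <= K (b - a)]. Along the trajectory, the derivative of [dH1]
    is uniformly close to [H1_slope c zb]. *)
Lemma H1_increment (zb : state * state) (e : R) :
  pos zb.1 != 0 -> 0 < mass zb.1 -> vel zb.2 != 0 -> 0 < e ->
  exists2 r : R, 0 < r & forall tf (z : R -> state * state) rho tau a b,
    dynamics c tf z rho tau -> 0 <= a -> a <= b -> b <= tf ->
    (forall t, a <= t <= b -> `|z t - zb| < r) ->
    `|H1 c (z b).1 (z b).2 - H1 c (z a).1 (z a).2 - H1_slope c zb * (b - a)|
      <= e * (b - a).
Proof.
move=> r0 m0 pv0 e0; have m0' : mass zb.1 != 0 by rewrite gt_eqF.
have [A [L [A0 L0 hAL]]] := field_growth c.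
pose K := A + L * (`|zb| + 1).
have K0 : 0 <= K by rewrite addr_ge0// mulr_ge0// addr_ge0.
have [_ hs] := SD_H1 c m0' pv0.
have e3 : 0 < e / (2 * (K + 1)) by rewrite divr_gt0//; lra.
have [r1 r10 hr1] := hs _ e3.
have s1 : {for zb, continuous (fun z : state * state =>
    umax c / (enorm (vel zb.2) * mass zb.1) * dot (vel zb.2) (pos z.2))}.
  apply: (SD_continuous (SD_mul (SD_cst _ zb)
    (SD_dot (SDv_cst (vel zb.2) zb) (SDv_pos zb snd_norm_le)))).
have s2 : {for zb, continuous (fun z : state * state => enorm (vel z.2) * (mass z.1)^-1 ^+ 2)}.
  apply: (SD_continuous (SD_mul
    (@SD_enorm _ _ (fun z : state * state => vel z.2) _ zb pv0 (SDv_vel zb snd_norm_le))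
    (SD_sqr (@SD_inv _ _ (fun z : state * state => mass z.1) _ zb m0' (SD_mass zb fst_norm_le))))).
pose b0 := beta c * umax c ^+ 2.
have b00 : 0 <= b0 by rewrite mulr_ge0 ?exprn_ge0// ltW ?beta_gt0 ?umax_gt0.
have e4 : 0 < e / 4 by lra.
have e5 : 0 < e / (4 * (b0 + 1)) by rewrite divr_gt0//; lra.
have e6 := enorm_gt0 (vel zb.2); rewrite pv0 in e6.
have near_pv : {for zb, continuous (fun z : state * state => enorm (vel z.2))}.
  exact: (SD_continuous (@SD_enorm _ _ (fun z : state * state => vel z.2) _ zb pv0 (SDv_vel zb snd_norm_le))).
have : \forall z \near zb, [/\ 
   `|umax c / (enorm (vel zb.2) * mass zb.1) * dot (vel zb.2) (pos zb.2) -
     umax c / (enorm (vel zb.2) * mass zb.1) * dot (vel zb.2) (pos z.2)| < e / 4,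
   `|enorm (vel zb.2) * (mass zb.1)^-1 ^+ 2 - enorm (vel z.2) * (mass z.1)^-1 ^+ 2|
      < e / (4 * (b0 + 1)) & 0 < enorm (vel z.2)].
  near=> z; split; near: z.
  - exact: (cvgr_dist_lt _ _ s1).
  - exact: (cvgr_dist_lt _ _ s2).
  - exact: (cvgr_gt _ near_pv).
move=> /nbhs_ballP[r2 /= r20 hr2].
exists (Num.min (Num.min r1 r2) 1); first by rewrite !lt_min r10 r20 ltr01.
move=> tf z rho tau a b hz a0 ab btf hclose.
have close t : a <= t <= b -> [/\ `|z t - zb| < r1, `|z t - zb| < r2 & `|z t - zb| < 1].
  by move=> /hclose; rewrite !lt_min => /andP[/andP[]].
have aab : a <= a <= b by rewrite lexx.
have bab : a <= b <= b by rewrite lexx andbT.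
have hzz : `|z b - z a| <= K * (b - a).
  apply: norm_le_coord => [|k]; first by rewrite mulr_ge0 ?subr_ge0.
  rewrite coordB; apply: (primitive_norm_le_cst (E := set0) _ a0 ab btf (dyn_ode hz k)) => //.
  move=> s /andP[as_ sb] _; have stf : 0 <= s <= tf by lra.
  apply: (le_trans (hAL _ _ _ (dyn_X hz stf) (dyn_adm hz stf) k)).
  rewrite lerD2l ler_wpM2l//.
  have sab : a <= s <= b by lra.
  have [_ _ h1] := close s sab; have : `|z s| <= `|z s - zb| + `|zb|.
    by rewrite -{1}[z s](subrK zb); exact: ler_normD.
  by lra.
have p1 := primitive_lin 1 (- H1_slope c zb) (dH1_primitive zb hz) (primitive_id tf).
have h2 : `|dH1 c zb (z b) - dH1 c zb (z a) - H1_slope c zb * (b - a)| <= e / 2 * (b - a).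
  have := primitive_norm_le_cst (E := set0) (K := e / 2) _ a0 ab btf p1.
  have -> : 1 * dH1 c zb (z b) + - H1_slope c zb * b - (1 * dH1 c zb (z a) + - H1_slope c zb * a) =
    dH1 c zb (z b) - dH1 c zb (z a) - H1_slope c zb * (b - a) by ring.
  apply => // s /andP[as_ sb] _; have stf : 0 <= s <= tf by lra.
  have sab : a <= s <= b by lra.
  have [_ hs2 _] := close s sab.
  have hb : ball zb r2 (z s) by rewrite -ball_normE/= distrC.
  have [k1 k2 k3] := hr2 _ hb.
  have pvs : vel (z s).2 != 0 by rewrite -enorm_gt0.
  have al := max_alignment (dyn_X hz stf) pvs (dyn_adm hz stf) (dyn_max hz stf).
  rewrite dH1_field al.
  have [/andP[rho0 rho1] _] := dyn_adm hz stf.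
  set X1 := _ * dot _ (pos zb.2) in k1; set X2 := _ * dot _ (pos (z s).2) in k1.
  set Y1 := enorm (vel zb.2) * _ in k2; set Y2 := enorm (vel (z s).2) * _ in k2.
  (* Since [H1_slope c zb] is [- X1], the deviation from the slope is a variation of a costate term
     plus [rho] times a variation of [|vel p| / m^2], each at most [e / 4]. *)
  have -> : 1 * (- (umax c / (enorm (vel zb.2) * mass zb.1)) * dot (vel zb.2) (pos (z s).2) +
      beta c * umax c ^+ 2 * (rho s * enorm (vel zb.2) / mass zb.1 ^+ 2 -
      rho s * enorm (vel (z s).2) / mass (z s).1 ^+ 2)) + - H1_slope c zb * 1 =
    (X1 - X2) + b0 * (rho s * (Y1 - Y2)).
    by rewrite /X1 /X2 /Y1 /Y2 /b0 /H1_slope !exprVn; ring.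
  apply: (le_trans (ler_normD _ _)); rewrite (normrM b0) (ger0_norm b00) normrM (ger0_norm rho0).
  have k4 : rho s * `|Y1 - Y2| <= 1 * (e / (4 * (b0 + 1))) by rewrite ler_pM// ltW.
  have k5 : b0 * (1 * (e / (4 * (b0 + 1)))) <= e / 4.
    by rewrite mul1r; apply: shrink_le => //; exact: ltW.
  have k6 := le_trans (ler_wpM2l b00 k4) k5.
  rewrite (_ : e / 2 = e / 4 + e / 4); last by field.
  by rewrite lerD// ltW.
have [ha1 _ _] := close a aab; have [hb1 _ _] := close b bab.
have h1 := hr1 (z b) (z a) hb1 ha1.
rewrite dH1B in h1.
have h3 : e / (2 * (K + 1)) * `|z b - z a| <= e / 2 * (b - a).
  apply: (le_trans (ler_wpM2l (ltW e3) hzz)).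
  rewrite mulrCA mulrA ler_wpM2r ?subr_ge0//.
  by apply: shrink_le => //; exact: ltW.
have -> : H1 c (z b).1 (z b).2 - H1 c (z a).1 (z a).2 - H1_slope c zb * (b - a) =
  (H1 c (z b).1 (z b).2 - H1 c (z a).1 (z a).2 - (dH1 c zb (z b) - dH1 c zb (z a))) +
  (dH1 c zb (z b) - dH1 c zb (z a) - H1_slope c zb * (b - a)) by ring.
apply: (le_trans (ler_normD _ _)); apply: (le_trans (lerD (le_trans h1 h3) h2)).
by rewrite -mulrDl -splitr.
Unshelve. all: by end_near. Qed.

End Trajectories.

(** * Consequences of regularity at a switching time *)

Section Switching.
Context {R : realType} (c : constants R).
Local Notation state := 'cV[R]_7.

Lemma derivable_increment (f : R -> R^o) (s : R) : derivable f s 1 ->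
  forall e : R, 0 < e -> exists2 d : R, 0 < d &
    forall t, `|t - s| < d -> `|f t - f s - 'D_1 f s * (t - s)| <= e * `|t - s|.
Proof.
move=> df e e0.
have /cvgrPdist_le /(_ e e0) /nbhs_ballP [d /= d0 hd] := df.
exists d => // t td; have [->|ts] := eqVneq t s.
  by rewrite !subrr mulr0 subr0 normr0 mulr0.
have ts0 : t - s != 0 by rewrite subr_eq0.
have := hd (t - s); rewrite -ball_normE/= sub0r normrN => /(_ td ts0).
rewrite /GRing.scale/= mulr1 subrK -/('D_1 f s) distrC => h.
have -> : f t - f s - 'D_1 f s * (t - s) =
    ((t - s)^-1 * (f t - f s) - 'D_1 f s) * (t - s) by field.
by rewrite normrM ler_wpM2r.
Qed.

Variables (tf : R) (z : R -> state * state) (rho : R -> R) (tau : R -> 'cV[R]_3).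
Hypothesis hz : dynamics c tf z rho tau.

Let H t : R := H1 c (z t).1 (z t).2.

(* If vel p vanishes at s, then H1 = umax |vel p| / m + (a function with zero
   derivative at s), so a two-sided derivative of H1 at s can only be 0. *)
Lemma regular_vel s : 0 < s < tf ->
  regular_switching c (fun t => (z t).1) (fun t => (z t).2) s -> vel (z s).2 != 0.
Proof.
move=> /andP[s0 stf] [_ dH D0]; apply/eqP => pv0; move/negP: D0; apply.
set D := 'D_1 _ s; rewrite -normr_le0; apply/ler_addgt0Pr => e e0; rewrite add0r.
have [d1 d10 hd1] := derivable_increment dH (e := e / 2) ltac:(by rewrite divr_gt0).
have stf' : 0 <= s <= tf by rewrite !ltW.
have u0 := umax_gt0 c; have b0 := beta_gt0 c; have m0 := mc_gt0 c.
(* The weighted mass costate has rate at most [C e'] where [vel p] has entries at most [e']; [3]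
   counts the products in a dot product, and [e'] is chosen to make this rate [e / 2]. *)
pose C := beta c * umax c * (umax c / mc c ^+ 2 * 3).
have C0 : 0 < C by rewrite !mulr_gt0 ?invr_gt0 ?exprn_gt0.
pose e' := e / (2 * C).
have e'0 : 0 < e' by rewrite divr_gt0// mulr_gt0.
have [d2 d20 hd2] := dynamics_continuous hz stf' e'0.
have pm a b : 0 <= a -> a <= b -> b <= tf -> (forall t, a <= t <= b -> `|t - s| < d2) ->
    beta c * umax c * `|mass (z b).2 - mass (z a).2| <= e / 2 * (b - a).
  move=> a0 ab btf near_s.
  have := primitive_norm_le_cst (E := set0) (K := umax c / mc c ^+ 2 * (3 * e')) _ a0 ab btf
    (dyn_ode hz (false, im)).
  rewrite /coord/= -!massE => h.
  have : `|mass (z b).2 - mass (z a).2| <= umax c / mc c ^+ 2 * (3 * e') * (b - a).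
    apply: h => // t /andP[at_ tb] _.
    have ttf : 0 <= t <= tf by apply/andP; split; [exact: le_trans (ltW at_)|exact: le_trans (ltW tb) _].
    have tab : a <= t <= b by rewrite !ltW.
    have zt := hd2 t ttf (near_s t tab).
    have := field_pm c (z t) (rho t) (tau t); rewrite /coord/= => ->.
    have [/andP[r0 r1] t1] := dyn_adm hz ttf.
    have Xt := dyn_X hz ttf.
    have mt0 := X_mass_gt0 Xt.
    have Q0 : 0 <= umax c / mass (z t).1 ^+ 2 by rewrite divr_ge0 ?(ltW u0)// exprn_ge0// ltW.
    rewrite normrM (ger0_norm r0) normrM (ger0_norm Q0).
    have hv j : `|vel (z t).2 j 0| <= e'.
      have : `|coord (false, iv j) (z t - z s)| < e' by apply: le_lt_trans zt; exact: coord_le_norm.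
      by rewrite coordB /coord/= -!velE pv0 [X in _ - X]mxE subr0 => /ltW.
    have hd : `|dot (vel (z t).2) (tau t)| <= 3 * e'.
      have hj j : `|vel (z t).2 j 0 * tau t j 0| <= e' * 1.
        by rewrite normrM ler_pM// -t1 entry_le_enorm.
      have h0 := hj 0; have h1 := hj 1; have h2 := hj 2.
      rewrite dot3E; apply: (le_trans (ler_normD _ _)).
      apply: (le_trans (lerD (ler_normD _ _) (lexx _))).
      clear -h0 h1 h2; lra.
    have q : umax c / mass (z t).1 ^+ 2 <= umax c / mc c ^+ 2.
      rewrite ler_pM2l// lef_pV2 ?posrE ?exprn_gt0//.
      by rewrite ler_pXn2r ?nnegrE ?(ltW m0) ?(ltW mt0)// (X_mass Xt).
    rewrite -[leRHS]mul1r; apply: ler_pM => //; first exact: mulr_ge0.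
    exact: ler_pM.
  move/(ler_wpM2l (ltW (mulr_gt0 b0 u0)))/le_trans; apply.
  rewrite le_eqVlt; apply/orP; left; apply/eqP.
  by rewrite /e' /C; field; rewrite !gt_eqF.
(* As [vel p] vanishes at [s], the thrust term of [H1] can only increase away from [s], on both
   sides. *)
have lower t : 0 <= t <= tf -> H t - H s >= - (beta c * umax c * `|mass (z t).2 - mass (z s).2|).
  move=> ttf; rewrite /H !H1E pv0 /(enorm 0) dot0l sqrtr0 mul0r mulr0.
  have : 0 <= umax c * (enorm (vel (z t).2) / mass (z t).1).
    by rewrite mulr_ge0 ?(ltW u0)// divr_ge0 ?enorm_ge0 ?ltW// (X_mass_gt0 (dyn_X hz ttf)).
  have := ler_wpM2l (ltW (mulr_gt0 b0 u0)) (ler_norm (mass (z t).2 - mass (z s).2)).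
  lra.
pose dd := Num.min (Num.min (d1 / 2) (d2 / 2)) (Num.min s (tf - s)).
have dd0 : 0 < dd by rewrite !lt_min !divr_gt0// s0 subr_gt0.
have [dd1 dd2 dd3 dd4] : [/\ dd <= d1 / 2, dd <= d2 / 2, dd <= s & dd <= tf - s].
  by rewrite /dd !ge_min !lexx !orbT.
have stp : 0 <= s + dd <= tf by clear -dd0 dd4 s0; lra.
have stm : 0 <= s - dd <= tf by clear -dd0 dd3 stf; lra.
(* The lower bound on the increment to the right of [s] gives [D >= -e]; the one to the left gives
   [D <= e]. *)
rewrite ler_norml; apply/andP; split.
  have := hd1 (s + dd); rewrite addrAC subrr add0r (ger0_norm (ltW dd0)) -/D.
  have -> : dd < d1 by clear -dd1 d10; lra.
  move=> /(_ isT); rewrite ler_norml => /andP[_ h1].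
  have h2 := lower _ stp.
  have h3 : beta c * umax c * `|mass (z (s + dd)).2 - mass (z s).2| <= e / 2 * dd.
    have {2}-> : dd = s + dd - s by rewrite addrAC subrr add0r.
    apply: pm; [exact: ltW|by rewrite lerDl ltW|by case/andP: stp|].
    by move=> t /andP[t1 t2]; rewrite ger0_norm ?subr_ge0//; clear -t2 dd2 d20; lra.
  rewrite -(ler_pM2r dd0); move: h1 h2 h3; rewrite -/(H _) -/(H _).
  set X := _ * `|_|; clear; lra.
have := hd1 (s - dd); rewrite addrAC subrr add0r normrN (ger0_norm (ltW dd0)) -/D.
have -> : dd < d1 by clear -dd1 d10; lra.
move=> /(_ isT); rewrite ler_norml => /andP[_ h1].
have h2 := lower _ stm.
have h3 : beta c * umax c * `|mass (z (s - dd)).2 - mass (z s).2| <= e / 2 * dd.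
  rewrite distrC; have {2}-> : dd = s - (s - dd) by rewrite subKr.
  apply: pm; [by case/andP: stm|by rewrite gerBl ltW|exact: ltW|].
  by move=> t /andP[t1 t2]; rewrite ler0_norm ?subr_le0//; clear -t1 dd2 d20; lra.
rewrite -(ler_pM2r dd0); move: h1 h2 h3; rewrite -/(H _) -/(H _).
set X := _ * `|_|; clear; lra.
Qed.

(** By [H1_increment], difference quotients of [H1] to the right of [s] tend to [H1_slope]. A zero
    slope would thus force the derivative of [H1] at [s] to vanish. *)
Lemma regular_slope s : 0 < s < tf ->
  regular_switching c (fun t => (z t).1) (fun t => (z t).2) s ->
  H1_slope c (z s) != 0.
Proof.
move=> s0tf reg; have pv0 := regular_vel s0tf reg; case/andP: s0tf => s0 stf.
case: reg => _ dH D0; apply: contra_neq D0 => sl0.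
have stf' : 0 <= s <= tf by rewrite !ltW.
have Xs := dyn_X hz stf'.
apply/eqP; rewrite -normr_le0; apply/ler_addgt0Pr => e e0; rewrite add0r.
have e20 : 0 < e / 2 by rewrite divr_gt0.
have [d1 d10 hd1] := derivable_increment dH e20.
have [r r0 hr] := H1_increment c (X_pos Xs) (X_mass_gt0 Xs) pv0 e20.
have [d2 d20 hd2] := dynamics_continuous hz stf' r0.
pose dd := Num.min (Num.min (d1 / 2) (d2 / 2)) (tf - s).
have dd0 : 0 < dd by rewrite !lt_min !divr_gt0// subr_gt0.
have [dd1 dd2 dd4] : [/\ dd <= d1 / 2, dd <= d2 / 2 & dd <= tf - s].
  by rewrite /dd !ge_min !lexx !orbT.
have stp : s + dd <= tf by clear -dd4; lra.
have := hr _ _ _ _ s (s + dd) hz (ltW s0); rewrite lerDl (ltW dd0) => /(_ isT stp).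
rewrite sl0 mul0r subr0 (addrC s) addrK => h.
have h1 : `|H (dd + s) - H s| <= e / 2 * dd.
  apply: h => t /andP[t1 t2]; apply: hd2.
    by clear -t1 t2 stp s0; lra.
  by rewrite ger0_norm ?subr_ge0//; clear -t2 dd2 d20; lra.
have := hd1 (dd + s); rewrite addrK (ger0_norm (ltW dd0)).
have -> : dd < d1 by clear -dd1 d10; lra.
move=> /(_ isT) h2; rewrite -(ler_pM2r dd0).
set D := 'D_1 _ s in h2 *.
have -> : `|D| * dd = `|D * dd| by rewrite normrM (ger0_norm (ltW dd0)).
have -> : D * dd = (H (dd + s) - H s) - (H (dd + s) - H s - D * dd) by ring.
apply: (le_trans (ler_normB _ _)); apply: (le_trans (lerD h1 h2)).
by rewrite -mulrDl -splitr.
Qed.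

End Switching.

(** * Comparison of two extremals across a switch *)

Section StepControl.
Context {R : realType} (c : constants R).
Local Notation state := 'cV[R]_7.

(* On [u, w] the engine is switched on (if b) or off (if not b) at the time t1.
   The control at the single instant t1, where H1 vanishes, is arbitrary. *)
Definition switches_at (b : bool) (u w t1 : R) (z : R -> state * state)
    (rho : R -> R) (tau : R -> 'cV[R]_3) : Prop :=
  u <= t1 <= w /\ forall t, u <= t <= w -> t != t1 ->
    rho t = (b == (t1 < t))%:R /\
    field c (z t) (rho t) (tau t) = drift c (z t) + rho t *: thrust c (z t).

Definition orientation (b : bool) : R := if b then 1 else -1.

Section OneTrajectory.
Variables (tf : R) (z : R -> state * state) (rho : R -> R) (tau : R -> 'cV[R]_3).
Hypothesis hz : dynamics c tf z rho tau.
Variables (u w : R).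
Hypotheses (u0 : 0 <= u) (uw : u <= w) (wtf : w <= tf).

Local Notation H t := (H1 c (z t).1 (z t).2).

(** The estimate makes [sl * H] strictly increasing, so it changes sign at most once. Taking [t1] as
    the supremum of the times where it is nonpositive also covers the case of no sign change before
    [w]. *)
Lemma switch_structure (sl : R) : sl != 0 ->
  (forall a b, u <= a -> a <= b -> b <= w ->
     `|H b - H a - sl * (b - a)| <= `|sl| / 2 * (b - a)) ->
  (forall t, u <= t <= w -> vel (z t).2 != 0) -> sl * H u <= 0 ->
  exists2 t1, switches_at (0 < sl) u w t1 z rho tau &
    forall t, u <= t <= w -> sl * H t = 0 -> t = t1.
Proof.
move=> sl0 hH hv Hu.
have mono a b : u <= a -> a < b -> b <= w -> sl * H a < sl * H b.
  move=> ua ab bw; have := hH a b ua (ltW ab) bw.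
  move/(ler_wpM2l (normr_ge0 sl)); rewrite -normrM => /ler_normlP[h _].
  have sq : `|sl| * (`|sl| / 2 * (b - a)) = sl ^+ 2 * (b - a) / 2.
    by rewrite -[in RHS](real_normK (num_real sl)); field.
  have : 0 < sl ^+ 2 * (b - a) by rewrite mulr_gt0 ?subr_gt0// exprn_even_gt0.
  rewrite sq in h; lra.
pose S := [set t | u <= t <= w /\ sl * H t <= 0].
have Su : S u by split; rewrite ?lexx.
have hS : has_sup S by split; [exists u|exists w => t [/andP[]]].
have t1u : u <= sup S by apply: ub_le_sup => //; case: hS.
have t1w : sup S <= w by apply: ge_sup; [exists u|move=> t [/andP[]]].
have Hneg t : u <= t -> t < sup S -> sl * H t < 0.
  move=> ut tS; have [t' St' tt'] := sup_adherent (eps := sup S - t) ltac:(by rewrite subr_gt0) hS.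
  rewrite subKr in tt'; have [/andP[_ t'w] Ht'] := St'.
  exact: lt_le_trans (mono t t' ut tt' t'w) Ht'.
have Hpos t : t <= w -> sup S < t -> 0 < sl * H t.
  move=> tw St; rewrite ltNge; apply/negP => Ht.
  have : t <= sup S.
    by apply: ub_le_sup; [case: hS|split=> //; rewrite tw andbT (le_trans t1u)// ltW].
  by rewrite leNgt St.
exists (sup S).
  split=> [|t /andP[ut tw] tS]; first by rewrite t1u.
  have ttf : 0 <= t <= tf by rewrite (le_trans u0) ?(le_trans tw).
  have vt : vel (z t).2 != 0 by apply: hv; rewrite ut.
  have on := max_thrust_on (dyn_X hz ttf) vt (dyn_adm hz ttf) (dyn_max hz ttf).
  have off := max_thrust_off (dyn_X hz ttf) vt (dyn_adm hz ttf) (dyn_max hz ttf).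
  have : (0 < sl) == (sup S < t) -> 0 < H t.
    case: ltP => hsl; case: ltP => St //= _.
      by have := Hpos t tw St; rewrite pmulr_rgt0.
    have slneg : sl < 0 by rewrite lt_neqAle sl0.
    by have := Hneg t ut (_ : t < sup S); rewrite lt_neqAle tS St nmulr_rlt0// => /(_ isT).
  have : (0 < sl) != (sup S < t) -> H t < 0.
    case: ltP => hsl; case: ltP => St //= _.
      by have := Hneg t ut (_ : t < sup S); rewrite lt_neqAle tS St pmulr_rlt0// => /(_ isT).
    have slneg : sl < 0 by rewrite lt_neqAle sl0.
    by have := Hpos t tw St; rewrite nmulr_rgt0.
  case: eqP => /= _ hneg hpos.
    have [-> ->] := on (hpos isT).
    by split; rewrite // scale1r field_on.
  have -> := off (hneg isT).
  by split; rewrite // scale0r addr0 field_off.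
move=> t /andP[ut tw] Ht; apply/eqP; rewrite eq_le !leNgt.
by apply/andP; split; apply/negP; [move/(Hpos t tw)|move/(Hneg t ut)]; rewrite Ht ltxx.
Qed.

(** The bracket is the burning time on [[u, t]]: [max (t - t1, 0)] when the engine is switched on,
    and its complement in [t - u] when it is switched off. This lets [t1] be recovered from
    masses. *)
Lemma step_mass b t1 : switches_at b u w t1 z rho tau ->
  forall t, u <= t <= w -> mass (z t).1 - mass (z u).1 =
    - (beta c * umax c) * (orientation b * Num.max (t - t1) 0 + (~~ b)%:R * (t - u)).
Proof.
move=> [/andP[ut1 t1w] hr] t /andP[ut tw].
have piece (r a b' : R) : u <= a -> a <= b' -> b' <= w ->
    (forall s, a < s < b' -> rho s = r) ->
    mass (z b').1 - mass (z a).1 = - (beta c * umax c) * r * (b' - a).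
  move=> ua ab bw hrho.
  (* With constant throttle [r], the mass plus [beta umax r] times the time has zero derivative; the
     mean value inequality with [K = 0] makes it constant. *)
  have p := primitive_lin 1 (beta c * umax c * r) (dyn_ode hz (true, im)) (primitive_id tf).
  have := primitive_norm_le_cst (E := set0) (K := 0) _ (le_trans u0 ua) ab (le_trans bw wtf) p.
  rewrite mul0r /coord/= -!massE => h.
  have : `|1 * mass (z b').1 + beta c * umax c * r * b' -
          (1 * mass (z a).1 + beta c * umax c * r * a)| <= 0.
    apply: h => // s /andP[as_ sb] _.
    have := field_im c (z s) (rho s) (tau s); rewrite /coord/= => ->.
    rewrite hrho ?as_//.
    have -> : 1 * - (r * (beta c * umax c)) + beta c * umax c * r * 1 = 0 by ring.
    by rewrite normr0.
  rewrite normr_le0 => /eqP h0.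
  apply/eqP; rewrite -subr_eq0; apply/eqP; rewrite -[RHS]h0; ring.
have before s : u < s < t1 -> rho s = (~~ b)%:R.
  move=> /andP[us st1]; have usw : u <= s <= w.
    by rewrite (ltW us) (le_trans (ltW st1)).
  have [-> _] := hr s usw (negbT (lt_eqF st1)).
  by rewrite (ltNge t1) (ltW st1); case: (b).
have after s : t1 < s < w -> rho s = b%:R.
  move=> /andP[t1s sw]; have usw : u <= s <= w.
    by rewrite (ltW sw) andbT (le_trans ut1)// ltW.
  have [-> _] := hr s usw (negbT (gt_eqF t1s)).
  by rewrite t1s; case: (b).
have [tt1|t1t] := leP t t1.
  rewrite (piece (~~ b)%:R u t (lexx u) ut tw); last first.
    by move=> s /andP[us st]; apply: before; rewrite us (lt_le_trans st).
  by rewrite max_r ?subr_le0//; ring.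
have -> : mass (z t).1 - mass (z u).1 =
  (mass (z t).1 - mass (z t1).1) + (mass (z t1).1 - mass (z u).1) by ring.
rewrite (piece b%:R t1 t ut1 (ltW t1t) tw); last first.
  by move=> s /andP[t1s st]; apply: after; rewrite t1s (lt_le_trans st).
rewrite (piece (~~ b)%:R u t1 (lexx u) ut1 t1w before).
rewrite max_l ?subr_ge0 1?ltW// /orientation; case: (b) => /=; ring.
Qed.

End OneTrajectory.

(** Integrand of [step_compare] at one instant. As [t1 <= t2], either both engines are in the same
    state, or exactly one burns; in the latter case the oriented throttle difference is [1] and [f]
    absorbs the thrust up to [e]. *)
Lemma step_compare_coord (b : bool) (t1 t2 s P e d1 d2 h1 h2 f : R) :
  t1 <= t2 -> 0 <= P -> 0 <= e ->
  `|d1 - d2| <= P -> `|h1 - h2| <= P -> `|h1 - f| <= e -> `|h2 - f| <= e ->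
  `|1 * (1 * (d1 + (b == (t1 < s))%:R * h1) + -1 * (d2 + (b == (t2 < s))%:R * h2))
     + - f * (1 * (b == (t1 < s))%:R + -1 * (b == (t2 < s))%:R)| <=
  2 * P * 1 + e * orientation b * (1 * (b == (t1 < s))%:R + -1 * (b == (t2 < s))%:R).
Proof.
move=> t12 P0 e0; rewrite !ler_norml => /andP[p1 p2] /andP[p3 p4] /andP[p5 p6] /andP[p7 p8].
have : (t2 < s) ==> (t1 < s) by apply/implyP; exact: le_lt_trans.
by rewrite /orientation; case: (b); case: (t1 < s); case: (t2 < s) => //= _;
  apply/andP; split; lra.
Qed.

(** Where both engines are in the same state the fields differ by at most [2 P]. Between the two
    switches only one engine burns, and freezing its thrust at [F] costs [e] per unit of time; the
    difference of the [max] terms is the time elapsed there up to [t]. *)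
Lemma step_compare (tf : R) (z1 z2 : R -> state * state) rho1 rho2 tau1 tau2
    (u w P e t1 t2 : R) (b : bool) (F : state * state) :
  dynamics c tf z1 rho1 tau1 -> dynamics c tf z2 rho2 tau2 ->
  0 <= u -> u <= w -> w <= tf -> t1 <= t2 ->
  switches_at b u w t1 z1 rho1 tau1 -> switches_at b u w t2 z2 rho2 tau2 ->
  (forall t, u <= t <= w -> [/\ `|drift c (z1 t) - drift c (z2 t)| <= P,
     `|thrust c (z1 t) - thrust c (z2 t)| <= P,
     `|thrust c (z1 t) - F| <= e & `|thrust c (z2 t) - F| <= e]) ->
  forall t, u <= t <= w ->
  `|z1 t - z2 t - (z1 u - z2 u) -
    (orientation b * (Num.max (t - t1) 0 - Num.max (t - t2) 0)) *: F| <=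
  2 * P * (t - u) + e * (Num.max (t - t1) 0 - Num.max (t - t2) 0).
Proof.
move=> hz1 hz2 u0 uw wtf t12 s1 s2 hF t utw; have /andP[ut tw] := utw.
have m1 := step_mass hz1 u0 wtf s1 utw; have m2 := step_mass hz2 u0 wtf s2 utw.
have bu0 : 0 < beta c * umax c by rewrite mulr_gt0 ?beta_gt0 ?umax_gt0.
(* A burning-time clock: [B z] has derivative [rho], so the integral of [rho1 - rho2] becomes an
   explicit function of masses. *)
pose B (z : R -> state * state) t := - (beta c * umax c)^-1 * mass (z t).1.
set S := Num.max (t - t1) 0 - Num.max (t - t2) 0.
have BS : orientation b * S = (B z1 t - B z1 u) - (B z2 t - B z2 u).
  rewrite /B -!mulrBr m1 m2 /S; field.
  by rewrite !gt_eqF ?beta_gt0 ?umax_gt0.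
have S_BS : S = orientation b * ((B z1 t - B z1 u) - (B z2 t - B z2 u)).
  by rewrite -BS mulrA /orientation; case: (b) => /=; ring.
have P0 : 0 <= P by have [+ _ _ _] := hF t utw; exact: le_trans.
have e0 : 0 <= e by have [_ _ + _] := hF t utw; exact: le_trans.
have S0 : 0 <= S.
  by rewrite subr_ge0 ge_max le_max lerD2l lerN2 t12/= le_max lexx orbT.
have pB z rho tau : dynamics c tf z rho tau -> primitive tf (B z) rho.
  move=> hz; have := primitive_lin (- (beta c * umax c)^-1) 0 (dyn_ode hz (true, im)) (dyn_ode hz (true, im)).
  move=> p; congr (primitive _ _ _): p; apply/funext => s.
    by rewrite /B massE /coord/=; ring.
  rewrite field_im; field.
  by rewrite !gt_eqF ?beta_gt0 ?umax_gt0.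
have pB12 := primitive_lin 1 (-1) (pB _ _ _ hz1) (pB _ _ _ hz2).
apply: norm_le_coord => [|k].
  by rewrite addr_ge0// mulr_ge0// ?subr_ge0// mulr_ge0.
have p1 := primitive_lin 1 (- coord k F)
  (primitive_lin 1 (-1) (dyn_ode hz1 k) (dyn_ode hz2 k)) pB12.
have p2 := primitive_lin (2 * P) (e * orientation b) (primitive_id tf) pB12.
have fE : finite_set [set t1; t2] by [].
have := primitive_norm_le fE u0 ut (le_trans tw wtf) p1 p2.
have ptw s : u < s < t -> ~ [set t1; t2] s ->
    `|1 * (1 * coord k (field c (z1 s) (rho1 s) (tau1 s)) +
           -1 * coord k (field c (z2 s) (rho2 s) (tau2 s))) +
      - coord k F * (1 * rho1 s + -1 * rho2 s)| <=
    2 * P * 1 + e * orientation b * (1 * rho1 s + -1 * rho2 s).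
  move=> /andP[us st] /not_orP[/eqP st1 /eqP st2].
  have usw : u <= s <= w by rewrite (ltW us) (le_trans (ltW st)).
  have [r1 f1E] := s1.2 s usw st1.
  have [r2 f2E] := s2.2 s usw st2.
  rewrite f1E f2E !coordD !coordZ r1 r2.
  have [hP1 hP2 hF1 hF2] := hF s usw.
  have kP1 := le_trans (coord_le_norm k _) hP1.
  have kP2 := le_trans (coord_le_norm k _) hP2.
  have kF1 := le_trans (coord_le_norm k _) hF1.
  have kF2 := le_trans (coord_le_norm k _) hF2.
  move: kP1 kP2 kF1 kF2; rewrite !coordB.
  exact: step_compare_coord.
move=> /(_ ptw) h; rewrite !coordB coordZ BS [in leRHS]S_BS.
by move: h; congr (`|_| <= _); ring.
Qed.

End StepControl.

(** * The family of extremals *)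

Section C1Coordinates.
Context {R : realType}.
Local Notation state := 'cV[R]_7.

Lemma coord_linear k : linear (coord k : state * state -> R^o).
Proof. by move=> a u v; rewrite coordD coordZ. Qed.

Lemma C1_coord n (f : 'rV[R]_n -> state * state) q k : C1_at f q ->
  SD (fun y => coord k (f y)) (fun v => \sum_j v 0 j *
    'D_(delta_mx 0 j) ((fun y => coord k (f y)) : _ -> R^o) q) q.
Proof.
move=> C1f.
pose M := GRing.isLinear.Build _ _ _ _ _ (coord_linear k).
(* [coord k] is packed as a linear functional so that [C1_strict] applies to it. *)
pose pr : {linear (state * state)%type -> R^o} := HB.pack (coord k : state * state -> R^o) M.
have cpr : continuous pr.
  move=> z; apply/cvgrPdist_lt => e e0; near=> w.
  rewrite -linearB; apply: le_lt_trans (coord_le_norm k _) _.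
  by near: w; apply: (@cvgr_dist_lt _ _ _ _ _ id).
have hs := C1_strict cpr C1f.
pose d (v : 'rV[R]_n) : R := \sum_j v 0 j * pr ('D_(delta_mx 0 j) f q).
have sf : SD (fun y => coord k (f y)) d q.
  split; last exact: hs.
  exists (\sum_j `|pr ('D_(delta_mx 0 j) f q)|) => v.
  apply: (le_trans (ler_norm_sum _ _ _)); rewrite mulr_suml; apply: ler_sum => j _.
  by rewrite normrM mulrC ler_wpM2l// mx_entry_le_norm.
apply: (SD_eq sf) => // v; apply: eq_bigr => j _; congr (_ * _).
rewrite (SD_derive sf); last first.
  by move=> t; rewrite /d mulr_sumr; apply: eq_bigr => i _; rewrite mxE mulrA.
rewrite /d (bigD1 j)//= mxE !eqxx mul1r big1 ?addr0// => i ij.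
by rewrite mxE (negbTE ij) andbF mul0r.
Unshelve. all: by end_near. Qed.

Lemma C1_state_strict (gamma : R -> 'rV[R]_7 -> state * state) t q :
  C1_at (gamma t) q -> forall e : R, 0 < e -> exists2 r : R, 0 < r & forall q1 q2,
    `|q1 - q| < r -> `|q2 - q| < r ->
    `|(gamma t q1).1 - (gamma t q2).1 - dxdq gamma t q *m (q1 - q2)^T| <=
      e * `|q1 - q2|.
Proof.
move=> C1g e e0.
have /choice[r hr] : forall i : 'I_7, exists r : R, 0 < r /\ forall q1 q2,
    `|q1 - q| < r -> `|q2 - q| < r ->
    `|((gamma t q1).1 - (gamma t q2).1 - dxdq gamma t q *m (q1 - q2)^T) i 0| <=
      e * `|q1 - q2|.
  move=> i; have [_ hs] := C1_coord (true, i) C1g.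
  have [r r0 h] := hs e e0; exists r; split=> // q1 q2 h1 h2.
  have := h q1 q2 h1 h2; congr (`|_| <= _).
  have sub3 (A B C : state) : (A - B - C) i 0 = A i 0 - B i 0 - C i 0.
    by rewrite !mxE.
  rewrite sub3; congr (_ - _ - _); rewrite mxE; apply: eq_bigr => j _.
  by rewrite [dxdq _ _ _ _ _]mxE [_^T _ _]mxE mulrC.
exists (\big[Num.min/1]_i r i).
  by apply/bigmin_gtP; split=> // i _; have [] := hr i.
move=> q1 q2 /bigmin_gtP[_ h1] /bigmin_gtP[_ h2].
apply: mx_norm_le => [|i j]; first by rewrite mulr_ge0// ltW.
by rewrite (ord1 j); have [_ h] := hr i; apply: h; [exact: h1|exact: h2].
Qed.

Lemma C1_lip n (f : 'rV[R]_n -> state * state) q : C1_at f q ->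
  exists L r : R, [/\ 0 <= L, 0 < r & forall q1 q2,
    `|q1 - q| < r -> `|q2 - q| < r -> `|f q1 - f q2| <= L * `|q1 - q2|].
Proof.
move=> C1f; apply: SD_coord_lip => k; eexists; exact: (C1_coord k C1f).
Qed.

End C1Coordinates.

Section MatrixEstimates.
Context {R : realType}.

(** Testing on small multiples of a basis vector, homogeneity bounds every entry by an arbitrary
    [e]. *)
Lemma mx_eq0_littleo m n (A : 'M[R]_(m, n)) :
  (forall e : R, 0 < e -> exists2 r : R, 0 < r & forall v : 'rV[R]_n,
    `|v| < r -> `|A *m v^T| <= e * `|v|) -> A = 0.
Proof.
move=> hA; apply/matrixP => i j; rewrite mxE; apply/eqP; rewrite -normr_le0.
apply/ler_addgt0Pr => e e0; rewrite add0r.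
have [r r0 hr] := hA e e0.
pose d : 'rV[R]_n := delta_mx 0 j.
have d1 : `|d| <= 1.
  by apply: mx_norm_le => // k l; rewrite mxE; case: (_ && _); rewrite ?normr1 ?normr0.
have r20 : 0 < r / 2 by rewrite divr_gt0.
have vr : `|(r / 2) *: d| <= r / 2 by rewrite normrZ gtr0_norm// ler_piMr// ltW.
have := hr ((r / 2) *: d) (le_lt_trans vr _).
rewrite ltr_pdivrMr// ltr_pMr// ltr1n => /(_ isT) h.
have E : (A *m ((r / 2) *: d)^T) i 0 = r / 2 * A i j.
  rewrite linearZ/= -scalemxAr mxE; congr (_ * _).
  rewrite mxE (bigD1 j)//= !mxE !eqxx mulr1 big1 ?addr0// => k kj.
  by rewrite !mxE (negbTE kj) mulr0.
have := le_trans (mx_entry_le_norm _ i 0) h.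
rewrite E normrM (gtr0_norm r20) => h2.
rewrite -(ler_pM2l r20); apply: (le_trans h2).
by rewrite [leRHS]mulrC ler_wpM2l// ltW.
Qed.

(** Errors are counted in units of [e1 * |q1 - q2|] in [switching_expansion]: [1 + CT] for comparing
    two extremals and [8] for each Jacobian replaced by its one-sided limit, hence
    [17 = 1 + 8 + 8]. *)
Lemma budget_le1 (x : R) : 1 + x + 8 <= 17 + x.
Proof. by lra. Qed.

Lemma budget_le2 (x : R) : 1 + x + 8 + 8 <= 17 + x.
Proof. by lra. Qed.

Lemma at_left_dist (T : R -> Prop) (s : R) : (\forall t \near s^'-, T t) ->
  exists2 d : R, 0 < d & forall t, s - d < t -> t < s -> T t.
Proof.
move=> /nbhs_ballP [d /= d0 hd]; exists d => // t dt ts; apply: hd => //.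
by rewrite -ball_normE/= gtr0_norm ?subr_gt0//; lra.
Qed.

Lemma at_right_dist (T : R -> Prop) (s : R) : (\forall t \near s^'+, T t) ->
  exists2 d : R, 0 < d & forall t, s < t -> t < s + d -> T t.
Proof.
move=> /nbhs_ballP [d /= d0 hd]; exists d => // t st td; apply: hd => //.
by rewrite -ball_normE/= ltr0_norm ?subr_lt0//; lra.
Qed.

End MatrixEstimates.

Section LocalConstants.
Context {R : realType} (c : constants R).
Local Notation state := 'cV[R]_7.

(** One radius and one Lipschitz constant for all local estimates. The tolerance of half the slope
    keeps [H1] strictly monotone along nearby trajectories. *)
Lemma local_constants (zb : state * state) :
  X c zb.1 -> vel zb.2 != 0 -> H1_slope c zb != 0 ->
  exists L e : R, [/\ 0 <= L, 0 < e,
    forall z1 z2, `|z1 - zb| < e -> `|z2 - zb| < e ->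
      [/\ `|drift c z1 - drift c z2| <= L * `|z1 - z2|,
          `|thrust c z1 - thrust c z2| <= L * `|z1 - z2| &
          `|H1 c z1.1 z1.2 - H1 c z2.1 z2.2| <= L * `|z1 - z2|],
    forall z, `|z - zb| < e -> vel z.2 != 0 &
    forall tf (z : R -> state * state) rho tau a b,
      dynamics c tf z rho tau -> 0 <= a -> a <= b -> b <= tf ->
      (forall t, a <= t <= b -> `|z t - zb| < e) ->
      `|H1 c (z b).1 (z b).2 - H1 c (z a).1 (z a).2 - H1_slope c zb * (b - a)|
        <= `|H1_slope c zb| / 2 * (b - a)].
Proof.
move=> Xzb pv0 sl0.
have r0 := X_pos Xzb; have mp := X_mass_gt0 Xzb.
have m0 : mass zb.1 != 0 by rewrite gt_eqF.
have [L1 [r1 [L10 r10 h1]]] := SD_coord_lip (SD_drift c r0).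
have [L2 [r2 [L20 r20 h2]]] := SD_coord_lip (SD_thrust c m0 pv0).
have [L3 [r3 [L30 r30 h3]]] := SD_lip (SD_H1 c m0 pv0).
have e0 : 0 < `|H1_slope c zb| / 2 by rewrite divr_gt0// normr_gt0.
have [r4 r40 h4] := H1_increment c r0 mp pv0 e0.
have ep0 : 0 < enorm (vel zb.2) by rewrite enorm_gt0.
have cpv := SD_continuous (@SD_enorm _ _ (fun z : state * state => vel z.2) _ zb pv0
  (SDv_vel zb snd_norm_le)).
have /nbhs_ballP [r5 /= r50 h5] : \forall z \near zb, 0 < enorm (vel z.2).
  exact: (cvgr_gt _ cpv).
exists (L1 + L2 + L3), (Num.min (Num.min r1 (Num.min r2 r3)) (Num.min r4 r5)).
split.
- by rewrite !addr_ge0.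
- by rewrite !lt_min r10 r20 r30 r40 r50.
- move=> z1 z2; rewrite !lt_min => /andP[/and3P[a1 a2 a3] _] /andP[/and3P[b1 b2 b3] _].
  split; [apply: le_trans (h1 _ _ a1 b1) _|apply: le_trans (h2 _ _ a2 b2) _|
    apply: le_trans (h3 _ _ a3 b3) _]; rewrite ler_wpM2r//.
  + by rewrite -addrA lerDl addr_ge0.
  + by rewrite addrAC lerDr addr_ge0.
  + by rewrite lerDr addr_ge0.
- move=> z; rewrite !lt_min => /andP[_ /andP[_ a5]].
  by rewrite -enorm_gt0; apply: h5; rewrite -ball_normE/= distrC.
move=> tf z rho tau a b hz a0 ab btf hcl; apply: h4 hz a0 ab btf _ => t tab.
by have := hcl t tab; rewrite !lt_min => /andP[_ /andP[]].
Qed.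

End LocalConstants.

Lemma quarter_step {R : realType} (L h : R) : L * h <= 8^-1 -> 2 * L * (2 * h) <= 2^-1.
Proof. by lra. Qed.

Lemma slope_step {R : realType} (sl Hu h : R) :
  - (sl * (- Hu - sl * h)) <= sl ^+ 2 / 2 * h -> sl * Hu <= - (sl ^+ 2 / 2 * h).
Proof. by lra. Qed.

Lemma lip_step {R : realType} (N X S f e C K V P M Nu : R) :
  N <= X + S * f + Nu -> X <= P + e * S -> Nu <= C * V -> P <= M / 2 ->
  S * (f + e) <= K * V * (f + e) ->
  N <= (C + (f + e) * K) * V + M / 2.
Proof. by lra. Qed.

Section Family.
Context {R : realType} (c : constants R).
Local Notation state := 'cV[R]_7.
Variables (tf : R) (gamma : R -> 'rV[R]_7 -> state * state).
Variables (rho : 'rV[R]_7 -> R -> R) (tau : 'rV[R]_7 -> R -> 'cV[R]_3).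
Variables (O : set 'rV[R]_7) (qb : 'rV[R]_7) (s : R).
Hypothesis hO : nbhs qb O.
Hypothesis hdyn : forall q, O q -> dynamics c tf (gamma ^~ q) (rho q) (tau q).
Hypothesis s0tf : 0 < s < tf.
Local Notation zb := (gamma s qb).

Let Oqb : O qb. Proof. exact: nbhs_singleton. Qed.
Let s_in : 0 <= s <= tf. Proof. by case/andP: s0tf => ? ?; rewrite !ltW. Qed.

(** Regularity in [q] is available at [u], not at a switching time; closeness at [u] is carried
    across [s] by [near_stay], whose duration is independent of [q]. *)
Lemma family_close (e : R) : 0 < e -> exists2 d : R, 0 < d & forall u w,
  s - d < u -> u <= s -> s <= w -> w < s + d -> C1_at (gamma u) qb ->
  exists2 r : R, 0 < r & forall q, `|q - qb| < r ->
    O q /\ forall t, u <= t <= w -> `|gamma t q - zb| < e.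
Proof.
move=> e0; have [d1 d10 hd1] := near_stay c zb e0.
have e4 : 0 < e / 4 by rewrite divr_gt0.
have [d2 d20 hd2] := dynamics_continuous (hdyn Oqb) s_in e4.
case/andP: (s0tf) => s0 stf.
pose d := Num.min (Num.min (d1 / 2) d2) (Num.min s (tf - s)).
have d0 : 0 < d by rewrite !lt_min divr_gt0// d20 s0 subr_gt0.
have [k1 k2 k3 k4] : [/\ d <= d1 / 2, d <= d2, d <= s & d <= tf - s].
  by rewrite /d !ge_min !lexx !orbT.
exists d => // u w du us sw wd C1u.
have [L [r1 [L0 r10 hL]]] := C1_lip C1u.
have [/= r2 r20 hr2] := (nbhs_ballP _ _).1 hO.
have L1 : 0 < L + 1 by rewrite ltr_wpDl.
exists (Num.min (Num.min r1 r2) (e / (4 * (L + 1)))).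
  by rewrite !lt_min r10 r20 divr_gt0// mulr_gt0.
move=> q; rewrite !lt_min => /andP[/andP[q1 q2] q3].
have Oq : O q by apply: hr2; rewrite -ball_normE/= distrC.
split=> //; apply: (hd1 _ _ _ _ u w (hdyn Oq)).
- by lra.
- exact: le_trans sw.
- by lra.
- by lra.
have h1 : `|gamma u qb - zb| < e / 4.
  apply: hd2; first by apply/andP; split; lra.
  by rewrite ler0_norm ?subr_le0//; lra.
have h2 : `|gamma u q - gamma u qb| <= e / 4.
  apply: (le_trans (hL q qb q1 _)); first by rewrite subrr normr0.
  apply: (le_trans (ler_wpM2l L0 (ltW q3))).
  by apply: shrink_le => //; exact: ltW.
rewrite -(subrKA (gamma u qb)); apply: (le_lt_trans (ler_normD _ _)).
by lra.
Qed.

Hypothesis hreg : regular_switching c (fun t => (gamma t qb).1)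
  (fun t => (gamma t qb).2) s.
Hypothesis hC1 : exists2 d : R, 0 < d & forall t, 0 < `|t - s| < d -> C1_at (gamma t) qb.
Local Notation b := (0 < H1_slope c zb).

(* Near qb, the extremal with parameter q has s + T q as its only switching time
   in [u, w], and a is the differential of T at qb. *)
Definition switching_data (u w L C r : R) (T : 'rV[R]_7 -> R) (a : 'rV[R]_7) : Prop :=
  [/\ [/\ 0 <= u, u < s, s < w & w <= tf], [/\ 0 <= L, 0 <= C & 0 < r],
    T qb = 0 /\ SD T (fun v => (a *m v^T) 0 0) qb,
    forall q, `|q - qb| < r -> O q /\
      switches_at c b u w (s + T q) (gamma ^~ q) (rho q) (tau q) &
    forall q1 q2, `|q1 - qb| < r -> `|q2 - qb| < r -> forall t, u <= t <= w ->
      [/\ `|gamma t q1 - gamma t q2| <= C * `|q1 - q2|,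
          `|drift c (gamma t q1) - drift c (gamma t q2)| <= L * `|gamma t q1 - gamma t q2| &
          `|thrust c (gamma t q1) - thrust c (gamma t q2)| <= L * `|gamma t q1 - gamma t q2|]].

(** Nearby extremals inherit from the nominal one the sign of [H1] at [u], which gives a single
    switch by [switch_structure]. Lipschitz dependence on [q] holds because both the initial gap at
    [u] and the gap between switching times are of order [|q1 - q2|]. *)
Lemma switching_data_exists : exists u w L C r T a, switching_data u w L C r T a.
Proof.
have hzb := hdyn Oqb.
have /andP[s0 stf] := s0tf.
have Xzb := dyn_X hzb s_in.
have pv0 := regular_vel hzb s0tf hreg.
have sl0 := regular_slope hzb s0tf hreg.
have [L [e [L0 e0 hL hpv hinc]]] := local_constants Xzb pv0 sl0.
have [d1 d10 hclose] := family_close e0.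
have [d2 d20 hC] := hC1.
have L1 : 0 < 8 * (L + 1) by rewrite mulr_gt0// ltr_wpDl.
(* The half-width [h] keeps [[u, w]] inside [[0, tf]] and in the range of [family_close] and [hC1];
   the last bound gives [2 L (w - u) <= 1/2]. *)
pose h := Num.min (Num.min (d1 / 2) (d2 / 2)) (Num.min (Num.min s (tf - s)) (8 * (L + 1))^-1).
have h0 : 0 < h by rewrite !lt_min !divr_gt0// s0 subr_gt0 stf invr_gt0 L1.
have [k1 k2 k3 k4 k5] : [/\ h <= d1 / 2, h <= d2 / 2, h <= s, h <= tf - s & h <= (8 * (L + 1))^-1].
  by rewrite /h !ge_min !lexx !orbT.
pose u := s - h; pose w := s + h.
have us : u < s by rewrite gtrBl.
have sw : s < w by rewrite ltrDl.
have uw : u < w by exact: lt_trans sw.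
have u0 : 0 <= u by rewrite subr_ge0.
have wtf : w <= tf by rewrite /w addrC -lerBrDr.
have uu : u <= u <= w by rewrite lexx ltW.
have ww : u <= w <= w by rewrite lexx ltW.
have suw : u <= s <= w by rewrite !ltW.
have hd1 : h < d1 by apply: le_lt_trans k1 _; rewrite ltr_pdivrMr// ltr_pMr// ltr1n.
have hd2 : h < d2 by apply: le_lt_trans k2 _; rewrite ltr_pdivrMr// ltr_pMr// ltr1n.
have C1u : C1_at (gamma u) qb.
  by apply: hC; rewrite /u addrAC subrr add0r normrN (gtr0_norm h0) h0.
have C1w : C1_at (gamma w) qb.
  by apply: hC; rewrite /w addrAC subrr add0r (gtr0_norm h0) h0.
have du : s - d1 < u by rewrite /u ltrD2l ltrN2.
have wd : w < s + d1 by rewrite /w ltrD2l.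
have [r1 r10 hr1] := hclose u w du (ltW us) (ltW sw) wd C1u.
have qb1 : `|qb - qb| < r1 by rewrite subrr normr0.
pose H t q := H1 c (gamma t q).1 (gamma t q).2.
pose sl := H1_slope c zb.
have hH q : `|q - qb| < r1 -> forall a b', u <= a -> a <= b' -> b' <= w ->
    `|H b' q - H a q - sl * (b' - a)| <= `|sl| / 2 * (b' - a).
  move=> /hr1 [Oq hq] a b' ua ab bw.
  apply: (hinc _ _ _ _ _ _ (hdyn Oq) (le_trans u0 ua) ab (le_trans bw wtf)) => t /andP[at_ tb].
  by apply: hq; rewrite (le_trans ua at_) (le_trans tb bw).
have Hs : H s qb = 0 by case: hreg.
(* As the nominal [H1] vanishes at [s], its rate leaves a definite margin at [u]. The radius [r3]
   below keeps perturbations within this margin. *)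
have Hu : sl * H u qb <= - (sl ^+ 2 / 2 * h).
  have := hH qb qb1 u s (lexx u) (ltW us) (ltW sw).
  rewrite Hs sub0r (_ : s - u = h); last by rewrite /u subKr.
  move/(ler_wpM2l (normr_ge0 sl)); rewrite -normrM => /ler_normlP[hh _].
  have sq : `|sl| * (`|sl| / 2 * h) = sl ^+ 2 / 2 * h.
    by rewrite -[in RHS](real_normK (num_real sl)); field.
  by rewrite sq in hh; exact: slope_step hh.
have [Cu [r2 [Cu0 r20 hCu]]] := C1_lip C1u.
have sl2 : 0 < sl ^+ 2 / 2 * h by rewrite mulr_gt0// divr_gt0// exprn_even_gt0.
pose r3 := sl ^+ 2 / 2 * h / (`|sl| * L * Cu + 1).
have K0 : 0 <= `|sl| * L * Cu by rewrite !mulr_ge0.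
have K1 : 0 < `|sl| * L * Cu + 1 by rewrite ltr_wpDl.
have r30 : 0 < r3 by rewrite divr_gt0.
have Hneg q : `|q - qb| < r1 -> `|q - qb| < r2 -> `|q - qb| < r3 -> sl * H u q <= 0.
  move=> q1 q2 q3.
  have [_ _ hHl] := hL _ _ ((hr1 q q1).2 u uu) ((hr1 qb qb1).2 u uu).
  have q2' : `|qb - qb| < r2 by rewrite subrr normr0.
  have hg := hCu q qb q2 q2'.
  have hd : sl * (H u q - H u qb) <= `|sl| * L * Cu * `|q - qb|.
    apply: (le_trans (ler_norm _)); rewrite normrM -!mulrA ler_wpM2l//.
    by apply: (le_trans hHl); rewrite ler_wpM2l.
  apply: (@le_trans _ _ (- (sl ^+ 2 / 2 * h) + `|sl| * L * Cu * `|q - qb|)).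
    by rewrite -(subrK (sl * H u qb) (sl * H u q)) addrC lerD// -mulrBr.
  rewrite addrC subr_le0.
  apply: (@le_trans _ _ ((`|sl| * L * Cu + 1) * r3)).
    by apply: ler_pM => //; [rewrite lerDl|exact: ltW].
  by rewrite /r3 mulrC divfK// gt_eqF.
have hsw q : `|q - qb| < r1 -> `|q - qb| < r2 -> `|q - qb| < r3 ->
    exists2 t1, switches_at c b u w t1 (gamma ^~ q) (rho q) (tau q) &
    forall t, u <= t <= w -> sl * H t q = 0 -> t = t1.
  move=> q1 q2 q3; have [Oq hq] := hr1 q q1.
  have hv t : u <= t <= w -> vel (gamma t q).2 != 0 by move=> tuw; exact/hpv/hq.
  exact: (switch_structure (hdyn Oq) u0 (ltW uw) wtf sl0 (hH q q1) hv (Hneg q q1 q2 q3)).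
pose nb : R := (~~ b)%:R; pose og : R := orientation b.
have og2 : og * og = 1 by rewrite /og /orientation; case: (b); ring.
(* [step_mass] at [w], solved for [t1 - s]; [og] is its own inverse. Only values at [u] and [w],
   where [gamma] is C1, enter. *)
pose T q := w - s + og * (((mass (gamma w q).1 - mass (gamma u q).1) / (beta c * umax c))
  + nb * (w - u)).
have hT q t1 : O q -> switches_at c b u w t1 (gamma ^~ q) (rho q) (tau q) -> T q = t1 - s.
  move=> Oq hs; have := step_mass (hdyn Oq) u0 wtf hs ww.
  rewrite max_l ?subr_ge0; last by case: hs => /andP[].
  rewrite -/og -/nb /T => ->.
  have -> : - (beta c * umax c) * (og * (w - t1) + nb * (w - u)) / (beta c * umax c) =
    - (og * (w - t1) + nb * (w - u)).
    by field; rewrite !gt_eqF ?beta_gt0 ?umax_gt0.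
  rewrite (_ : og * _ = - (og * og * (w - t1))); last by ring.
  by rewrite og2; ring.
have z1 : `|qb - qb| < r2 by rewrite subrr normr0.
have z2 : `|qb - qb| < r3 by rewrite subrr normr0.
have Tqb : T qb = 0.
  (* The nominal [H1] is zero at [s], so uniqueness of the zero identifies the nominal switching
     time with [s]. *)
  have [t1 ht1 huni] := hsw qb qb1 z1 z2.
  by rewrite (hT _ _ Oqb ht1) -(huni s suw) ?subrr// Hs mulr0.
pose Dm t j : R := 'D_(delta_mx 0 j) ((fun y => coord (true, im) (gamma t y)) : _ -> R^o) qb.
pose a : 'rV[R]_7 := \row_j (og / (beta c * umax c) * (Dm w j - Dm u j)).
have SDT : SD T (fun v => (a *m v^T) 0 0) qb.
  have s1 := SD_lin (og / (beta c * umax c)) (- (og / (beta c * umax c)))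
    (C1_coord (true, im) C1w) (C1_coord (true, im) C1u).
  apply: (SD_eq (SD_lin 1 (w - s + og * (nb * (w - u))) s1 (SD_cst 1 qb))) => [y|v] /=.
    by rewrite /T !massE /coord/=; ring.
  rewrite mulr0 addr0 mul1r mulNr -mulrBr -sumrB mulr_sumr mxE; apply: eq_bigr => j _.
  by rewrite !mxE /Dm; ring.
have [CT [r4 [CT0 r40 hCT]]] := SD_lip SDT.
pose r := Num.min (Num.min r1 r2) (Num.min r3 r4).
have r0 : 0 < r by rewrite !lt_min r10 r20 r30 r40.
have hr q : `|q - qb| < r -> [/\ `|q - qb| < r1, `|q - qb| < r2, `|q - qb| < r3 & `|q - qb| < r4].
  by rewrite !lt_min => /andP[/andP[-> ->] /andP[-> ->]].
have hsT q : `|q - qb| < r -> O q /\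
    switches_at c b u w (s + T q) (gamma ^~ q) (rho q) (tau q).
  move=> /hr [q1 q2 q3 q4]; have [Oq _] := hr1 q q1; split=> //.
  have [t1 ht1 _] := hsw q q1 q2 q3.
  by rewrite (hT q t1 Oq ht1) subrKC.
have hLq q1 q2 t : `|q1 - qb| < r -> `|q2 - qb| < r -> u <= t <= w ->
    [/\ `|drift c (gamma t q1) - drift c (gamma t q2)| <= L * `|gamma t q1 - gamma t q2|,
        `|thrust c (gamma t q1) - thrust c (gamma t q2)| <= L * `|gamma t q1 - gamma t q2| &
        `|thrust c (gamma t q1) - thrust c zb| <= L * e].
  move=> /hr [a1 _ _ _] /hr [a2 _ _ _] tuw.
  have g1 := (hr1 q1 a1).2 t tuw; have g2 := (hr1 q2 a2).2 t tuw.
  have [k6 k7 _] := hL _ _ g1 g2; split=> //.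
  have gz : `|zb - zb| < e by rewrite subrr normr0.
  have [_ k8 _] := hL _ _ g1 gz.
  by apply: (le_trans k8); rewrite ler_wpM2l// ltW.
pose F := thrust c zb.
(* [Cu] accounts for the gap at [u], the other term for a thrust of size [|F|] up to error [L * e]
   acting between switches at most [CT |q1 - q2|] apart; the factor [2] is that of [sup_half]. *)
pose C := 2 * (Cu + (`|F| + L * e) * CT).
have Fe0 : 0 <= `|F| + L * e by rewrite addr_ge0// mulr_ge0// ltW.
have C0 : 0 <= C by rewrite mulr_ge0// addr_ge0// mulr_ge0.
have Luw : 2 * L * (w - u) <= 2^-1.
  have -> : w - u = 2 * h by rewrite /w /u; ring.
  have Lh : L * h <= 8^-1.
    apply: (le_trans (ler_wpM2l L0 k5)).
    by rewrite -[(8 * (L + 1))^-1]mul1r -[8^-1]mul1r; apply: shrink_le.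
  by apply: quarter_step.
(* [step_compare] needs ordered switching times; the other order follows at the end by exchanging
   [q1] and [q2]. *)
have lip q1 q2 : `|q1 - qb| < r -> `|q2 - qb| < r -> s + T q1 <= s + T q2 ->
    forall t, u <= t <= w -> `|gamma t q1 - gamma t q2| <= C * `|q1 - q2|.
  move=> hq1 hq2 T12.
  have [a1 b1 _ c1] := hr q1 hq1; have [a2 b2 _ c2] := hr q2 hq2.
  have [Oq1 s1] := hsT q1 hq1; have [Oq2 s2] := hsT q2 hq2.
  pose N t := `|gamma t q1 - gamma t q2|.
  pose V := `|q1 - q2|.
  have bound t : u <= t <= w -> N t <= e + e.
    move=> tuw; rewrite /N -(subrKA zb); apply: (le_trans (ler_normD _ _)).
    rewrite (distrC zb) lerD// ltW//; [exact: (hr1 q1 a1).2|exact: (hr1 q2 a2).2].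
  have step M : (forall t, u <= t <= w -> N t <= M) -> forall t, u <= t <= w ->
      N t <= (Cu + (`|F| + L * e) * CT) * V + M / 2.
    move=> hM t tuw; have /andP[ut tw] := tuw.
    have M0 : 0 <= M by apply: le_trans (hM u uu); exact: normr_ge0.
    have ptw t' : u <= t' <= w -> [/\ `|drift c (gamma t' q1) - drift c (gamma t' q2)| <= L * M,
        `|thrust c (gamma t' q1) - thrust c (gamma t' q2)| <= L * M,
        `|thrust c (gamma t' q1) - F| <= L * e & `|thrust c (gamma t' q2) - F| <= L * e].
      move=> tuw'; have [k6 k7 k8] := hLq q1 q2 t' hq1 hq2 tuw'.
      have [_ _ k9] := hLq q2 q1 t' hq2 hq1 tuw'.
      split=> //; [apply: (le_trans k6)|apply: (le_trans k7)];
        by rewrite ler_wpM2l//; exact: hM.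
    have := step_compare (hdyn Oq1) (hdyn Oq2) u0 (ltW uw) wtf T12 s1 s2 ptw tuw.
    set S := Num.max _ 0 - Num.max _ 0.
    have S0 : 0 <= S.
      by rewrite subr_ge0 ge_max le_max lerD2l lerN2 T12/= le_max lexx orbT.
    have SV : S <= CT * V.
      apply: (@le_trans _ _ `|T q1 - T q2|); last exact: hCT.
      apply: (le_trans (ler_norm _)); apply: (le_trans (max_lip _ _ _)).
      by rewrite le_eqVlt; apply/orP; left; apply/eqP; rewrite distrC; congr `|_|; ring.
    have ogn : `|og * S| = S.
      by rewrite normrM (ger0_norm S0) /og /orientation; case: (b); rewrite ?normrN normr1 mul1r.
    have hu : N u <= Cu * V by exact: hCu.
    set X := _ - _ - _ => hX.
    have : N t <= `|X| + `|(og * S) *: F| + N u.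
      have -> : N t = `|X + (og * S) *: F + (gamma u q1 - gamma u q2)|.
        by rewrite /X subrK subrK.
      apply: (le_trans (ler_normD _ _)); rewrite lerD2r; exact: ler_normD.
    rewrite normrZ ogn => hN.
    have h3 : 2 * (L * M) * (t - u) <= M / 2.
      have : 2 * L * (t - u) <= 2^-1.
        by apply: le_trans Luw; rewrite ler_wpM2l ?mulr_ge0// lerD2r.
      by move/(ler_wpM2r M0); congr (_ <= _); ring.
    have h4 : S * (`|F| + L * e) <= CT * V * (`|F| + L * e) by rewrite ler_wpM2r.
    exact: (lip_step hN hX hu h3 h4).
  move=> t tuw; rewrite /C -mulrA; exact: (sup_half (ltW uw) bound step tuw).
exists u, w, L, C, r, T, a; split=> //.
move=> q1 q2 hq1 hq2 t tuw; have [k6 k7 _] := hLq q1 q2 t hq1 hq2 tuw; split=> //.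
case: (leP (s + T q1) (s + T q2)) => [T12|/ltW T21]; first exact: lip.
by rewrite distrC (distrC q1); exact: lip.
Qed.

Variables (Jm Jp : 'M[R]_7).
Hypothesis hJm : dxdq gamma t qb @[t --> s^'-] --> Jm.
Hypothesis hJp : dxdq gamma t qb @[t --> s^'+] --> Jp.

(** The vector [D]: the state part of the thrust at the switch, with sign [+] when the engine is
    switched on. *)
Definition jump : 'cV[R]_7 := orientation b *: (thrust c zb).1.

(** Both estimates come from [step_compare] started at [u]: stopped at [s] it yields the expansion
    of the state with its kink, stopped at [w], after both switches, it relates [Jp], [Jm] and [T].
    Shrinking [[u, w]] around [s] brings the Jacobians at its ends close to [Jm] and [Jp]. *)
Lemma switching_expansion (u0 w0 L C r0 : R) T a :
  switching_data u0 w0 L C r0 T a ->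
  forall e : R, 0 < e -> exists2 r : R, 0 < r & forall q1 q2,
    `|q1 - qb| < r -> `|q2 - qb| < r ->
    `|(gamma s q1).1 - (gamma s q2).1 - Jm *m (q1 - q2)^T +
      (Num.min (T q1) 0 - Num.min (T q2) 0) *: jump| <= e * `|q1 - q2| /\
    `|(Jp - Jm) *m (q1 - q2)^T + (T q1 - T q2) *: jump| <= e * `|q1 - q2|.
Proof.
move=> [[u00 u0s sw0 w0tf] [L0 C0 r00] [T0 SDT] hsw hlip] e e0.
have [CT [rT [CT0 rT0 hCT]]] := SD_lip SDT.
pose e1 := e / (17 + CT).
have CT17 : 0 < 17 + CT by rewrite ltr_wpDr.
have e10 : 0 < e1 by rewrite divr_gt0.
have /andP[s0 stf] := s0tf.
have Xzb := dyn_X (hdyn Oqb) s_in.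
have pv0 := regular_vel (hdyn Oqb) s0tf hreg.
have m0 : mass zb.1 != 0 by rewrite gt_eqF// (X_mass_gt0 Xzb).
have [eta eta0 hthrust] := thrust_continuous c m0 pv0 e10.
have [d1 d10 hclose] := family_close eta0.
have [d2 d20 hC] := hC1.
have [d3 d30 hleft] := at_left_dist (cvgr_dist_lt _ _ hJm _ e10).
have [d4 d40 hright] := at_right_dist (cvgr_dist_lt _ _ hJp _ e10).
have LC0 : 0 <= L * C by rewrite mulr_ge0.
have k5 : 0 < e1 / (4 * (L * C + 1)) by rewrite divr_gt0// mulr_gt0// ltr_wpDl.
pose m := Num.min (Num.min (Num.min d1 d2) (Num.min d3 d4))
   (Num.min (Num.min (s - u0) (w0 - s)) (e1 / (4 * (L * C + 1)))).
have mp : 0 < m by rewrite !lt_min d10 d20 d30 d40 k5 !subr_gt0 u0s sw0.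
pose h := m / 2.
have h0 : 0 < h by rewrite divr_gt0.
have hm : h < m by rewrite ltr_pdivrMr// ltr_pMr// ltr1n.
have := hm; rewrite /m !lt_min -!andbA => /and5P[hd1 hd2 hd3 hd4 /and3P[hu0 hw0 he1]].
pose u := s - h; pose w := s + h.
have us : u < s by rewrite gtrBl.
have sw : s < w by rewrite ltrDl.
have uw : u <= w by rewrite ltW// (lt_trans us).
have u0u : u0 <= u by rewrite lerBrDr addrC -lerBrDr ltW.
have ww0 : w <= w0 by rewrite /w addrC -lerBrDr ltW.
have u_ge0 : 0 <= u := le_trans u00 u0u.
have wtf : w <= tf := le_trans ww0 w0tf.
have uu : u <= u <= w by rewrite lexx.
have wwi : u <= w <= w by rewrite lexx andbT.
have suw : u <= s <= w by rewrite !ltW.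
have wu : w - u = 2 * h by rewrite /w /u; ring.
have C1u : C1_at (gamma u) qb.
  by apply: hC; rewrite /u addrAC subrr add0r normrN (gtr0_norm h0) h0.
have C1w : C1_at (gamma w) qb.
  by apply: hC; rewrite /w addrAC subrr add0r (gtr0_norm h0) h0.
have du : s - d1 < u by rewrite /u ltrD2l ltrN2.
have wd : w < s + d1 by rewrite /w ltrD2l.
have [r1 r10 hr1] := hclose u w du (ltW us) (ltW sw) wd C1u.
have Ju : `|Jm - dxdq gamma u qb| < e1 by apply: hleft => //; rewrite /u ltrD2l ltrN2.
have Jw : `|Jp - dxdq gamma w qb| < e1 by apply: hright => //; rewrite /w ltrD2l.
have [r2 r20 hr2] := C1_state_strict C1u e10.
have [r3 r30 hr3] := C1_state_strict C1w e10.
have CT1 : 0 < CT + 1 by rewrite ltr_wpDl.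
have r40 : 0 < h / (CT + 1) by rewrite divr_gt0.
(* The bound [h / (CT + 1)] forces [|T q| <= h], so that the switch still falls in the shorter
   window [[u, w]]. *)
pose r := Num.min (Num.min (Num.min r0 r1) (Num.min r2 r3)) (Num.min rT (h / (CT + 1))).
exists r; first by rewrite !lt_min r00 r10 r20 r30 rT0 r40.
have hr q : `|q - qb| < r -> [/\ `|q - qb| < r0, `|q - qb| < r1, `|q - qb| < r2,
    `|q - qb| < r3 & `|q - qb| < rT /\ `|q - qb| < h / (CT + 1)].
  by rewrite !lt_min -!andbA => /and5P[-> -> -> -> /andP[-> ->]].
have hstep q : `|q - qb| < r -> O q /\
    switches_at c b u w (s + T q) (gamma ^~ q) (rho q) (tau q).
  move=> /hr[q0 _ _ _ [qT qh]]; have [Oq [_ hq]] := hsw q q0; split=> //.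
  have Th : `|T q| <= h.
    rewrite -[T q]subr0 -T0.
    apply: (le_trans (hCT _ _ qT _)); first by rewrite subrr normr0.
    apply: (le_trans (ler_wpM2l CT0 (ltW qh))).
    by rewrite -{2}[h]divr1 -[CT + 1]mul1r; apply: shrink_le => //; exact: ltW.
  move: Th; rewrite ler_norml => /andP[Th1 Th2].
  split; first by rewrite /u /w !lerD2l Th1.
  move=> t /andP[ut tw]; apply: hq.
  by rewrite (le_trans u0u ut) (le_trans tw ww0).
(* The constant is [8 = 1 + 7], with [7] the dimension factor of [mulmx_norm_le]. *)
have approx (J J' : 'M[R]_7) t q1 q2 : `|J' - J| < e1 ->
    `|(gamma t q1).1 - (gamma t q2).1 - J *m (q1 - q2)^T| <= e1 * `|q1 - q2| ->
    `|(gamma t q1).1 - (gamma t q2).1 - J' *m (q1 - q2)^T| <= 8 * (e1 * `|q1 - q2|).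
  move=> hJ hx.
  have -> : (gamma t q1).1 - (gamma t q2).1 - J' *m (q1 - q2)^T =
    ((gamma t q1).1 - (gamma t q2).1 - J *m (q1 - q2)^T) - (J' - J) *m (q1 - q2)^T.
    by rewrite mulmxBl opprB addrA subrK.
  apply: (le_trans (ler_normB _ _)).
  have h7 : `|(J' - J) *m (q1 - q2)^T| <= 7%:R * (e1 * `|q1 - q2|).
    apply: (le_trans (mulmx_norm_le _ _)); rewrite norm_trmx -mulrA ler_wpM2l//.
    by rewrite ler_wpM2r// ltW.
  apply: (le_trans (lerD hx h7)).
  by rewrite -{1}[e1 * _]mul1r -mulrDl -[1]/(1%:R) -natrD.
have ordered q1 q2 : `|q1 - qb| < r -> `|q2 - qb| < r -> T q1 <= T q2 ->
    `|(gamma s q1).1 - (gamma s q2).1 - Jm *m (q1 - q2)^T +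
      (Num.min (T q1) 0 - Num.min (T q2) 0) *: jump| <= e * `|q1 - q2| /\
    `|(Jp - Jm) *m (q1 - q2)^T + (T q1 - T q2) *: jump| <= e * `|q1 - q2|.
  move=> hq1 hq2 T12.
  have [a0 a1 a2 a3 [aT _]] := hr q1 hq1; have [b0 b1 b2 b3 [bT _]] := hr q2 hq2.
  have [Oq1 s1] := hstep q1 hq1; have [Oq2 s2] := hstep q2 hq2.
  set V := `|q1 - q2|.
  have V0 : 0 <= V by exact: normr_ge0.
  have ptw t : u <= t <= w ->
     [/\ `|drift c (gamma t q1) - drift c (gamma t q2)| <= L * C * V,
     `|thrust c (gamma t q1) - thrust c (gamma t q2)| <= L * C * V,
     `|thrust c (gamma t q1) - thrust c zb| <= e1 & `|thrust c (gamma t q2) - thrust c zb| <= e1].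
    move=> /andP[ut tw].
    have tuw0 : u0 <= t <= w0 by rewrite (le_trans u0u ut) (le_trans tw ww0).
    have [k1 k2 k3] := hlip q1 q2 a0 b0 t tuw0.
    have k4 := ler_wpM2l L0 k1; rewrite mulrA in k4.
    have tuw : u <= t <= w by rewrite ut.
    split; [exact: le_trans k2 k4|exact: le_trans k3 k4| |].
      by apply: hthrust; exact: (hr1 q1 a1).2.
    by apply: hthrust; exact: (hr1 q2 b1).2.
  have sT12 : s + T q1 <= s + T q2 by rewrite lerD2l.
  have cmp := step_compare (hdyn Oq1) (hdyn Oq2) u_ge0 uw wtf sT12 s1 s2 ptw.
  have TV : T q2 - T q1 <= CT * V.
    by apply: (le_trans (ler_norm _)); rewrite distrC; exact: hCT.
  have cmp1 t S : u <= t <= w -> S <= T q2 - T q1 ->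
      Num.max (t - (s + T q1)) 0 - Num.max (t - (s + T q2)) 0 = S ->
      `|(gamma t q1).1 - (gamma t q2).1 - ((gamma u q1).1 - (gamma u q2).1) - S *: jump| <=
      (1 + CT) * (e1 * V).
    move=> tuw ST ES; have := cmp t tuw; rewrite ES => hX.
    have := le_trans (fst_norm_le _) hX.
    rewrite /= /jump scalerA mulrC => {}hX; apply: (le_trans hX).
    have /andP[ut tw] := tuw.
    have k1 : 2 * (L * C * V) * (t - u) <= e1 * V.
      have k2 : L * C * h <= e1 / 4.
        apply: (le_trans (ler_wpM2l LC0 (ltW he1))).
        by apply: shrink_le => //; exact: ltW.
      have k3 : t - u <= 2 * h by rewrite -wu lerD2r.
      have k4 : 2 * (L * C * V) * (t - u) <= 2 * (L * C * V) * (2 * h).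
        by rewrite ler_wpM2l// !mulr_ge0.
      apply: (le_trans k4).
      have -> : 2 * (L * C * V) * (2 * h) = (4 * (L * C * h)) * V by ring.
      by rewrite ler_wpM2r// mulrC -ler_pdivlMr.
    have k2 : e1 * S <= CT * (e1 * V).
      by rewrite mulrCA ler_wpM2l ?(ltW e10)// (le_trans ST).
    by rewrite [leRHS]mulrDl [1 * _ in leRHS]mul1r; exact: lerD.
  have xu := approx _ _ u q1 q2 Ju (hr2 _ _ a2 b2).
  have xw := approx _ _ w q1 q2 Jw (hr3 _ _ a3 b3).
  have e1V : (17 + CT) * (e1 * V) = e * V.
    by rewrite mulrA /e1 (mulrC (17 + CT)) divfK// gt_eqF.
  have e1V0 : 0 <= e1 * V by rewrite mulr_ge0// ltW.
  split.
    (* At time [s], only an extremal with [T q < 0] has already switched; this is the origin of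
       [min (T q, 0)]. *)
    have ES : Num.max (s - (s + T q1)) 0 - Num.max (s - (s + T q2)) 0 =
        - (Num.min (T q1) 0 - Num.min (T q2) 0).
      have negmax x : Num.max (s - (s + x)) 0 = - Num.min x 0.
        by rewrite opprD addrA subrr add0r oppr_min oppr0.
      by rewrite !negmax opprB addrC opprK.
    have SL : - (Num.min (T q1) 0 - Num.min (T q2) 0) <= T q2 - T q1.
      rewrite opprB; apply: (le_trans (ler_norm _)); apply: (le_trans (min_lip _ _ _)).
      by rewrite ger0_norm ?subr_ge0.
    have := cmp1 s _ suw SL ES; rewrite scaleNr opprK => hX.
    have -> : (gamma s q1).1 - (gamma s q2).1 - Jm *m (q1 - q2)^T +
        (Num.min (T q1) 0 - Num.min (T q2) 0) *: jump =
      ((gamma s q1).1 - (gamma s q2).1 - ((gamma u q1).1 - (gamma u q2).1) +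
        (Num.min (T q1) 0 - Num.min (T q2) 0) *: jump) +
      ((gamma u q1).1 - (gamma u q2).1 - Jm *m (q1 - q2)^T).
      by apply/matrixP => i j; rewrite !mxE; ring.
    apply: (le_trans (ler_normD _ _)); apply: (le_trans (lerD hX xu)).
    by rewrite -mulrDl -e1V ler_wpM2r// budget_le1.
  have ES : Num.max (w - (s + T q1)) 0 - Num.max (w - (s + T q2)) 0 = T q2 - T q1.
    rewrite !max_l; first ring.
      by rewrite subr_ge0; case: s2 => /andP[].
    by rewrite subr_ge0; case: s1 => /andP[].
  have := cmp1 w _ wwi (lexx _) ES => hX.
  have -> : (Jp - Jm) *m (q1 - q2)^T + (T q1 - T q2) *: jump =
    ((gamma w q1).1 - (gamma w q2).1 - ((gamma u q1).1 - (gamma u q2).1) -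
      (T q2 - T q1) *: jump) -
    ((gamma w q1).1 - (gamma w q2).1 - Jp *m (q1 - q2)^T) +
    ((gamma u q1).1 - (gamma u q2).1 - Jm *m (q1 - q2)^T).
    by rewrite mulmxBl -(opprB (T q1)) scaleNr; apply/matrixP => i j; rewrite !mxE; ring.
  apply: (le_trans (ler_normD _ _)); apply: (le_trans (lerD (ler_normB _ _) (lexx _))).
  apply: (le_trans (lerD (lerD hX xw) xu)).
  by rewrite -!mulrDl -e1V ler_wpM2r// budget_le2.
move=> q1 q2 hq1 hq2; case: (leP (T q1) (T q2)) => [T12|/ltW T21]; first exact: ordered.
have [hA hB] := ordered q2 q1 hq2 hq1 T21; rewrite (distrC q1).
have vE : (q1 - q2)^T = - (q2 - q1)^T by rewrite -linearN/= opprB.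
split.
  rewrite vE mulmxN -[`|_|]normrN; move: hA; congr (`|_| <= _).
  by apply/matrixP => i j; rewrite !mxE; ring.
rewrite vE mulmxN -[`|_|]normrN; move: hB; congr (`|_| <= _).
by apply/matrixP => i j; rewrite !mxE; ring.
Qed.

(** Inserting the differential of [T] into the second estimate of [switching_expansion] makes
    [Jp - Jm + jump a] smaller than any [e], hence zero; the determinant condition then has the form
    that [piecewise_surjection] expects. *)
Lemma switching_surjection : \det Jp * \det Jm > 0 ->
  \forall y \near (gamma s qb).1, exists2 q, O q & (gamma s q).1 = y.
Proof.
move=> hdet.
have [u [w [L [C [r [T [a hdata]]]]]]] := switching_data_exists.
have hexp := switching_expansion hdata.
have [_ _ [T0 SDT] _ _] := hdata.
have JpE : Jp = Jm - jump *m a.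
  apply/eqP; rewrite -subr_eq0; apply/eqP.
  apply: mx_eq0_littleo => e e0.
  have e'0 : 0 < e / (1 + `|jump|) by rewrite divr_gt0// ltr_wpDr.
  have [r1 r10 h1] := hexp _ e'0; have [_ hs] := SDT; have [r2 r20 h2] := hs _ e'0.
  exists (Num.min r1 r2) => [|v]; first by rewrite lt_min r10.
  rewrite lt_min => /andP[v1 v2].
  have vq : qb + v - qb = v by rewrite addrAC subrr add0r.
  have [_ hB] := h1 (qb + v) qb ltac:(by rewrite vq) ltac:(by rewrite subrr normr0).
  have hT := h2 (qb + v) qb ltac:(by rewrite vq) ltac:(by rewrite subrr normr0).
  rewrite vq in hB hT.
  have -> : (Jp - (Jm - jump *m a)) *m v^T = ((Jp - Jm) *m v^T + (T (qb + v) - T qb) *: jump) -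
      (T (qb + v) - T qb - (a *m v^T) 0 0) *: jump.
    have -> : (Jp - (Jm - jump *m a)) *m v^T = (Jp - Jm) *m v^T + ((a *m v^T) 0 0) *: jump.
      rewrite opprB addrA addrAC mulmxDl; congr (_ + _).
      by rewrite -mulmxA [a *m v^T]mx11_scalar mul_mx_scalar !mxE mulr1n.
    by rewrite -addrA -scalerBl opprB addrCA subrr addr0.
  apply: (le_trans (ler_normB _ _)); rewrite normrZ.
  apply: (le_trans (lerD hB (ler_wpM2r (normr_ge0 jump) hT))).
  rewrite le_eqVlt; apply/orP; left; apply/eqP; field.
  by rewrite gt_eqF// ltr_wpDr.
apply: (@piecewise_surjection _ _ (fun q => (gamma s q).1) T Jm jump a qb O) => //.
- by rewrite -JpE.
- exact: SDT.2.
move=> e e0; have [r1 r10 h1] := hexp e e0; exists r1 => // q1 q2 hq1 hq2.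
exact: (h1 q1 q2 hq1 hq2).1.
Qed.

End Family.

Lemma smooth_surjection (R : realType)
    (gamma : R -> 'rV[R]_7 -> 'cV[R]_7 * 'cV[R]_7) (O : set 'rV[R]_7) qb t :
  nbhs qb O -> C1_at (gamma t) qb -> \det (dxdq gamma t qb) != 0 ->
  \forall y \near (gamma t qb).1, exists2 q, O q & (gamma t q).1 = y.
Proof.
move=> hO C1g d0.
apply: (@piecewise_surjection _ _ (fun q => (gamma t q).1) (fun=> 0)
  (dxdq gamma t qb) 0 0 qb O) => //.
- by rewrite mulmx0 subr0 -expr2 exprn_even_gt0.
- by have [_] := SD_cst 0 qb; congr strict_diff; apply/funext => v; rewrite mul0mx mxE.
move=> e e0; have [r r0 hr] := C1_state_strict C1g e0; exists r => // q1 q2 h1 h2.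
by rewrite scaler0 addr0; exact: hr.
Qed.

(** The nominal curve coincides with [gamma ^~ qbar] only on [[0, tf]], so regularity is transferred
    through equality near [s]. *)
Lemma eq_regular_switching (R : realType) (c : constants R)
    (x p x' p' : R -> 'cV[R]_7) (s : R) :
  (\forall t \near s, x t = x' t /\ p t = p' t) ->
  regular_switching c x p s -> regular_switching c x' p' s.
Proof.
move=> heq [h0 h1 h2]; have [xs ps] := nbhs_singleton heq.
have near_eq : \forall t \near s,
    (fun t => H1 c (x t) (p t) : R^o) t = (fun t => H1 c (x' t) (p' t) : R^o) t.
  by near=> t; have [-> ->] : x t = x' t /\ p t = p' t by near: t.
split.
- by rewrite -xs -ps.
- by apply: near_eq_derivable h1.
by rewrite -(near_eq_derive _ near_eq).
Unshelve. all: by end_near. Qed.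

Theorem corollary1 (R : realType) (c : constants R) (tf : R) (htf : 0 < tf)
  (l : nat) (hl : (0 < l <= 7)%N) (phi : 'cV[R]_7 -> 'cV[R]_l)
  (hphi : forall x, X c x -> C2_at phi x)
  (x0 : 'cV[R]_7) (hx0 : (X c `\` M c phi) x0)
  (* nominal extremal *)
  (xbar pbar : R -> 'cV[R]_7) (hxbar0 : xbar 0 = x0)
  (hrank : \rank (dphi phi (xbar tf)) = l)
  (* parameterized family *)
  (N : set ('cV[R]_7 * 'cV[R]_7))
  (hN : exists2 W : set ('cV[R]_7 * 'cV[R]_7), open W & N = Lf c phi `&` W)
  (hNbar : N (xbar tf, pbar tf))
  (F : 'cV[R]_7 * 'cV[R]_7 -> 'rV[R]_7)
  (Finv : 'rV[R]_7 -> 'cV[R]_7 * 'cV[R]_7)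
  (hF : chart N F Finv)
  (gamma : R -> 'rV[R]_7 -> 'cV[R]_7 * 'cV[R]_7)
  (rho : 'rV[R]_7 -> R -> R) (tau : 'rV[R]_7 -> R -> 'cV[R]_3)
  (hext : forall q, (F @` N) q ->
    extremal c phi tf (fun t => (gamma t q).1) (fun t => (gamma t q).2)
      (rho q) (tau q))
  (hend : forall q, (F @` N) q -> gamma tf q = Finv q)
  (hbang : forall q, (F @` N) q -> bang_bang tf (rho q))
  (hC1 : forall q, (F @` N) q -> forall t, 0 <= t <= tf ->
    ~ switching_time tf (rho q) t -> C1_at (gamma t) q)
  (qbar : 'rV[R]_7) (hqbar : qbar = F (xbar tf, pbar tf))
  (hnom : forall t, 0 <= t <= tf -> gamma t qbar = (xbar t, pbar t))
  (* switching times on [t0, tf] *)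
  (t0 : R) (ht0 : 0 <= t0 < tf)
  (k : nat) (ts : k.-tuple R) (hts : sorted <%R (t0 :: rcons ts tf))
  (hsw : forall s, t0 <= s <= tf ->
    (switching_time tf (rho qbar) s <-> s \in ts))
  (hreg : forall s, s \in ts -> regular_switching c xbar pbar s)
  (* reachability of the target *)
  (hreach : forall s, 0 <= s < tf -> \forall xs \near xbar s,
    (X c `\` M c phi) xs ->
    exists2 xf, M c phi xf & (tmin c xs xf <= (tf - s)%:E)%E)
  (* one-sided limits of dx/dq at the switching times *)
  (Jm Jp : R -> 'M[R]_7)
  (hJm : forall s, s \in ts -> dxdq gamma t qbar @[t --> s^'-] --> Jm s)
  (hJp : forall s, s \in ts -> dxdq gamma t qbar @[t --> s^'+] --> Jp s)
  (h1 : forall t, t0 <= t < tf -> t \notin ts -> \det (dxdq gamma t qbar) != 0)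
  (h1ts : forall s, s \in ts -> \det (Jm s) != 0 /\ \det (Jp s) != 0)
  (h2 : forall s, s \in ts -> \det (Jp s) * \det (Jm s) > 0) :
  forall t, t0 <= t < tf -> \forall xs \near xbar t,
    (X c `\` M c phi) xs ->
    exists2 qs, (F @` N) qs & xs = (gamma t qs).1.
Proof.
have [_ _ oFN _] := hF.
have qbarFN : (F @` N) qbar by exists (xbar tf, pbar tf).
have nFN : nbhs qbar (F @` N) by exact: open_nbhs_nbhs.
have /andP[t0_ge0 t0tf] := ht0.
have tf0 := ltW htf.
have hdyn q : (F @` N) q -> dynamics c tf (gamma ^~ q) (rho q) (tau q).
  by move=> hq; exact: extremal_dynamics tf0 (hext _ hq).
have ts_between s : s \in ts -> t0 < s < tf.
  (* The pairwise form of sortedness compares each switching time directly with both ends [t0] and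
     [tf]. *)
  move: hts; rewrite (sorted_pairwise lt_trans) /= all_rcons pairwise_rcons.
  by move=> /andP[/andP[_ /allP h] /andP[/allP h' _]] sts; rewrite h//= h'.
have C1_off t : t0 <= t <= tf -> t \notin ts -> C1_at (gamma t) qbar.
  move=> /andP[t0t ttf] tts; apply: hC1 => //; first by rewrite (le_trans t0_ge0).
  by move/(hsw t (introT andP (conj t0t ttf))); apply/negP.
move=> t /andP[t0t ttf].
have t0f : 0 <= t <= tf by rewrite (le_trans t0_ge0 t0t) ltW.
suff : \forall y \near (gamma t qbar).1, exists2 q, (F @` N) q & (gamma t q).1 = y.
  rewrite hnom//=; apply: filterS => xs [q hq <-] _; by exists q.
have [tts|tts] := boolP (t \in ts); last first.
  by apply: smooth_surjection => //; [apply: C1_off => //; rewrite t0t ltW|apply: h1 => //; rewrite t0t].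
have /andP[t0t' _] := ts_between t tts.
have t_in : 0 < t < tf by rewrite ttf (le_lt_trans t0_ge0).
have reg : regular_switching c (fun t' => (gamma t' qbar).1) (fun t' => (gamma t' qbar).2) t.
  apply: eq_regular_switching (hreg _ tts).
  have : \forall t' \near t, t' \in `]0, tf[ by apply: near_in_itvoo; rewrite in_itv.
  apply: filterS => t'; rewrite in_itv/= => /andP[t'0 t'f].
  by rewrite hnom// !ltW.
(* Within [d] of [t] there is no other switching time and no endpoint; [1] is the default value when
   [t] is the only switching time. *)
pose d := Num.min (Num.min (t - t0) (tf - t))
  (\big[Num.min/1]_(i < k | tnth ts i != t) `|tnth ts i - t|).
have C1_near : exists2 d : R, 0 < d &
    forall t', 0 < `|t' - t| < d -> C1_at (gamma t') qbar.
  exists d.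
    rewrite !lt_min !subr_gt0 t0t' ttf/=; apply/bigmin_gtP; split=> // i it.
    by rewrite normr_gt0 subr_eq0.
  move=> t'; rewrite !lt_min -!andbA => /and4P[t't dl dr /bigmin_gtP[_ hts']].
  apply: C1_off.
    move: dl dr; rewrite !ltr_norml; lra.
  apply/negP => /tnthP[i t'E].
  have it : tnth ts i != t by rewrite -t'E -subr_eq0 -normr_gt0.
  by have := hts' i it; rewrite t'E ltxx.
exact: (switching_surjection nFN hdyn t_in reg C1_near (hJm _ tts) (hJp _ tts) (h2 _ tts)).
Qed.
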